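(* Let $\alpha\in(0,1)$, let $\Gamma_0$ be a compact hypersurface of class $buc^{2+\alpha}$ bounding the domain $\Omega_0\subset\mathbb{R}^n$, let $f\in\operatorname{C}^\infty(\mathbb{R}^n,\mathbb{R})$, and let $u_0\in buc^{2+\alpha}(\Omega_0)$. Consider the Stefan type moving boundary problem for $(u(t,\cdot),\Gamma(t))$, $\Gamma(t)=\partial\Omega(t)$, $$\begin{cases}u_t-\Delta u=f&\text{in }\Omega(t),\ t>0,\\ u=0&\text{on }\Gamma(t),\ t>0,\\ u(0,\cdot)=u_0&\text{in }\Omega_0,\\ V=-\partial_\nu u&\text{on }\Gamma(t),\ t>0,\\ \Gamma(0)=\Gamma_0,\end{cases}$$ where $V$ is the velocity of $\Gamma(t)$ in the direction of its outward unit normal $\nu$. Then the linearization of this system in $(u(t,\cdot),\Gamma(t))\equiv(u_0,\Gamma_0)$ (as defined in the context, with unknowns $(\bar w,\nu_\varphi)$) is $$\begin{cases}\bar w_t-\Delta\bar w=0&\text{in }\Omega_0,\ t>0,\\ \bar w=-\partial_{\nu_\varphi}u_0&\text{on }\Gamma_0,\ t>0,\\ \bar w(0,\cdot)=0&\text{in }\Omega_0,\\ \nu_0\cdot\dot\nu_\varphi=-\partial_{\nu_0}\partial_{\nu_\varphi}u_0-\partial_{\nu_0}\bar w&\text{on }\Gamma_0,\ t>0,\\ \nu_\varphi(0,\cdot)=0&\text{on }\Gamma_0.\end{cases}$$ For $\nu_\varphi=h\,\nu^\delta$ with $h=h(t,y)$, $y\in\Gamma_0$, this reduces, in coordinates,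 to a system for $(\bar w,h)$ via $$\partial_{\nu_\varphi}u_0=(\partial_{\nu^\delta}u_0)\,h\quad\text{and}\quad\nu_0\cdot\dot\nu_\varphi=(\nu^\delta\cdot\nu_0)\,\dot h.$$
   Context: For $O\subset\mathbb{R}^n$ open, the little Hölder space $buc^{k+\alpha}(O)$ is the closure of $\operatorname{BUC}^{k+\beta}(O)$, $\beta>\alpha$, in the usual $C^{k+\alpha}$ Hölder norm. $\nu_0$ is the unit outward normal of $\Gamma_0$ and $\partial_vg=v\cdot\nabla g$. The expression $\partial_{\nu_0}\partial_{\nu_\varphi}u_0$ is an iterated derivative: $\partial_{\nu_0}$ is applied on $\Gamma_0$ to the function $\nu_\varphi\cdot\nabla u_0$, so the field $\nu_\varphi$ is differentiated as well; here $\nu_\varphi$ is thought of as defined in a neighborhood of $\Gamma_0$ (by the same $s$-derivative of the deforming diffeomorphisms). Linearization: let $\varphi_{s,t}$ be a two-parameter family of diffeomorphisms with $\varphi_{0,t}=\operatorname{id}$ for all $t$; set $\Omega_{s,t}=\varphi_{s,t}(\Omega_0)$, $\Gamma_{s,t}=\varphi_{s,t}(\Gamma_0)$, $$\nu_\varphi=\left.\tfrac{d}{ds}\right|_{s=0}\varphi_{s,t}\big|_{\Gamma_0},\qquad \dot\nu_\varphi=\tfrac{d}{dt}\left.\tfrac{d}{ds}\right|_{s=0}\varphi_{s,t}\big|_{\Gamma_0}.$$ It is assumed, without loss of generality, that the diffeomorphisms flow into $\Omega_0$. Write the unknown function on $\Omega_{s,t}$ as $u=u_0+\bar u$ and set $\bar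 v=\varphi_{s,t}^*\bar u=\bar u\circ\varphi_{s,t}$, with $\bar v=0$ for $s=0$. With $\varphi^{s,t}_*=(\varphi_{s,t}^* )^{-1}$, the initial boundary value problem for $u$ is taken in the form $$\varphi_{s,t}^*(\partial_t-\Delta)\varphi^{s,t}_*\bar v=0\text{ in }\Omega_0,\quad \bar v=-\varphi_{s,t}^*(u_0|_{\Gamma_{s,t}})\text{ on }\Gamma_0,\quad \bar v(0,\cdot)=0\text{ in }\Omega_0,$$ and the condition on the normal velocity in the form $$\tfrac{d}{dt}\varphi_{s,t}\cdot\varphi_{s,t}^*\nu_{\Gamma_{s,t}}=-\varphi_{s,t}^*\bigl[\partial_{\nu_{\Gamma_{s,t}}}u_0+\partial_{\nu_{\Gamma_{s,t}}}\bar u\bigr]\text{ on }\Gamma_0,$$ where $\nu_{\Gamma_{s,t}}$ is the unit outward normal of $\Gamma_{s,t}$. The linearization in $(u_0,\Gamma_0)$ is the system for $\bar w=\left.\frac{d}{ds}\right|_{s=0}\bar v$ and $\nu_\varphi$ obtained by equating the derivatives with respect to $s$ at $s=0$ of both sides of these equations. Regularized normal field: choose $\tilde r_0>0$ such that $(y,r)\mapsto y+r\nu_0(y)$ is a diffeomorphism from $\Gamma_0\times(-\tilde r_0,\tilde r_0)$ onto the tubular neighborhood $\{x:|d(x,\Gamma_0)|<\tilde r_0\}$, with inverse $x\mapsto(y(x),r(x))$. Let $\eta:\mathbb{R}\to[0,1]$ be smooth, equal to $1$ on $[-\tilde r_0/2,\tilde r_0/2]$ and $0$ outside $(-3\tilde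 r_0/4,3\tilde r_0/4)$, set $\widetilde\nu(x)=\eta(r(x))\nu_0(y(x))$ in the tubular neighborhood and $\widetilde\nu=0$ elsewhere, and let $\nu^\delta=\psi_\delta*\widetilde\nu$ (a smooth field on $\mathbb{R}^n$) with $\psi_\delta$ a compactly supported smooth mollifier, $\delta>0$ small.
   Formalization: The linearization is proved when u_0=0 and (ν_0·∂_{ν_0}ν_φ)∂_{ν_0}u_0=0 on Γ_0, as holds if (u_0,Γ_0) is a solution; otherwise the fourth equation can fail (u_0=1-x² on (-1,1)); φ is taken C², v̄ C³ inside and C² up to Γ_0. *)

(* Defs.v *)
From HB Require Import structures.
From mathcomp Require Import all_boot all_order all_algebra.
From mathcomp Require Import all_classical all_reals all_analysis.
Import Order.TTheory GRing.Theory Num.Theory.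
Import numFieldNormedType.Exports.

Set Implicit Arguments.
Unset Strict Implicit.
Unset Printing Implicit Defensive.

Local Open Scope classical_set_scope.
Local Open Scope ring_scope.

(* The norm that the library puts on row vectors is the sup norm. *)
Definition dot (R : realType) (n : nat) (u v : 'rV[R]_n) : R :=
  \sum_(i < n) u 0 i * v 0 i.

Definition enorm (R : realType) (n : nat) (u : 'rV[R]_n) : R :=
  Num.sqrt (dot u u).

Definition ebase (R : realType) (n : nat) (i : 'I_n) : 'rV[R]_n :=
  delta_mx 0 i.

Definition grad (R : realType) (n : nat) (f : 'rV[R]_n -> R)
  (x : 'rV[R]_n) : 'rV[R]_n := \row_i 'D_(ebase R i) f x.

Definition laplacian (R : realType) (n : nat) (f : 'rV[R]_n -> R)
  (x : 'rV[R]_n) : R := \sum_(i < n) 'D_(ebase R i) ('D_(ebase R i) f) x.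

(* C^k on O, for finite-dimensional V: all iterated directional derivatives of
   order at most k exist and are continuous at the points of O.  The set O is
   meant to be open. *)
Fixpoint Ck (R : realType) (V W : normedModType R) (k : nat) (O : set V)
    (f : V -> W) : Prop :=
  if k is k'.+1 then
    (forall x, O x -> differentiable f x) /\ (forall v, Ck k' O ('D_v f))
  else forall x, O x -> {for x, continuous f}.

(* C^k on a set D which need not be open (closed domains, one-sided
   parameters): f is on D the restriction of a function that is C^k on an open
   set containing D. *)
Definition Ck_upto (R : realType) (V W : normedModType R) (k : nat)
    (D : set V) (f : V -> W) : Prop :=
  exists (O : set V) (g : V -> W),
    [/\ open O, D `<=` O, Ck k O g & {in D, f =1 g}].

Definition smooth (R : realType) (V W : normedModType R) (f : V -> W) : Prop :=
  forall k, Ck k setT f.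

(* Right derivative at 0; the parameter s of the deformations is nonnegative,
   see [flows_into] below. *)
Definition is_rderiv0 (R : realType) (W : normedModType R) (F : R -> W)
  (l : W) : Prop := h^-1 *: (F h - F 0) @[h --> 0^'+] --> l.

Definition rderiv0 (R : realType) (W : normedModType R) (F : R -> W) : W :=
  lim (h^-1 *: (F h - F 0) @[h --> 0^'+]).

(* Functions on a domain Omega are total functions whose values off Omega are
   irrelevant.  Their values and gradients on the boundary are the continuous
   extensions from inside. *)
Definition bext (R : realType) (n : nat) (Omega : set 'rV[R]_n)
  (f : 'rV[R]_n -> R) (x : 'rV[R]_n) : R := lim (f @ within Omega (nbhs x)).

Definition bgrad (R : realType) (n : nat) (Omega : set 'rV[R]_n)
  (f : 'rV[R]_n -> R) (x : 'rV[R]_n) : 'rV[R]_n :=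
  \row_i bext Omega ('D_(ebase R i) f) x.

(* The derivative v . grad f of a function f on Omega along a vector field v, as
   a function on the closure of Omega.  It can be iterated, and then the field
   of the inner derivative is differentiated too. *)
Definition dder (R : realType) (n : nat) (Omega : set 'rV[R]_n)
  (v : 'rV[R]_n -> 'rV[R]_n) (f : 'rV[R]_n -> R) (x : 'rV[R]_n) : R :=
  dot (v x) (bgrad Omega f x).

Definition pderivs (R : realType) (n : nat) (l : seq 'I_n)
  (f : 'rV[R]_n -> R) : 'rV[R]_n -> R :=
  foldr (fun i g => 'D_(ebase R i) g) f l.

Definition sup_norm_Ck (R : realType) (n k : nat) (O : set 'rV[R]_n)
  (f : 'rV[R]_n -> R) : \bar R :=
  ereal_sup [set e | exists (l : seq 'I_n) (x : 'rV[R]_n),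
    [/\ (size l <= k)%N, O x & e = `|pderivs l f x|%:E]].

Definition holder_seminorm (R : realType) (n k : nat) (a : R)
  (O : set 'rV[R]_n) (f : 'rV[R]_n -> R) : \bar R :=
  ereal_sup [set e | exists (l : seq 'I_n) (x y : 'rV[R]_n),
    [/\ size l = k, O x /\ O y, x <> y &
        e = (`|pderivs l f x - pderivs l f y| / enorm (x - y) `^ a)%:E]].

Definition holder_norm (R : realType) (n k : nat) (a : R) (O : set 'rV[R]_n)
  (f : 'rV[R]_n -> R) : \bar R :=
  (sup_norm_Ck k O f + holder_seminorm k a O f)%E.

Definition uniformly_continuous_on (R : realType) (n : nat)
  (O : set 'rV[R]_n) (f : 'rV[R]_n -> R) : Prop :=
  forall e : R, 0 < e -> exists2 d : R, 0 < d &
    forall x y, O x -> O y -> enorm (x - y) < d -> `|f x - f y| < e.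

Definition BUC (R : realType) (n k : nat) (a : R) (O : set 'rV[R]_n)
  (f : 'rV[R]_n -> R) : Prop :=
  [/\ Ck k O f,
      forall l : seq 'I_n, (size l <= k)%N ->
        uniformly_continuous_on O (pderivs l f) &
      (holder_norm k a O f < +oo)%E].

Definition buc (R : realType) (n k : nat) (a : R) (O : set 'rV[R]_n)
  (f : 'rV[R]_n -> R) : Prop :=
  Ck k O f /\
  exists b : R, a < b < 1 /\
    forall e : R, 0 < e -> exists2 g, BUC k b O g &
      (holder_norm k a O (f \- g)%R <= e%:E)%E.

Definition bounds_domain (R : realType) (n : nat) (a : R)
  (Gamma Omega : set 'rV[R]_n) : Prop :=
  [/\ [/\ open Omega, connected Omega & Omega !=set0],
      compact Gamma, Gamma = closure Omega `\` Omega &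
      forall x, Gamma x -> exists (U : set 'rV[R]_n) (rho : 'rV[R]_n -> R),
        [/\ open U, U x, buc 2 a U rho &
            forall z, U z -> [/\ grad rho z != 0,
                                 Omega z <-> rho z < 0 &
                                 Gamma z <-> rho z = 0]]].

Definition is_outward_unit_normal (R : realType) (n : nat)
  (Omega : set 'rV[R]_n) (x v : 'rV[R]_n) : Prop :=
  exists (U : set 'rV[R]_n) (rho : 'rV[R]_n -> R),
    [/\ open U /\ U x, Ck 1 U rho /\ grad rho x != 0,
        forall z, U z -> (Omega z <-> rho z < 0), rho x = 0 &
        v = (enorm (grad rho x))^-1 *: grad rho x].

(* The normal of the boundary of Omega: the vector characterised above where it
   exists (it is unique), 0 at the other points. *)
Definition unit_normal (R : realType) (n : nat) (Omega : set 'rV[R]_n)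
  (x : 'rV[R]_n) : 'rV[R]_n := xget 0 [set v | is_outward_unit_normal Omega x v].

(* The moving domain is Omega(t) = phi t (Omega0), Gamma(t) = phi t (Gamma0); a
   point of Gamma(t) is phi t x with x in Gamma0, the normal velocity there is
   V = d/dt phi . nu, and Gamma(0) = Gamma0 reads phi 0 = id on Gamma0. *)
Definition stefan_problem (R : realType) (n : nat) (Omega0 Gamma0 : set 'rV[R]_n)
  (f u0 : 'rV[R]_n -> R) (phi : R -> 'rV[R]_n -> 'rV[R]_n)
  (u : R -> 'rV[R]_n -> R) : Prop :=
  [/\ forall t y, 0 < t -> (phi t @` Omega0) y ->
        'D_1 (fun t' => u t' y) t - laplacian (u t) y = f y,
      forall t y, 0 < t -> (phi t @` Gamma0) y ->
        bext (phi t @` Omega0) (u t) y = 0,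
      forall y, Omega0 y -> u 0 y = u0 y,
      forall t x, 0 < t -> Gamma0 x ->
        dot ('D_1 (fun t' => phi t' x) t)
            (unit_normal (phi t @` Omega0) (phi t x)) =
        - dder (phi t @` Omega0) (unit_normal (phi t @` Omega0)) (u t) (phi t x)
    & forall x, Gamma0 x -> phi 0 x = x].

(* C^2 families phi s t, 0 <= s < s0, t >= 0, of diffeomorphisms of R^n with
   inverses psi s t. *)
Definition diffeo_family (R : realType) (n : nat) (s0 : R)
  (phi psi : R -> R -> 'rV[R]_n -> 'rV[R]_n) : Prop :=
  let D := [set p : R * R * 'rV[R]_n | 0 <= p.1.1 < s0 /\ 0 <= p.1.2] in
  [/\ forall s t, 0 <= s < s0 -> 0 <= t ->
        cancel (phi s t) (psi s t) /\ cancel (psi s t) (phi s t),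
      Ck_upto 2 D (fun p => phi p.1.1 p.1.2 p.2),
      Ck_upto 2 D (fun p => psi p.1.1 p.1.2 p.2)
    & forall t x, 0 <= t -> phi 0 t x = x].

(* Both signs of s would make every such deformation tangential to first
   order. *)
Definition flows_into (R : realType) (n : nat) (s0 : R) (Omega0 : set 'rV[R]_n)
  (phi : R -> R -> 'rV[R]_n -> 'rV[R]_n) : Prop :=
  forall s t, 0 <= s < s0 -> 0 <= t -> phi s t @` Omega0 `<=` Omega0.

Definition pulled_back_regular (R : realType) (n : nat) (s0 : R)
  (Omega0 : set 'rV[R]_n) (v : R -> R -> 'rV[R]_n -> R) : Prop :=
  [/\ Ck_upto 3 [set p : R * R * 'rV[R]_n |
        [/\ 0 <= p.1.1 < s0, 0 < p.1.2 & Omega0 p.2]]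
        (fun p => v p.1.1 p.1.2 p.2),
      Ck_upto 2 [set p : R * R * 'rV[R]_n |
        [/\ 0 <= p.1.1 < s0, 0 < p.1.2 & closure Omega0 p.2]]
        (fun p => v p.1.1 p.1.2 p.2),
      forall x, Omega0 x -> exists l : R, is_rderiv0 (fun s => v s 0 x) l
    & forall t x, 0 <= t -> closure Omega0 x -> v 0 t x = 0].

Definition phi_push (R : realType) (n : nat)
  (psi : R -> R -> 'rV[R]_n -> 'rV[R]_n) (v : R -> R -> 'rV[R]_n -> R)
  (s t : R) (y : 'rV[R]_n) : R := v s t (psi s t y).

(* The pulled back equations.  The two sides of each of them are functions of s,
   and [E] says how they are compared: see [solves] and [derivatives_agree].
   The last equation is Gamma(0) = Gamma0. *)
Definition pulled_back_equations (R : realType) (n : nat)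
  (Omega0 Gamma0 : set 'rV[R]_n) (u0 : 'rV[R]_n -> R)
  (phi psi : R -> R -> 'rV[R]_n -> 'rV[R]_n) (v : R -> R -> 'rV[R]_n -> R)
  (E : forall W : normedModType R, (R -> W) -> (R -> W) -> Prop) : Prop :=
  let Omega s t := phi s t @` Omega0 in
  let nu s t := unit_normal (Omega s t) in
  let ubar := phi_push psi v in
  [/\ forall t x, 0 < t -> Omega0 x ->
        E R (fun s => 'D_1 (fun t' => ubar s t' (phi s t x)) t
                        - laplacian (ubar s t) (phi s t x))
              (fun=> 0),
      forall t x, 0 < t -> Gamma0 x ->
        E R (fun s => v s t x) (fun s => - bext Omega0 u0 (phi s t x)),
      forall x, Omega0 x -> E R (fun s => v s 0 x) (fun=> 0),
      forall t x, 0 < t -> Gamma0 x ->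
        E R (fun s => dot ('D_1 (fun t' => phi s t' x) t)
                            (nu s t (phi s t x)))
              (fun s => - (dder Omega0 (nu s t) u0 (phi s t x) +
                           dder (Omega s t) (nu s t) (ubar s t) (phi s t x)))
    & forall x, Gamma0 x -> E 'rV[R]_n (fun s => phi s 0 x) (fun=> x)].

Definition solves (R : realType) (s0 : R) (W : normedModType R)
  (F G : R -> W) : Prop := forall s, 0 <= s < s0 -> F s = G s.

Definition derivatives_agree (R : realType) (W : normedModType R)
  (F G : R -> W) : Prop := exists2 l : W, is_rderiv0 F l & is_rderiv0 G l.

Definition linearization (R : realType) (n : nat)
  (Omega0 Gamma0 : set 'rV[R]_n) (u0 : 'rV[R]_n -> R)
  (phi psi : R -> R -> 'rV[R]_n -> 'rV[R]_n) (v : R -> R -> 'rV[R]_n -> R) :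
  Prop :=
  pulled_back_equations Omega0 Gamma0 u0 phi psi v (@derivatives_agree R).

Definition nu_phi (R : realType) (n : nat)
  (phi : R -> R -> 'rV[R]_n -> 'rV[R]_n) (t : R) (x : 'rV[R]_n) : 'rV[R]_n :=
  rderiv0 (fun s => phi s t x).

Definition wbar (R : realType) (n : nat) (v : R -> R -> 'rV[R]_n -> R)
  (t : R) (x : 'rV[R]_n) : R := rderiv0 (fun s => v s t x).

Definition linearized_system (R : realType) (n : nat)
  (Omega0 Gamma0 : set 'rV[R]_n) (u0 : 'rV[R]_n -> R)
  (w : R -> 'rV[R]_n -> R) (nuphi : R -> 'rV[R]_n -> 'rV[R]_n) : Prop :=
  let nu0 := unit_normal Omega0 in
  [/\ forall t x, 0 < t -> Omega0 x ->
        'D_1 (fun t' => w t' x) t - laplacian (w t) x = 0,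
      forall t x, 0 < t -> Gamma0 x -> w t x = - dder Omega0 (nuphi t) u0 x,
      forall x, Omega0 x -> w 0 x = 0,
      forall t x, 0 < t -> Gamma0 x ->
        dot (nu0 x) ('D_1 (fun t' => nuphi t' x) t) =
        - dder Omega0 nu0 (dder Omega0 (nuphi t) u0) x
        - dder Omega0 nu0 (w t) x
    & forall x, Gamma0 x -> nuphi 0 x = 0].

Definition tube (R : realType) (n : nat) (Gamma : set 'rV[R]_n) (r0 : R) :
  set 'rV[R]_n := [set x | exists2 y, Gamma y & enorm (x - y) < r0].

(* (y, r) |-> y + r nu(y) is a diffeomorphism from Gamma x (-r0, r0) onto the
   tube, with inverse x |-> (Y x, r x). *)
Definition tubular_coordinates (R : realType) (n : nat) (Gamma : set 'rV[R]_n)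
  (nu : 'rV[R]_n -> 'rV[R]_n) (r0 : R) (Y : 'rV[R]_n -> 'rV[R]_n)
  (r : 'rV[R]_n -> R) : Prop :=
  [/\ 0 < r0,
      forall y q, Gamma y -> `|q| < r0 ->
        [/\ tube Gamma r0 (y + q *: nu y), Y (y + q *: nu y) = y &
            r (y + q *: nu y) = q],
      forall x, tube Gamma r0 x ->
        [/\ Gamma (Y x), `|r x| < r0 & Y x + r x *: nu (Y x) = x],
      Ck 1 (tube Gamma r0) Y & Ck 1 (tube Gamma r0) r].

Definition cutoff (R : realType) (r0 : R) (eta : R -> R) : Prop :=
  [/\ smooth eta, forall q, 0 <= eta q <= 1,
      forall q, `|q| <= r0 / 2 -> eta q = 1 &
      forall q, 3 * r0 / 4 <= `|q| -> eta q = 0].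

Definition nu_tilde (R : realType) (n : nat) (Gamma : set 'rV[R]_n)
  (nu : 'rV[R]_n -> 'rV[R]_n) (r0 : R) (Y : 'rV[R]_n -> 'rV[R]_n)
  (r : 'rV[R]_n -> R) (eta : R -> R) : 'rV[R]_n -> 'rV[R]_n :=
  (fun x => eta (r x) *: nu (Y x)) \_ (tube Gamma r0).

(* Integral over R^n as an iterated Lebesgue integral; it is only applied to
   continuous functions with compact support. *)
Fixpoint integral_rV (R : realType) (n : nat) : ('rV[R]_n -> R) -> R :=
  if n is m.+1 return ('rV[R]_n -> R) -> R then
    fun f => Rintegral (@lebesgue_measure R) setT
      (fun z : R => integral_rV
        (fun y : 'rV[R]_m => f (row_mx (z%:M : 'rV[R]_1) y : 'rV[R]_(1 + m))))
  else fun f => f 0.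

Definition mollifier (R : realType) (n : nat) (m : 'rV[R]_n -> R) : Prop :=
  [/\ smooth m, forall z, 0 <= m z,
      exists M : R, forall z, M < enorm z -> m z = 0 & integral_rV m = 1].

Definition mollify (R : realType) (n : nat) (m : 'rV[R]_n -> R) (delta : R)
  (N : 'rV[R]_n -> 'rV[R]_n) (x : 'rV[R]_n) : 'rV[R]_n :=
  \row_i integral_rV
    (fun z => delta ^- n * m (delta^-1 *: z) * N (x - z) 0 i).

(* Here h is a function on R^n, of which only the values near Gamma0 matter: the
   iterated derivative needs nu_phi = h nu^delta in a neighborhood of Gamma0. *)
Definition reduced_system (R : realType) (n : nat)
  (Omega0 Gamma0 : set 'rV[R]_n) (u0 : 'rV[R]_n -> R)
  (nud : 'rV[R]_n -> 'rV[R]_n) (w h : R -> 'rV[R]_n -> R) : Prop :=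
  let nu0 := unit_normal Omega0 in
  [/\ forall t x, 0 < t -> Omega0 x ->
        'D_1 (fun t' => w t' x) t - laplacian (w t) x = 0,
      forall t x, 0 < t -> Gamma0 x -> w t x = - (dder Omega0 nud u0 x * h t x),
      forall x, Omega0 x -> w 0 x = 0,
      forall t x, 0 < t -> Gamma0 x ->
        dot (nud x) (nu0 x) * 'D_1 (fun t' => h t' x) t =
        - dder Omega0 nu0 (fun z => dder Omega0 nud u0 z * h t z) x
        - dder Omega0 nu0 (w t) x
    & forall x, Gamma0 x -> h 0 x = 0].

(* Main.v *)
Require Import Defs.
From HB Require Import structures.
From mathcomp Require Import all_boot all_order all_algebra.
From mathcomp Require Import ring lra.
From mathcomp Require Import all_classical all_reals all_analysis.
Import Order.TTheory GRing.Theory Num.Theory.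
Import numFieldNormedType.Exports.
Local Open Scope classical_set_scope.
Local Open Scope ring_scope.
(** Everything is a first order expansion in the deformation parameter s at s = 0,
where phi(0, t, .) is the identity and v(0, ., .) vanishes. Since the deformations
map Omega0 into itself, only s >= 0 makes sense, and phi, psi and v are replaced by
extensions of class C^2 or C^3 to open sets of space-time ([flow_extension],
[pullback_extension]); right derivatives in s are then ordinary partial
derivatives, which commute with those in t and x ([derive_comm]). The expansions
are short because nearly every product of functions of s that occurs has a factor
that vanishes at s = 0, so that only the derivative of this factor survives
([is_rderiv0_mul_vanishing]).

The heat operator. At y = phi(s, t, x) every derivative of v(s, t, psi(s, t, y))
is, by the chain rule, a sum of derivatives of v at x multiplied by derivatives of
psi. The former vanish at s = 0 and there psi is the identity, so the first order
term is w_t - laplacian w, where w is the s-derivative of v ([heat_rderiv]).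

Boundary values. The functions u0 and grad u0 are known only inside Omega0 and as
limits on its boundary, the limits existing because derivatives of little Hoelder
functions are uniformly continuous ([buc_uniform], [uniform_cvg_bext]). They are
nevertheless differentiable along the flow at a boundary point, because the paths
of interior points stay inside Omega0, where the mean value theorem applies
([is_rderiv0_bext]). This gives w = - d u0 / d nu_phi, and the first order change
D^2 u0 (nu_phi) of grad u0.

The normal velocity. The velocity d/dt phi vanishes at s = 0, whence the left hand
side nu0 . d/dt nu_phi. On the right there are three contributions: the change of
grad u0 just mentioned; the normal derivative of ubar, which gives that of w since
grad ubar vanishes at s = 0 ([dder_ubar_rderiv]); and the rotation of the normal.
The moving normal is a normalised vector depending differentiably on s
([unit_normal_flow]), so its first order change is tangential
([normalize_rderiv]), whereas grad u0 is a multiple of nu0, because u0 vanishes on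
the boundary ([gradient_normal]): the rotation contributes nothing
([normal_derivative_rderiv]). What results is nu0 . D^2 u0 (nu_phi). The iterated
derivative of the linearized system is this plus grad u0 . D_{nu0} nu_phi, since
it differentiates nu_phi too ([dder_dder]). As grad u0 is normal, the additional
term is (nu0 . D_{nu0} nu_phi) times the normal derivative of u0. It vanishes for
solutions: at s = 0 the velocity condition says that the normal derivative of u0 is
zero ([solution_linearized]). For other families its vanishing is the condition
under which [linearization_iff] holds.

The Stefan problem for u0 + ubar. Its member s = 0 says that - laplacian u0 = f;
subtracting this from the heat equation for general s leaves the homogeneous
equation for ubar, and the remaining equations are those for u written in terms of
u0 and ubar ([stefan_pulled_back]).

The reduction. All terms are linear in nu_phi = h nu^delta, so the substitution is
direct; to recover h(0, .) = 0, and the differentiability of h in time, from the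
product it is enough that nu^delta has no zero on Gamma0. For small delta this
holds because, by compactness, nu0(y) deviates by less than a right angle from
nu0(x) for all surface points y near x, uniformly in x, so that nu^delta(x) . nu0(x)
is the integral of a nonnegative function that is positive somewhere
([uniform_cone], [mollified_normal_neq0]). *)

Set Implicit Arguments.
Unset Strict Implicit.
Unset Printing Implicit Defensive.

(** * Functions of class C^k and symmetry of second derivatives *)

Section Calculus.
Context {R : realType}.
Implicit Types V W : normedModType R.

Lemma Ck_differentiable V W k (O : set V) (f : V -> W) x :
  Ck k.+1 O f -> O x -> differentiable f x.
Proof. by case=> + _ => /[apply]. Qed.

Lemma Ck_derive V W k (O : set V) (f : V -> W) v :
  Ck k.+1 O f -> Ck k O ('D_v f).
Proof. by case=> _ /(_ v). Qed.

Lemma Ck_continuous V W k (O : set V) (f : V -> W) x :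
  Ck k O f -> O x -> {for x, continuous f}.
Proof.
case: k => [|k]; first exact.
by move=> /Ck_differentiable/[apply]; exact: differentiable_continuous.
Qed.

Lemma CkW V W k (O : set V) (f : V -> W) : Ck k.+1 O f -> Ck k O f.
Proof.
elim: k f => [f fO x Ox|k IH f fO]; first exact: Ck_continuous fO Ox.
split=> [x|v]; first exact: Ck_differentiable fO.
exact: IH (Ck_derive v fO).
Qed.

(** Both sides are limits of one and the same difference quotient. *)
Lemma derive_affine V V' W (iota : V' -> V) (f : V -> W) x v w :
    (forall k, iota (k *: v + x) = k *: w + iota x) ->
  'D_v (f \o iota) x = 'D_w f (iota x).
Proof.
move=> iotaE; rewrite /derive; set F := (X in lim (X @ _)).
by rewrite (_ : F = fun k => k^-1 *: (f (k *: w + iota x) - f (iota x)))//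
  /F; apply/funext => k; rewrite /= iotaE.
Qed.

Lemma derivable_affine V V' W (iota : V' -> V) (f : V -> W) x v w :
    (forall k, iota (k *: v + x) = k *: w + iota x) ->
  derivable (f \o iota) x v = derivable f (iota x) w.
Proof.
move=> iotaE; rewrite /derivable; set F := (X in cvg (X @ _) = _).
by rewrite (_ : F = fun k => k^-1 *: (f (k *: w + iota x) - f (iota x)))//
  /F; apply/funext => k; rewrite /= iotaE.
Qed.

Lemma is_derive_affine V V' W (iota : V' -> V) (f : V -> W) x v w l :
    (forall k, iota (k *: v + x) = k *: w + iota x) ->
  is_derive (iota x) w f l -> is_derive x v (f \o iota) l.
Proof.
move=> iotaE [df fl]; split; first by rewrite (derivable_affine _ iotaE).
by rewrite (derive_affine _ iotaE).
Qed.

Lemma differentiable_is_derive V W (f : V -> W) x v :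
  differentiable f x -> is_derive x v f ('D_v f x).
Proof. by move=> /(diff_derivable (v := v))/derivableP. Qed.

Lemma MVT_line V (f : V -> R) p v (h : R) : 0 < h ->
    (forall t, 0 <= t <= h -> differentiable f (p + t *: v)) ->
  exists2 c, 0 < c < h & f (p + h *: v) - f p = h * 'D_v f (p + c *: v).
Proof.
move=> h0 df.
have line t k : p + (k *: (1 : R) + t) *: v = k *: v + (p + t *: v).
  by rewrite scalerDl addrCA [k *: 1]mulr1.
have der t : 0 <= t <= h -> is_derive (t : R) 1
    (f \o (fun t => p + t *: v)) ('D_v f (p + t *: v)).
  by move=> /df dft; apply: is_derive_affine (line t) _;
    exact: differentiable_is_derive.
have [t||c ch] := @MVT _ (f \o (fun t => p + t *: v))
    (fun t => 'D_v f (p + t *: v)) 0 h h0.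
- by rewrite in_itv/= => /andP[t0 th]; apply: der; rewrite !ltW.
- apply: derivable_within_continuous => t; rewrite in_itv/= => th.
  exact: (@ex_derive _ _ _ _ _ _ _ (der t th)).
- rewrite /= scale0r addr0 subr0 mulrC => fE; exists c => //.
Qed.

(** The left hand side is symmetric in v and w, the right hand side is not: used
in both orders, this compares the two mixed derivatives near p. *)
Lemma second_difference V (f : V -> R) (O : set V) p v w (h : R) : 0 < h ->
    Ck 2 O f ->
    (forall a b : R, 0 <= a <= h -> 0 <= b <= h -> O (p + a *: v + b *: w)) ->
  exists a b, [/\ 0 < a < h, 0 < b < h &
    f (p + h *: v + h *: w) - f (p + h *: v) - (f (p + h *: w) - f p) =
    h * (h * 'D_w ('D_v f) (p + a *: v + b *: w))].
Proof.
move=> h0 f2 Op; pose g q := f (q + h *: w) - f q.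
have h00 : 0 <= h <= h by rewrite lexx ltW.
have z0h : 0 <= (0 : R) <= h by rewrite lexx ltW.
have shiftE q k : k *: v + q + h *: w = k *: v + (q + h *: w) by rewrite addrA.
have dfh t : 0 <= t <= h -> differentiable f (p + t *: v + h *: w).
  by move=> th; apply: (Ck_differentiable f2); exact: Op.
have df0 t : 0 <= t <= h -> differentiable f (p + t *: v).
  move=> th; apply: (Ck_differentiable f2).
  by rewrite -[_ + _]addr0 -(scale0r w); exact: Op.
have dg t : 0 <= t <= h -> differentiable g (p + t *: v).
  move=> th; apply: differentiableB; last exact: df0.
  apply: (@differentiable_comp _ _ _ _ (fun q => q + h *: w) f); last exact: dfh.
  exact: differentiableD.
have [a ah gE] := MVT_line h0 dg.
have ah' : 0 <= a <= h by case/andP: ah => *; rewrite !ltW.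
have DgE : 'D_v g (p + a *: v) =
    'D_v f (p + a *: v + h *: w) - 'D_v f (p + a *: v).
  rewrite deriveB; last 2 first.
  - rewrite (@derivable_affine _ _ _ (fun q => q + h *: w) f _ v v).
      exact/diff_derivable/dfh.
    by move=> k; exact: shiftE.
  - exact/diff_derivable/df0.
  congr (_ - _); apply: (@derive_affine _ _ _ (fun q => q + h *: w) f).
  by move=> k; exact: shiftE.
have [|b bh fE] := @MVT_line _ ('D_v f) (p + a *: v) w h h0.
  by move=> t th; apply: (Ck_differentiable (Ck_derive v f2)); exact: Op.
exists a, b; split => //; rewrite -fE -DgE -gE /g.
by rewrite addrAC.
Qed.

Lemma derive_comm V (f : V -> R) (O : set V) p v w :
  open O -> Ck 2 O f -> O p -> 'D_v ('D_w f) p = 'D_w ('D_v f) p.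
Proof.
move=> oO f2 Op; pose A : V -> R := 'D_v ('D_w f).
pose B : V -> R := 'D_w ('D_v f); rewrite -/(A p) -/(B p).
have cA : {for p, continuous A}.
  exact: (@Ck_continuous _ _ 0 O _ _ (Ck_derive v (Ck_derive w f2)) Op).
have cB : {for p, continuous B}.
  exact: (@Ck_continuous _ _ 0 O _ _ (Ck_derive w (Ck_derive v f2)) Op).
apply/eqP; rewrite -subr_eq0 -normr_eq0; apply/eqP/le_anti.
rewrite normr_ge0 andbT; apply/ler_addgt0Pr => e e0; rewrite add0r.
pose G (ab : R * R) := p + ab.1 *: v + ab.2 *: w.
have G0 : G (0, 0) = p by rewrite /G !scale0r !addr0.
have cG : {for (0, 0), continuous G}.
  apply: cvgD; first apply: cvgD; first exact: cvg_cst.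
  - by apply: cvgZr_tmp; exact: cvg_fst.
  - by apply: cvgZr_tmp; exact: cvg_snd.
have e2 : 0 < e / 2 by rewrite divr_gt0.
have near1 : \forall ab \near ((0, 0) : R * R), [/\ O (G ab),
    `|A p - A (G ab)| < e / 2 & `|B p - B (G ab)| < e / 2].
  apply: (cG (fun q => [/\ O q, `|A p - A q| < e / 2 & `|B p - B q| < e / 2])).
  rewrite G0.
  have n0 : \forall q \near p, O q by exact: open_nbhs_nbhs.
  move/cvgrPdist_lt/(_ _ e2) : cA => n1; move/cvgrPdist_lt/(_ _ e2) : cB => n2.
  exact: (@filterS3 _ (nbhs p) _ _ _ _ (fun q => [/\ O q, `|A p - A q| < e / 2 &
    `|B p - B q| < e / 2]) (fun q h1 h2 h3 => And3 h1 h2 h3) n0 n1 n2).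
have [[U U'] /= [U0 U'0] UU'] := near1.
have [/nbhs_ballP[d1 /= d10 dA] /nbhs_ballP[d2 /= d20 dB]] := (U0, U'0).
pose h := Num.min d1 d2 / 2.
have h0 : 0 < h by rewrite divr_gt0// lt_min d10.
have in_sq a b : 0 <= a <= h -> 0 <= b <= h -> U a /\ U' b.
  have lth : h < Num.min d1 d2 by rewrite /h gtr_pMr ?invf_lt1 ?ltr1n// lt_min d10.
  move=> /andP[a0 ah] /andP[b0 bh]; split.
  - apply: dA; rewrite /ball/= sub0r normrN ger0_norm//.
    by apply: le_lt_trans ah _; rewrite (lt_le_trans lth)// ge_min lexx.
  - apply: dB; rewrite /ball/= sub0r normrN ger0_norm//.
    by apply: le_lt_trans bh _; rewrite (lt_le_trans lth)// ge_min lexx orbT.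
have sq a b : 0 <= a <= h -> 0 <= b <= h -> [/\ O (G (a, b)),
    `|A p - A (G (a, b))| < e / 2 & `|B p - B (G (a, b))| < e / 2].
  by move=> ah bh; apply: (UU' (a, b)); exact: in_sq.
have GC a b : p + b *: w + a *: v = G (a, b) by rewrite /G addrAC.
have [a [b [ah bh E1]]] := @second_difference _ f O p v w h h0 f2
  (fun a b ah bh => let: And3 o _ _ := sq a b ah bh in o).
have [|b' [a' [bh' ah' E2]]] := @second_difference _ f O p w v h h0 f2.
  by move=> x y xh yh; rewrite GC; case: (sq y x yh xh).
have {E1 E2} E : B (G (a, b)) = A (G (a', b')).
  have hh : h != 0 by rewrite gt_eqF.
  apply: (mulfI hh); apply: (mulfI hh).
  have EA : A (p + b' *: w + a' *: v) = A (G (a', b')) by congr A; exact: GC.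
  have hC : f (p + h *: w + h *: v) = f (p + h *: v + h *: w).
    by congr f; rewrite addrAC.
  move: E1 E2; rewrite -/(A _) -/(B _) EA hC.
  move: (f (p + h *: v + h *: w)) (f (p + h *: v)) (f (p + h *: w)) (f p).
  move=> x1 x2 x3 x4 E1 E2.
  apply: (etrans (etrans (esym E1) _) E2).
  by ring.
have wd c : 0 < c < h -> 0 <= c <= h by move=> /andP[c0 ch]; rewrite !ltW.
have [_ _ l1] := sq a b (wd a ah) (wd b bh).
have [_ l2 _] := sq a' b' (wd a' ah') (wd b' bh').
have l3 : `|A p - B (G (a, b))| < e / 2 by rewrite E; exact: l2.
have l4 : `|B (G (a, b)) - B p| < e / 2 by rewrite distrC; exact: l1.
apply: (le_trans (ler_distD (B (G (a, b))) (A p) (B p))).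
rewrite (splitr e); apply: lerD; [exact: ltW l3|exact: ltW l4].
Qed.

End Calculus.

(* Comparing two derivatives must not unfold them to limits of quotients. *)
Local Opaque derive.

(** * Local congruence, components and the chain rule *)

Section ChainRule.
Context {R : realType}.
Implicit Types V W : normedModType R.

(** The differential of f serves for g as well. *)
Lemma near_eq_differentiable V W (f g : V -> W) x :
  (\near x, f x = g x) -> differentiable f x -> differentiable g x.
Proof.
move=> fg dfx; have fgx : f x = g x := nbhs_singleton fg.
have H : g \o shift x = cst (g x) + 'd f x +o_ 0 id.
  apply/eqaddoP => e e0.
  have /eqaddoP/(_ e e0) := diff_locally dfx.
  have : \forall h \near (0 : V), f (h + x) = g (h + x).
    have cx : {for (0 : V), continuous (fun h => h + x)}.
      by apply: cvgD; [exact: cvg_id|exact: cvg_cst].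
    by apply: (cx (fun y => f y = g y)); rewrite add0r.
  by apply: filter_app2; near=> h; rewrite /= !fctE /= fgx => ->.
have cdf : continuous ('d f x) by exact: diff_continuous.
by apply/diff_locallyP; rewrite (diff_unique cdf H).
Unshelve. all: by end_near. Qed.

Lemma Ck_eq V W k (O : set V) (f g : V -> W) : open O ->
  (forall x, O x -> f x = g x) -> Ck k O f -> Ck k O g.
Proof.
move=> oO; elim: k f g => [|k IH] f g fg; have nfg x : O x -> \near x, f x = g x.
- move=> Ox; near=> y; apply: fg; near: y; exact: open_nbhs_nbhs.
- move=> fO x Ox; have cfx : f @ x --> f x := fO x Ox.
  change (g @ x --> g x); rewrite -fg//.
  apply: cvg_trans cfx; apply: near_eq_cvg; near=> y.
  apply: fg; near: y; exact: open_nbhs_nbhs.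
- move=> Ox; near=> y; apply: fg; near: y; exact: open_nbhs_nbhs.
- move=> [df Df]; split => [x Ox|v].
    exact: near_eq_differentiable (nfg x Ox) (df x Ox).
  apply: IH (Df v) => x Ox; exact: near_eq_derive (nfg x Ox).
Unshelve. all: by end_near. Qed.

Lemma Ck_subset V W k (O O' : set V) (f : V -> W) :
  O `<=` O' -> Ck k O' f -> Ck k O f.
Proof.
move=> OO'; elim: k f => [|k IH] f; first by move=> fO x /OO'; exact: fO.
by move=> [df Df]; split => [x /OO'/df//|v]; exact: IH (Df v).
Qed.

Lemma is_derive_coord V n (F : V -> 'rV[R]_n) x v k : differentiable F x ->
  is_derive x v (fun y => F y 0 k) ('D_v F x 0 k).
Proof.
move=> dF; have dv : derivable F x v by exact: diff_derivable.
by split; [move/derivable_mxP: dv; exact | rewrite (derive_mx dv) mxE].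
Qed.

Lemma differentiable_coord_fun V n (F : V -> 'rV[R]_n) x k :
  differentiable F x -> differentiable (fun y => F y 0 k) x.
Proof.
move=> dF; apply: (@differentiable_comp _ _ _ _ F (fun M => M 0 k)) => //.
exact: differentiable_coord.
Qed.

Lemma continuous_coord_fun (T : topologicalType) n (F : T -> 'rV[R]_n) x k :
  {for x, continuous F} -> {for x, continuous (fun y => F y 0 k)}.
Proof.
move=> cF; apply: (@continuous_comp _ _ _ F (fun M => M 0 k)) => //.
exact: coord_continuous.
Qed.

Lemma Ck_coord V k (O : set V) n (F : V -> 'rV[R]_n) i : open O ->
  Ck k O F -> Ck k O (fun y => F y 0 i).
Proof.
move=> oO; elim: k F => [|k IH] F.
  by move=> cF x /cF; exact: continuous_coord_fun.
move=> [dF DF]; split => [x /dF|v]; first exact: differentiable_coord_fun.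
apply: (@Ck_eq _ _ _ _ (fun y => 'D_v F y 0 i)) => //; last exact: IH (DF v).
by move=> x /dF dFx; rewrite (derive_val (is_derive := is_derive_coord v i dFx)).
Qed.

Lemma continuous_rV (T : topologicalType) n (F : T -> 'rV[R]_n) x :
  (forall k, {for x, continuous (fun y => F y 0 k)}) -> {for x, continuous F}.
Proof.
move=> cF; apply/cvgrPdist_le => /= e e0.
near=> y; rewrite /Num.Def.normr/= mx_normrE (bigmax_le _ (ltW e0))//= => -[i k] _.
rewrite !mxE/= (ord1 i); move: k; near: y; apply: filter_forall => k.
by have /cvgrPdist_le/(_ _ e0) := cF k.
Unshelve. all: by end_near. Qed.

Lemma derive_combo V (f : V -> R) x n (a : 'I_n -> R) (b : 'I_n -> V) :
  differentiable f x ->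
  'D_(\sum_k a k *: b k) f x = \sum_k a k * 'D_(b k) f x.
Proof.
move=> df; rewrite deriveE// linear_sum; apply: eq_bigr => k _.
by rewrite linearZ deriveE.
Qed.

Lemma derive_dirD V (f : V -> R) x u v :
  differentiable f x -> 'D_(u + v) f x = 'D_u f x + 'D_v f x.
Proof. by move=> df; rewrite !deriveE// linearD. Qed.

Lemma derive_dirZ V (f : V -> R) x c v :
  differentiable f x -> 'D_(c *: v) f x = c * 'D_v f x.
Proof. by move=> df; rewrite !deriveE// linearZ. Qed.

Lemma derive_rV n (f : 'rV[R]_n -> R) x w : differentiable f x ->
  'D_w f x = \sum_k w 0 k * 'D_(ebase R k) f x.
Proof.
move=> df; rewrite {1}(row_sum_delta w); exact: derive_combo.
Qed.

Lemma chain_derive V V' W (G : V' -> V) (F : V -> W) x v :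
  differentiable G x -> differentiable F (G x) ->
  is_derive x v (F \o G) ('D_('D_v G x) F (G x)).
Proof.
move=> dG dF; have dFG := differentiable_comp dG dF.
split; first exact: diff_derivable.
by rewrite deriveE// diff_comp//= !deriveE.
Qed.

Lemma chain_derive_rV V' n (G : V' -> 'rV[R]_n) (F : 'rV[R]_n -> R) x v :
  differentiable G x -> differentiable F (G x) ->
  is_derive x v (F \o G) (\sum_k 'D_v G x 0 k * 'D_(ebase R k) F (G x)).
Proof.
by move=> dG dF; rewrite -derive_rV//; exact: chain_derive.
Qed.

End ChainRule.

(** * Partial derivatives in space-time *)

Section SpaceTime.
Context {R : realType} {n : nat}.
Implicit Types W : normedModType R.
Local Notation P := (R * R * 'rV[R]_n)%type.

(** A point (s, t, y) of P consists of deformation parameter, time and position. *)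
Definition dir_s : P := (1, 0, 0).
Definition dir_t : P := (0, 1, 0).
Definition dir_y (e : 'rV[R]_n) : P := (0, 0, e).

Lemma triple_eq (a a' b b' : R) (w w' : 'rV[R]_n) :
  a = a' -> b = b' -> w = w' -> (a, b, w) = (a', b', w').
Proof. by move=> -> -> ->. Qed.

Lemma dirE (a b : R) (w : 'rV[R]_n) :
  (a, b, w) = a *: dir_s + b *: dir_t + \sum_k w 0 k *: dir_y (ebase R k) :> P.
Proof.
have -> : \sum_k w 0 k *: dir_y (ebase R k) = dir_y w.
  rewrite [in RHS](row_sum_delta w) /dir_y.
  elim/big_ind2 : _ => // [x y x' y' -> ->|k _].
    by congr (_, _); rewrite ?addr0//; congr (_, _); rewrite addr0.
  by congr (_, _); congr (_, _); rewrite /= scaler0.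
rewrite /dir_s /dir_t /dir_y.
congr (_, _); last by rewrite /= !scaler0 !add0r.
by congr (_, _); rewrite /= /GRing.scale/= !(mulr0, mulr1, addr0, add0r).
Qed.

Lemma derive_dirE (F : P -> R) p a b (w : 'rV[R]_n) : differentiable F p ->
  'D_(a, b, w) F p = a * 'D_dir_s F p + b * 'D_dir_t F p +
    \sum_k w 0 k * 'D_(dir_y (ebase R k)) F p.
Proof.
by move=> dF; rewrite dirE !derive_dirD// derive_combo// !derive_dirZ.
Qed.

Lemma slice_y_line (s t : R) (x v : 'rV[R]_n) (k : R) :
  (s, t, k *: v + x) = k *: dir_y v + (s, t, x) :> P.
Proof.
by apply: triple_eq; rewrite /= ?scaler0 ?add0r.
Qed.

Lemma slice_t_line (s t : R) (x : 'rV[R]_n) (k : R) :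
  (s, k *: (1 : R) + t, x) = k *: dir_t + (s, t, x) :> P.
Proof.
by apply: triple_eq; rewrite /= ?scaler0 ?add0r.
Qed.

Lemma slice_s_line (s t : R) (x : 'rV[R]_n) (k : R) :
  (k *: (1 : R) + s, t, x) = k *: dir_s + (s, t, x) :> P.
Proof.
by apply: triple_eq; rewrite /= ?scaler0 ?add0r.
Qed.

Lemma derive_slice_y W (F : P -> W) s t x v :
  'D_v (fun y => F (s, t, y)) x = 'D_(dir_y v) F (s, t, x).
Proof. exact: (derive_affine F (slice_y_line s t x v)). Qed.

Lemma derive_slice_t W (F : P -> W) s t x :
  'D_1 (fun t' => F (s, t', x)) t = 'D_dir_t F (s, t, x).
Proof. exact: (derive_affine F (slice_t_line s t x)). Qed.

Lemma is_derive_slice_s W (F : P -> W) s t x : differentiable F (s, t, x) ->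
  is_derive s 1 (fun s' => F (s', t, x)) ('D_dir_s F (s, t, x)).
Proof.
move=> dF; apply: (is_derive_affine (slice_s_line s t x)).
exact: differentiable_is_derive.
Qed.

Lemma differentiable_slice_y W (F : P -> W) s t x :
  differentiable F (s, t, x) -> differentiable (fun y => F (s, t, y)) x.
Proof.
move=> dF; apply: (@differentiable_comp _ _ _ _ (fun y => (s, t, y)) F) => //.
Qed.

Lemma continuous_slice_y (s t : R) :
  continuous (fun y : 'rV[R]_n => (s, t, y) : P).
Proof. by move=> y; exact: differentiable_continuous. Qed.

Lemma Ck_slice_y W k (O : set P) (F : P -> W) s t : Ck k O F ->
  Ck k [set y | O (s, t, y)] (fun y => F (s, t, y)).
Proof.
elim: k F => [|k IH] F.
  move=> cF y /cF cFy; apply: (continuous_comp _ cFy).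
  exact: continuous_slice_y.
move=> [dF DF]; split => [y /dF|v]; first exact: differentiable_slice_y.
have -> : 'D_v (fun y => F (s, t, y)) = fun y => 'D_(dir_y v) F (s, t, y).
  by apply/funext => y; exact: derive_slice_y.
exact: IH (DF (dir_y v)).
Qed.

End SpaceTime.

(** * Right derivatives at zero *)

Section RightDerivative.
Context {R : realType}.
Implicit Types W : normedModType R.

Lemma cvg_rsum (T : Type) (F : set_system T) {FF : Filter F} n
    (f : 'I_n -> T -> R) (l : 'I_n -> R) :
  (forall k, f k x @[x --> F] --> l k) ->
  \sum_k f k x @[x --> F] --> \sum_k l k.
Proof.
move=> fl.
have -> : (fun x => \sum_k f k x) = \sum_k f k.
  by apply/funext => s; rewrite fct_sumE.
elim/big_ind2 : _ => [|f' l' g k|i _]; [exact: cvg_cst|exact: cvgD|exact: fl].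
Qed.

Lemma rderiv0E W (F : R -> W) l : is_rderiv0 F l -> rderiv0 F = l.
Proof. by move=> Fl; apply: cvg_lim Fl. Qed.

Lemma is_rderiv0_unique W (F : R -> W) l l' :
  is_rderiv0 F l -> is_rderiv0 F l' -> l = l'.
Proof. by move=> /rderiv0E <- /rderiv0E. Qed.

Lemma near_right_ico (s0 : R) : 0 < s0 -> \forall h \near 0^'+, 0 <= h < s0.
Proof.
move=> s00; near=> h; apply/andP; split; last by near: h; exact: nbhs_right_lt.
by rewrite ltW//; near: h; exact: nbhs_right_gt.
Unshelve. all: by end_near. Qed.

Lemma near_is_rderiv0 W (F G : R -> W) l : F 0 = G 0 ->
  (\forall h \near 0^'+, F h = G h) -> is_rderiv0 F l -> is_rderiv0 G l.
Proof.
move=> FG0 FG Fl; apply: (cvg_trans _ Fl); apply: near_eq_cvg.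
by apply: filterS FG => h ->; rewrite FG0.
Qed.

Lemma eq_is_rderiv0 W (s0 : R) (F G : R -> W) l : 0 < s0 ->
  (forall s, 0 <= s < s0 -> F s = G s) -> is_rderiv0 F l -> is_rderiv0 G l.
Proof.
move=> s00 FG; apply: near_is_rderiv0; first by apply: FG; rewrite lexx.
by apply: filterS (near_right_ico s00) => h; exact: FG.
Qed.

Lemma is_derive_rderiv0 W (F : R -> W) l : is_derive (0 : R) 1 F l ->
  is_rderiv0 F l.
Proof.
move=> [dF FE]; have : (fun h => h^-1 *: (F (h *: 1 + 0) - F 0)) @ 0^' --> l.
  by rewrite -FE; exact: dF.
move/cvg_dnbhs_at_right; rewrite /is_rderiv0.
suff -> : (fun h => h^-1 *: (F h - F 0)) =
    fun h => h^-1 *: (F (h *: 1 + 0) - F 0) by [].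
by apply/funext => h; rewrite addr0 [h *: 1]mulr1.
Qed.

Lemma is_rderiv0_cst W (c : W) : is_rderiv0 (fun=> c) 0.
Proof.
rewrite /is_rderiv0; under eq_fun do rewrite subrr scaler0.
exact: cvg_cst.
Qed.

Lemma is_rderiv0D W (F G : R -> W) l k : is_rderiv0 F l -> is_rderiv0 G k ->
  is_rderiv0 (fun s => F s + G s) (l + k).
Proof.
move=> Fl Gk; apply: (cvg_trans _ (cvgD Fl Gk)); apply: near_eq_cvg.
by near=> h; rewrite /= opprD addrACA scalerDr.
Unshelve. all: by end_near. Qed.

Lemma is_rderiv0N W (F : R -> W) l : is_rderiv0 F l ->
  is_rderiv0 (fun s => - F s) (- l).
Proof.
move=> Fl; apply: (cvg_trans _ (cvgN Fl)); apply: near_eq_cvg.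
by near=> h; rewrite /= -opprD scalerN.
Unshelve. all: by end_near. Qed.

Lemma is_rderiv0B W (F G : R -> W) l k : is_rderiv0 F l -> is_rderiv0 G k ->
  is_rderiv0 (fun s => F s - G s) (l - k).
Proof. by move=> Fl /is_rderiv0N; exact: is_rderiv0D. Qed.

Lemma is_rderiv0_sum W n (F : 'I_n -> R -> W) l :
  (forall k, is_rderiv0 (F k) (l k)) ->
  is_rderiv0 (fun s => \sum_k F k s) (\sum_k l k).
Proof.
move=> Fl.
have -> : (fun s => \sum_k F k s) = fun s => (\sum_k F k) s.
  by apply/funext => s; rewrite fct_sumE.
elim/big_ind2 : _ => [|F' l' G k|i _]; [exact: is_rderiv0_cst| |exact: Fl].
exact: is_rderiv0D.
Qed.

(** If the second factor vanishes at 0, mere continuity of the first one is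
enough for the product rule. *)
Lemma is_rderiv0_mul_vanishing (a b : R -> R) (a0 l : R) :
  a h @[h --> 0^'+] --> a0 -> b 0 = 0 -> is_rderiv0 b l ->
  is_rderiv0 (fun s => a s * b s) (a0 * l).
Proof.
move=> ca b0 bl; apply: (cvg_trans _ (cvgM ca bl)); apply: near_eq_cvg.
by near=> h; rewrite /= b0 mulr0 !subr0 /GRing.scale/= mulrCA.
Unshelve. all: by end_near. Qed.

Lemma is_rderiv0_mull (a : R) b l : is_rderiv0 b l ->
  is_rderiv0 (fun s => a * b s) (a * l).
Proof.
move=> bl; apply: (cvg_trans _ (cvgM (cvg_cst a) bl)); apply: near_eq_cvg.
near=> h; rewrite /= /GRing.scale/=; ring.
Unshelve. all: by end_near. Qed.

End RightDerivative.

(** * Boundary values, and their derivatives along the deformations *)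

Section BoundaryValues.
Context {R : realType} {n : nat}.
Implicit Types (Omega : set 'rV[R]_n) (f g : 'rV[R]_n -> R) (x : 'rV[R]_n).

Lemma bextE Omega f x (l : R) : closure Omega x ->
  f @ within Omega (nbhs x) --> l -> bext Omega f x = l.
Proof.
move=> Ox fl; have FF : ProperFilter (within Omega (nbhs x)).
  exact: within_nbhs_proper.
exact: (cvg_lim _ fl).
Qed.

Lemma cvg_within_eq Omega f g x (l : R) : {in Omega, f =1 g} ->
  f @ within Omega (nbhs x) --> l -> g @ within Omega (nbhs x) --> l.
Proof.
move=> fg fl; apply: (cvg_trans _ fl); apply: near_eq_cvg.
rewrite near_withinE; near=> y => Oy; rewrite fg//; exact/mem_set.
Unshelve. all: by end_near. Qed.

Lemma eq_bext Omega f g x : {in Omega, f =1 g} -> bext Omega f x = bext Omega g x.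
Proof.
move=> fg; rewrite /bext; congr (get _); apply/funext => l; apply/propext.
split; apply: cvg_within_eq => //.
by move=> y /fg.
Qed.

Lemma cvg_within_subset Omega Omega' f x (l : R) : Omega' `<=` Omega ->
  f @ within Omega (nbhs x) --> l -> f @ within Omega' (nbhs x) --> l.
Proof.
move=> sub fl A /fl; rewrite /= /nbhs/= /within/=.
by apply: filterS => y + /sub.
Qed.

Lemma cvg_within_continuous Omega f x : {for x, continuous f} ->
  f @ within Omega (nbhs x) --> f x.
Proof. by move=> cf; apply: cvg_within_filter; exact: cf. Qed.

Lemma cvg_bext Omega f x : closure Omega x ->
  cvg (f @ within Omega (nbhs x)) -> f @ within Omega (nbhs x) --> bext Omega f x.
Proof. by move=> Ox /cvg_ex[l fl]; rewrite (bextE Ox fl). Qed.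

Lemma bext_continuous Omega f x : closure Omega x -> {for x, continuous f} ->
  bext Omega f x = f x.
Proof. by move=> Ox cf; apply: bextE => //; exact: cvg_within_continuous. Qed.

Lemma cvg_within_comp Omega Omega' (X : 'rV[R]_n -> 'rV[R]_n) f x (l : R) :
  {for x, continuous X} -> (forall y, Omega y -> Omega' (X y)) ->
  f @ within Omega' (nbhs (X x)) --> l ->
  (f \o X) @ within Omega (nbhs x) --> l.
Proof.
move=> cX OO'; apply: cvg_comp => A; rewrite /within/= => /cX; rewrite !nbhs_simpl/=.
by apply: filterS => y Ay Oy; apply: Ay; exact: OO'.
Qed.

Lemma closure_image Omega Omega' (X : 'rV[R]_n -> 'rV[R]_n) x :
  {for x, continuous X} -> (forall y, Omega y -> Omega' (X y)) ->
  closure Omega x -> closure Omega' (X x).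
Proof.
move=> cX OO' Ox A /cX XA; have [y [Oy Ay]] := Ox _ XA.
by exists (X y); split => //; exact: OO'.
Qed.

End BoundaryValues.

Section BoundaryFlow.
Context {R : realType} {n : nat}.
Local Notation P := (R * R * 'rV[R]_n)%type.

(** Differentiating boundary values along the flow needs no regularity of the
boundary: for y in the domain the whole path of Phi(s, t, y), s >= 0, stays
inside, so that the mean value theorem applies on it, and the estimate survives
the limit y --> x. *)
Lemma is_rderiv0_bext (Omega : set 'rV[R]_n) (g : 'rV[R]_n -> R)
    (Phi : P -> 'rV[R]_n) (O : set P) (s0 t : R) x (L : 'I_n -> R) :
    0 < s0 -> Ck 1 O Phi ->
    (forall s y, 0 <= s < s0 -> O (s, t, y)) ->
    (forall y, Phi (0, t, y) = y) ->
    (forall s y, 0 <= s < s0 -> Omega y -> Omega (Phi (s, t, y))) ->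
    closure Omega x ->
    (forall y, Omega y -> differentiable g y) ->
    (forall y, closure Omega y -> cvg (g @ within Omega (nbhs y))) ->
    (forall i, 'D_(ebase R i) g @ within Omega (nbhs x) --> L i) ->
  is_rderiv0 (fun s => bext Omega g (Phi (s, t, x)))
    (\sum_i ('D_dir_s Phi (0, t, x)) 0 i * L i).
Proof.
move=> s00 PhiC OO Phi0 stab cx dg cg gL.
pose A : set (R * 'rV[R]_n) := [set p | 0 <= p.1 < s0 /\ Omega p.2].
pose J (p : R * 'rV[R]_n) : P := (p.1, t, p.2).
have z0 : 0 <= (0 : R) < s0 by rewrite lexx.
have cJ p : {for p, continuous J}.
  case: p => a b; apply: (@cvg_pair _ _ _ _ (nbhs (a, t)) (nbhs b)).
    by apply: (@cvg_pair _ _ _ _ (nbhs a) (nbhs t)); [exact: cvg_fst|exact: cvg_cst].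
  exact: cvg_snd.
have OJ p : 0 <= p.1 < s0 -> O (J p) by exact: OO.
have dPhi s y : 0 <= s < s0 -> differentiable Phi (s, t, y).
  by move=> sE; apply: (Ck_differentiable PhiC); exact: OO.
have cPhi p : 0 <= p.1 < s0 -> {for p, continuous (Phi \o J)}.
  move=> pE; apply: continuous_comp; first exact: cJ.
  exact: differentiable_continuous (dPhi _ _ pE).
pose k i (p : R * 'rV[R]_n) := 'D_dir_s Phi (J p) 0 i *
  ('D_(ebase R i) g) (Phi (J p)).
have kL : (fun p => \sum_i k i p) @ within A (nbhs (0, x)) -->
    (\sum_i ('D_dir_s Phi (0, t, x)) 0 i * L i).
  apply: cvg_rsum => i; apply: cvgM.
    apply: cvg_within_filter.
    have : {for (0, x), continuous (fun p => ('D_dir_s Phi \o J) p 0 i)}.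
      apply: continuous_coord_fun; apply: continuous_comp; first exact: cJ.
      by apply: (Ck_continuous (Ck_derive dir_s PhiC)); exact: OJ.
    exact.
  apply: (cvg_comp (Phi \o J) ('D_(ebase R i) g)) (gL i) => B.
  rewrite /within/= => xB.
  have cP : (Phi \o J) p @[p --> (0, x)] --> x.
    by have := cPhi (0, x) z0; rewrite -[X in _ --> X](Phi0 x).
  have := cP _ xB; rewrite /= !nbhs_simpl /=; apply: filterS => p pB [pE Op].
  by apply: pB; exact: stab.
have {}kL e : 0 < e -> \forall s \near 0^'+, \forall y \near within Omega (nbhs x),
    `|g (Phi (s, t, y)) - g y - s * (\sum_i ('D_dir_s Phi (0, t, x)) 0 i * L i)|
      <= s * e.
  move=> e0; have /cvgrPdist_le/(_ _ e0) := kL.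
  rewrite near_withinE => -[[U V] /= [U0 Vx] UV].
  have /nbhs_ballP[d /= d0 dU] := U0.
  near=> s; rewrite near_withinE; near=> y => Oy.
  have s_gt0 : 0 < s by near: s; exact: nbhs_right_gt.
  have sd : s < d by near: s; exact: nbhs_right_lt.
  have ss0 : s < s0 by near: s; exact: nbhs_right_lt.
  have Vy : V y by near: y; exact: Vx.
  have win r : 0 <= r <= s -> 0 <= r < s0.
    by move=> /andP[-> rs]; exact: le_lt_trans rs ss0.
  have der r : 0 <= r <= s -> is_derive r 1 (g \o (fun r => Phi (r, t, y)))
      (\sum_i k i (r, y)).
    move=> rE; have dr := dPhi r y (win _ rE).
    have der1 := is_derive_slice_s dr.
    apply: is_derive_eq.
      apply: chain_derive_rV; last by apply: dg; apply: stab => //; exact: win.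
      by apply/derivable1_diffP; exact: ex_derive.
    by apply: eq_bigr => i _; rewrite /k/= derive_val.
  have [r||r rE] := @MVT _ (g \o (fun r => Phi (r, t, y)))
    (fun r => \sum_i k i (r, y)) 0 s s_gt0.
  - by rewrite in_itv/= => /andP[r0 rs]; apply: der; rewrite !ltW.
  - apply: derivable_within_continuous => r; rewrite in_itv/= => rs.
    exact: (@ex_derive _ _ _ _ _ _ _ (der r rs)).
  rewrite /= Phi0 subr0 => ->; rewrite mulrC -mulrBr normrM gtr0_norm//.
  rewrite ler_pM2l// distrC.
  move: rE; rewrite in_itv/= => /andP[r0 rs].
  apply: (UV (r, y)); split => //=.
    by apply: dU; rewrite /ball/= sub0r normrN gtr0_norm// (lt_trans rs).
  by rewrite ltW//= (lt_trans rs).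
apply/cvgrPdist_le => e e0; near=> s.
have s_gt0 : 0 < s by near: s; exact: nbhs_right_gt.
have ss0 : 0 <= s < s0 by near: s; exact: near_right_ico.
set l := \sum_i _.
rewrite -(ler_pM2l s_gt0) -[X in X * `|_|]gtr0_norm// -normrM mulrBr.
rewrite /GRing.scale/= mulVKf ?gt_eqF// distrC Phi0.
have FF : ProperFilter (within Omega (nbhs x)) by exact: within_nbhs_proper.
have cX : {for x, continuous (fun y => Phi (s, t, y))}.
  apply: differentiable_continuous; apply: differentiable_slice_y; exact: dPhi.
have l1 : (g \o (fun y => Phi (s, t, y))) @ within Omega (nbhs x) -->
    bext Omega g (Phi (s, t, x)).
  apply: (@cvg_within_comp _ _ Omega Omega) => //; first by move=> y; exact: stab.
  have cl : closure Omega (Phi (s, t, x)).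
    by apply: (closure_image cX _ cx) => y; exact: stab.
  by apply: cvg_bext => //; exact: cg.
have l2 := cvg_bext cx (cg _ cx).
apply: (cvgr_to_le (cvg_norm (cvgB (cvgB l1 l2) (cvg_cst (s * l))))).
by near: s; exact: kL.
Unshelve. all: by end_near. Qed.

End BoundaryFlow.

(** * The Euclidean norm *)

Section EuclideanNorm.
Context {R : realType} {n : nat}.
Implicit Types u v w : 'rV[R]_n.

Lemma dotC u v : dot u v = dot v u.
Proof. by apply: eq_bigr => i _; rewrite mulrC. Qed.

Lemma dotDl u v w : dot (u + v) w = dot u w + dot v w.
Proof. by rewrite /dot -big_split; apply: eq_bigr => i _; rewrite mxE mulrDl. Qed.

Lemma dotZl c u v : dot (c *: u) v = c * dot u v.
Proof. by rewrite /dot mulr_sumr; apply: eq_bigr => i _; rewrite mxE mulrA. Qed.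

Lemma dotNl u v : dot (- u) v = - dot u v.
Proof. by rewrite -scaleN1r dotZl mulN1r. Qed.

Lemma dotBl u v w : dot (u - v) w = dot u w - dot v w.
Proof. by rewrite dotDl dotNl. Qed.

Lemma dotDr u v w : dot u (v + w) = dot u v + dot u w.
Proof. by rewrite !(dotC u) dotDl. Qed.

Lemma dotZr c u v : dot u (c *: v) = c * dot u v.
Proof. by rewrite !(dotC u) dotZl. Qed.

Lemma dotBr u v w : dot u (v - w) = dot u v - dot u w.
Proof. by rewrite !(dotC u) dotBl. Qed.

Lemma dot0l u : dot 0 u = 0.
Proof. by rewrite -(scale0r u) dotZl mul0r. Qed.

Lemma dot_ge0 u : 0 <= dot u u.
Proof. by apply: sumr_ge0 => i _; rewrite -expr2 sqr_ge0. Qed.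

Lemma dot_eq0 u : (dot u u == 0) = (u == 0).
Proof.
apply/eqP/eqP => [u0|->]; last exact: dot0l.
apply/rowP => i; rewrite mxE; apply/eqP; rewrite -sqrf_eq0 expr2.
move/eqP: u0; rewrite /dot psumr_eq0; last by move=> j _; rewrite -expr2 sqr_ge0.
by move=> /allP/(_ i (mem_index_enum _)).
Qed.

Lemma dot_gt0 u : (0 < dot u u) = (u != 0).
Proof. by rewrite lt_def dot_eq0 dot_ge0 andbT. Qed.

Lemma enorm_ge0 u : 0 <= enorm u.
Proof. exact: sqrtr_ge0. Qed.

Lemma sqr_enorm u : enorm u * enorm u = dot u u.
Proof. by rewrite -expr2 sqr_sqrtr// dot_ge0. Qed.

Lemma enorm_gt0 u : (0 < enorm u) = (u != 0).
Proof. by rewrite sqrtr_gt0 dot_gt0. Qed.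

Lemma enorm0 : enorm (0 : 'rV[R]_n) = 0.
Proof. by rewrite /enorm dot0l sqrtr0. Qed.

Lemma enormN u : enorm (- u) = enorm u.
Proof. by rewrite /enorm dotNl dotC dotNl opprK. Qed.

Lemma cvg_dot (T : Type) (F : set_system T) {FF : Filter F}
    (f g : T -> 'rV[R]_n) u v :
  (forall i, f x 0 i @[x --> F] --> u 0 i) ->
  (forall i, g x 0 i @[x --> F] --> v 0 i) ->
  dot (f x) (g x) @[x --> F] --> dot u v.
Proof. by move=> fu gv; apply: cvg_rsum => i; exact: cvgM. Qed.

Lemma continuous_enorm : continuous (@enorm R n).
Proof.
move=> u; apply: (@continuous_comp _ _ _ (fun u => dot u u) (@Num.sqrt R)); last exact: sqrt_continuous.
have c i : (fun v : 'rV[R]_n => v 0 i) x @[x --> u] --> u 0 i by exact: coord_continuous.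
exact: (cvg_dot c c).
Qed.

Lemma continuous_enormB u : continuous (fun v => enorm (v - u)).
Proof.
move=> v; apply: (@continuous_comp _ _ _ (fun v => v - u)).
  by apply: (@cvgB _ _ _ (nbhs v) _ id (cst u) v u); [exact: cvg_id|exact: cvg_cst].
exact: continuous_enorm.
Qed.

Lemma near_enormB u v d : enorm (v - u) < d ->
  \forall w \near v, enorm (w - u) < d.
Proof.
have c : (fun w => enorm (w - u)) w @[w --> v] --> enorm (v - u).
  exact: continuous_enormB.
exact: (cvgr_lt _ c).
Qed.

End EuclideanNorm.

(** * Boundary values of little Hoelder functions *)

Section LittleHolder.
Context {R : realType} {n : nat}.
Implicit Types (O : set 'rV[R]_n) (f g : 'rV[R]_n -> R) (l : seq 'I_n).

Lemma Ck_pderivs k O f l : Ck (size l + k) O f -> Ck k O (pderivs l f).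
Proof.
elim: l k => [//|i l IH] k fO; apply: Ck_derive; apply: IH.
by rewrite addnS.
Qed.

Lemma pderivsB O f g l x : open O -> Ck (size l) O f -> Ck (size l) O g ->
  O x -> pderivs l (f \- g) x = pderivs l f x - pderivs l g x.
Proof.
move=> oO; elim: l x => [//|i l IH] x fO gO Ox /=.
have fl : derivable (pderivs l f) x (ebase R i).
  apply: diff_derivable; apply: (@Ck_differentiable _ _ _ 0 O) => //.
  by apply: Ck_pderivs; rewrite addn1.
have gl : derivable (pderivs l g) x (ebase R i).
  apply: diff_derivable; apply: (@Ck_differentiable _ _ _ 0 O) => //.
  by apply: Ck_pderivs; rewrite addn1.
rewrite -deriveB//; apply: near_eq_derive; near=> y.
apply: IH; [exact: CkW|exact: CkW|near: y; exact: open_nbhs_nbhs].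
Unshelve. all: by end_near. Qed.

Lemma Ck_le k k' O f : (k <= k')%N -> Ck k' O f -> Ck k O f.
Proof.
elim: k' => [|k' IH]; first by rewrite leqn0 => /eqP->.
by rewrite leq_eqVlt ltnS => /predU1P[->//|kk' /CkW]; exact: IH.
Qed.

(** The supremum of the empty set is -oo; but a nonempty open set in positive
dimension contains two distinct points, so the supremum is over a nonempty set. *)
Lemma holder_seminorm_ge0 k a O f : (0 < n)%N -> open O -> O !=set0 ->
  (0 <= holder_seminorm k a O f)%E.
Proof.
move=> n0 oO [x Ox]; pose i := Ordinal n0.
have cx : {for (0 : R), continuous (fun h : R => x + h *: ebase R i)}.
  by apply: cvgD; [exact: cvg_cst|apply: cvgZr_tmp; exact: cvg_id].
have : \forall h \near (0 : R), O (x + h *: ebase R i).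
  by apply: cx; rewrite /= scale0r addr0; exact: open_nbhs_nbhs.
move=> /nbhs_ballP[d /= d0 dO].
have Oy : O (x + (d / 2) *: ebase R i).
  apply: dO; rewrite /ball/= sub0r normrN gtr0_norm ?divr_gt0//.
  by rewrite gtr_pMr// invf_lt1 ?ltr1n.
apply: le_trans; last first.
  apply: ereal_sup_ubound; exists (nseq k i), x, (x + (d / 2) *: ebase R i).
  split; [by rewrite size_nseq|by []| |reflexivity].
  move/(congr1 (fun y => y - x)); rewrite subrr addrAC subrr add0r.
  move/esym/eqP; rewrite scaler_eq0 gt_eqF ?divr_gt0//=.
  move=> /eqP/rowP/(_ i); rewrite !mxE !eqxx/= => /eqP.
  by rewrite oner_eq0.
by rewrite lee_fin divr_ge0// powR_ge0.
Qed.

(** The derivatives are uniform limits of those of the approximating functions,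
which are uniformly continuous. *)
Lemma buc_uniform k a O f l : (0 < n)%N -> open O -> O !=set0 ->
  buc k a O f -> (size l <= k)%N -> uniformly_continuous_on O (pderivs l f).
Proof.
move=> n0 oO O0 [fO [b [_ approx]]] lk e e0.
have e3 : 0 < e / 3 by rewrite divr_gt0.
have [g [gO gU _] fg] := approx _ e3.
have close x : O x -> `|pderivs l f x - pderivs l g x| <= e / 3.
  move=> Ox; rewrite -(@pderivsB O)//; [|exact: Ck_le fO|exact: Ck_le gO].
  rewrite -lee_fin; apply: le_trans fg; rewrite /holder_norm.
  rewrite -[leLHS]adde0; apply: leeD; last exact: holder_seminorm_ge0.
  by apply: ereal_sup_ubound; exists l, x.
have [d d0 gd] := gU l lk _ e3.
exists d => // x y Ox Oy xy.
have h1 := close x Ox; have h2 := close y Oy; have h3 := gd x y Ox Oy xy.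
have : `|(pderivs l f x - pderivs l g x) - (pderivs l f y - pderivs l g y) +
   (pderivs l g x - pderivs l g y)| < e / 3 + e / 3 + e / 3.
  apply: le_lt_trans (ler_normD _ _) _; apply: ler_ltD => //.
  by apply: le_trans (ler_normB _ _) _; exact: lerD.
have -> : e / 3 + e / 3 + e / 3 = e by field.
congr (is_true (`|_| < e)).
by move: (pderivs l f x) (pderivs l f y) (pderivs l g x) (pderivs l g y)
  => r1 r2 r3 r4; ring.
Qed.

(** Uniform continuity makes the values near x a Cauchy filter. *)
Lemma uniform_cvg_bext O f x : closure O x -> uniformly_continuous_on O f ->
  cvg (f @ within O (nbhs x)).
Proof.
move=> cx uf; have FF : ProperFilter (within O (nbhs x)).
  exact: within_nbhs_proper.
apply/cauchy_cvgP/cauchy_exP => e e0.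
have [d d0 fd] := uf e e0.
have nx : \forall y \near x, enorm (y - x) < d.
  by apply: near_enormB; rewrite subrr enorm0.
have [y [Oy xy]] := cx _ nx.
exists (f y); suff : \forall z \near x, O z -> ball (f y) e (f z) by [].
have : \forall z \near x, enorm (z - y) < d.
  by apply: near_enormB; rewrite -enormN opprB.
apply: filterS => z zy Oz; apply: fd => //.
by rewrite -enormN opprB.
Qed.

End LittleHolder.

(** * Outward unit normals *)

Section UnitNormal.
Context {R : realType} {n : nat}.
Implicit Types (Omega U : set 'rV[R]_n) (rho : 'rV[R]_n -> R).
Implicit Types x v e u g w : 'rV[R]_n.

Lemma grad_dot rho x e : differentiable rho x -> dot (grad rho x) e = 'D_e rho x.
Proof.
by move=> dr; rewrite derive_rV// dotC; apply: eq_bigr => i _; rewrite mxE.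
Qed.

Lemma is_rderiv0_lt0 (F : R -> R) l : is_rderiv0 F l -> F 0 = 0 -> l < 0 ->
  \forall h \near 0^'+, F h < 0.
Proof.
move=> Fl F0 l0.
have /cvgr_lt/(_ _ l0) H : h^-1 *: (F h - F 0) @[h --> 0^'+] --> l := Fl.
near=> h; have h0 : 0 < h by near: h; exact: nbhs_right_gt.
have : h^-1 *: (F h - F 0) < 0 by near: h; exact: H.
by rewrite F0 subr0 pmulr_rlt0// invr_gt0.
Unshelve. all: by end_near. Qed.

Lemma is_rderiv0_line rho x e : differentiable rho x ->
  is_rderiv0 (fun h => rho (x + h *: e)) ('D_e rho x).
Proof.
move=> dr; apply: is_derive_rderiv0.
apply: (@is_derive_affine _ _ _ _ (fun h : R => x + h *: e) rho 0 1 e).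
  by move=> k; rewrite scale0r !addr0 [k *: 1]mulr1 addrC.
by rewrite scale0r addr0; exact: differentiable_is_derive.
Qed.

Lemma near_line (U : set 'rV[R]_n) x e : open U -> U x ->
  \forall h \near (0 : R)^'+, U (x + h *: e).
Proof.
move=> oU Ux; have cx : (fun h : R => x + h *: e) h @[h --> (0 : R)] --> x.
  suff : (fun h : R => x + h *: e) h @[h --> (0 : R)] --> x + 0 *: e.
    by rewrite scale0r addr0.
  by apply: cvgD; [exact: cvg_cst|apply: cvgZr_tmp; exact: cvg_id].
apply: cvg_within; apply: cx; exact: open_nbhs_nbhs.
Qed.

Lemma normalize_dot u : u != 0 ->
  dot ((enorm u)^-1 *: u) ((enorm u)^-1 *: u) = 1.
Proof.
move=> u0; rewrite dotZl dotZr -sqr_enorm; field.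
by rewrite gt_eqF// enorm_gt0.
Qed.

(** With unit vectors w and w', the direction w' - w works, since w . w' < 1. *)
Lemma separating_direction g g' : g != 0 -> g' != 0 ->
  (enorm g)^-1 *: g != (enorm g')^-1 *: g' ->
  exists e, dot g e < 0 /\ 0 < dot g' e.
Proof.
move=> g0 g0'; have := normalize_dot g0; have := normalize_dot g0'.
have e0 : 0 < enorm g by rewrite enorm_gt0.
have e0' : 0 < enorm g' by rewrite enorm_gt0.
have gw u : u != 0 -> u = enorm u *: ((enorm u)^-1 *: u).
  by move=> u0; rewrite scalerA mulfV ?scale1r// gt_eqF// enorm_gt0.
move: (gw g g0) (gw g' g0').
move: (_^-1 *: g) (_^-1 *: g') => w w' -> -> ww' ww wne.
have ww'1 : dot w w' < 1.
  have : 0 < dot (w - w') (w - w') by rewrite dot_gt0 subr_eq0.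
  by rewrite !dotBl !dotBr ww ww' (dotC w' w); lra.
exists (w' - w); rewrite !dotZl !dotBr ww ww' (dotC w' w).
by rewrite pmulr_rlt0// pmulr_rgt0// subr_lt0 subr_gt0.
Qed.

(** Two defining functions whose normalised gradients differ would disagree
about points close to x in a direction that separates the gradients. *)
Lemma outward_unit_normal_unique Omega x v v' :
  is_outward_unit_normal Omega x v -> is_outward_unit_normal Omega x v' -> v = v'.
Proof.
move=> [U [rho [[oU Ux] [rC g0] Oneg rx ->]]].
move=> [U' [rho' [[oU' U'x] [rC' g0'] Oneg' rx' ->]]].
apply/eqP; apply: contraT => /(separating_direction g0 g0')[e].
have [dr _] := rC; have [dr' _] := rC'.
rewrite !grad_dot; [|exact: dr'|exact: dr] => -[neg pos].
have z0 (f : 'rV[R]_n -> R) : f x = 0 -> f (x + 0 *: e) = 0.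
  by rewrite scale0r addr0.
have n1 := is_rderiv0_lt0 (is_rderiv0_line (e := e) (dr x Ux)) (z0 _ rx) neg.
have n2 : \forall h \near 0^'+, - rho' (x + h *: e) < 0.
  apply: (is_rderiv0_lt0 (is_rderiv0N (is_rderiv0_line (e := e) (dr' x U'x)))).
    by rewrite z0// oppr0.
  by rewrite oppr_lt0.
have /filter_ex[h [[Uh U'h] [h1 h2]]] :
    \forall h \near (0 : R)^'+, (U (x + h *: e) /\ U' (x + h *: e)) /\
    (rho (x + h *: e) < 0 /\ - rho' (x + h *: e) < 0).
  by apply: filterI; apply: filterI => //; exact: near_line.
move/(Oneg _ Uh)/(Oneg' _ U'h) : h1; move: h2; rewrite oppr_lt0 => h2 h1.
by move: (lt_trans h1 h2); rewrite ltxx.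
Qed.

Lemma unit_normalE Omega x v : is_outward_unit_normal Omega x v ->
  unit_normal Omega x = v.
Proof.
rewrite /unit_normal => xv; case: xgetP => [w _ xw|/(_ v)//].
exact: outward_unit_normal_unique xw xv.
Qed.

(** The image of Omega under X is described by rho o Z, whose gradient is q. *)
Lemma outward_unit_normal_image Omega U rho (X Z : 'rV[R]_n -> 'rV[R]_n) x :
    cancel X Z -> cancel Z X -> Ck 1 setT Z ->
    open U -> U x -> Ck 1 U rho -> (forall z, U z -> Omega z <-> rho z < 0) ->
    rho x = 0 ->
  let q := \row_i \sum_k 'D_(ebase R i) Z (X x) 0 k * 'D_(ebase R k) rho x in
  q != 0 -> is_outward_unit_normal (X @` Omega) (X x) ((enorm q)^-1 *: q).
Proof.
move=> XZ ZX ZC oU Ux rC Oneg rx q q0.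
have dZ z : differentiable Z z by exact: (Ck_differentiable ZC).
have cZ z : {for z, continuous Z} by exact: (Ck_continuous ZC).
have dr z : U z -> differentiable rho z by move=> Uz; exact: (Ck_differentiable rC).
have der z v : U (Z z) -> is_derive z v (rho \o Z)
    (\sum_k 'D_v Z z 0 k * 'D_(ebase R k) rho (Z z)).
  by move=> UZz; apply: chain_derive_rV => //; exact: dr.
have oU' : open (Z @^-1` U) by apply: open_comp => // z _; exact: cZ.
have gq : grad (rho \o Z) (X x) = q.
  apply/rowP => i; rewrite !mxE.
  have UZ : U (Z (X x)) by rewrite XZ.
  have D := der (X x) (ebase R i) UZ.
  by rewrite (derive_val (is_derive := D)) XZ.
exists (Z @^-1` U), (rho \o Z); split.
- by split => //=; rewrite XZ.
- split; last by rewrite gq.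
  split => [z Uz|v].
    by apply: differentiable_comp => //; exact: dr.
  apply: (@Ck_eq _ _ _ 0 _ (fun z => \sum_k 'D_v Z z 0 k * 'D_(ebase R k) rho (Z z))).
  + exact: oU'.
  + move=> z Uz; have D := der z v Uz.
    by rewrite (derive_val (is_derive := D)).
  + move=> z Uz; apply: (@cvg_rsum _ _ _ (nbhs_filter z)) => k; apply: cvgM.
      have cD : {for z, continuous ('D_v Z)} by exact: (Ck_continuous (Ck_derive v ZC)).
      exact: (continuous_coord_fun cD).
    have cD : {for Z z, continuous ('D_(ebase R k) rho)}.
      exact: (Ck_continuous (Ck_derive _ rC)).
    exact: (continuous_comp (cZ z) cD).
- move=> z Uz; rewrite -(Oneg _ Uz); split=> [[y Oy <-]|Oz]; first by rewrite XZ.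
  by exists (Z z).
- by rewrite /= XZ.
- by rewrite gq.
Qed.

End UnitNormal.

(** * Functions vanishing on the boundary have a normal gradient *)

Section TangentialGradient.
Context {R : realType} {n : nat}.
Implicit Types (Omega U N : set 'rV[R]_n) (rho g : 'rV[R]_n -> R).
Implicit Types x z v e p : 'rV[R]_n.

Definition norm1 v : R := \sum_i `|v 0 i|.

Lemma norm1_ge0 v : 0 <= norm1 v. Proof. exact: sumr_ge0. Qed.

Lemma norm1D u v : norm1 (u + v) <= norm1 u + norm1 v.
Proof.
by rewrite /norm1 -big_split; apply: ler_sum => i _; rewrite mxE ler_normD.
Qed.

Lemma norm1Z c v : norm1 (c *: v) = `|c| * norm1 v.
Proof. by rewrite /norm1 mulr_sumr; apply: eq_bigr => i _; rewrite mxE normrM. Qed.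

Lemma norm1N v : norm1 (- v) = norm1 v.
Proof. by rewrite -scaleN1r norm1Z normrN1 mul1r. Qed.

Lemma derive_close g z v (L : 'rV[R]_n) (d : R) : differentiable g z ->
  (forall i, `|'D_(ebase R i) g z - L 0 i| <= d) ->
  `|'D_v g z - dot L v| <= d * norm1 v.
Proof.
move=> dg gL; rewrite derive_rV// /dot -sumrB /norm1 mulr_sumr.
apply: le_trans (ler_norm_sum _ _ _) _; apply: ler_sum => i _.
by rewrite [L 0 i * _]mulrC -mulrBr normrM mulrC ler_wpM2r.
Qed.

Lemma right_interval (Q : R -> Prop) : (\forall h \near 0^'+, Q h) ->
  exists2 d : R, 0 < d & forall h, 0 < h < d -> Q h.
Proof.
move=> /nbhs_ballP[d /= d0 dQ]; exists d => // h /andP[h0 hd].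
by apply: dQ => //; rewrite /ball/= sub0r normrN gtr0_norm.
Qed.

Lemma cvg_ray Omega g z v h : 0 < h -> closure Omega z ->
  cvg (g @ within Omega (nbhs z)) ->
  (forall k, 0 < k <= h -> Omega (z + k *: v)) ->
  g (z + k *: v) @[k --> 0^'+] --> bext Omega g z.
Proof.
move=> h0 cz cg zO.
apply: (@cvg_comp _ _ _ (fun k => z + k *: v) g _ (within Omega (nbhs z)));
  last exact: cvg_bext.
move=> A; rewrite /within/= => zA.
have cv : (fun k : R => z + k *: v) k @[k --> (0 : R)] --> z.
  suff : (fun h : R => z + h *: v) h @[h --> (0 : R)] --> z + 0 *: v.
    by rewrite scale0r addr0.
  by apply: cvgD; [exact: cvg_cst|apply: cvgZr_tmp; exact: cvg_id].
have near1 : \forall k \near 0^'+, Omega (z + k *: v) -> A (z + k *: v).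
  by apply: cvg_within; exact: (cv _ zA).
suff : \forall k \near 0^'+, A (z + k *: v) by [].
near=> k; apply: (near near1 k) => //; apply: zO; apply/andP; split.
  by near: k; exact: nbhs_right_gt.
by near: k; exact: nbhs_right_le.
Unshelve. all: by end_near. Qed.

(** The base point z may lie on the boundary, where g has no derivative: the mean
value theorem is applied between z + k v and z + h v, and then k --> 0. *)
Lemma segment_bound Omega g z v (L : 'rV[R]_n) (h d : R) :
    0 < h -> closure Omega z -> cvg (g @ within Omega (nbhs z)) ->
    (forall k, 0 < k <= h -> [/\ Omega (z + k *: v),
       differentiable g (z + k *: v) &
       forall i, `|'D_(ebase R i) g (z + k *: v) - L 0 i| <= d]) ->
  `|g (z + h *: v) - bext Omega g z - h * dot L v| <= h * (d * norm1 v).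
Proof.
move=> h0 cz cg H.
have d0 : 0 <= d * norm1 v.
  have hh : 0 < h <= h by rewrite h0/=.
  have [_ dg /(derive_close v dg)] := H h hh.
  exact: le_trans.
have lim1 : g (z + h *: v) - g (z + k *: v) - (h - k) * dot L v @[k --> 0^'+] -->
    g (z + h *: v) - bext Omega g z - (h - 0) * dot L v.
  apply: cvgB; last apply: cvgMl.
    apply: cvgB; first exact: cvg_cst.
    by apply: cvg_ray h0 cz cg _ => k /H[].
  by apply: cvgB; [exact: cvg_cst|apply: cvg_within].
rewrite -[X in X * dot L v]subr0.
apply: (cvgr_to_le (cvg_norm lim1)); near=> k.
have k0 : 0 < k by near: k; exact: nbhs_right_gt.
have kh : k < h by near: k; exact: nbhs_right_lt.
have hk0 : 0 < h - k by rewrite subr_gt0.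
have addE t : z + k *: v + t *: v = z + (k + t) *: v by rewrite scalerDl addrA.
have kt t : 0 <= t <= h - k -> 0 < k + t <= h.
  by move=> /andP[t0 th]; apply/andP; split; lra.
have [t /kt/H[_ dg _]|c ck] := @MVT_line _ _ g (z + k *: v) v (h - k) hk0.
  by rewrite addE.
rewrite addE (addrC k) subrK => ->; rewrite -mulrBr normrM gtr0_norm// addE.
have [|_ dg gL] := H (k + c); first by apply: kt; case/andP: ck => *; rewrite !ltW.
apply: le_trans (ler_wpM2l (ltW hk0) (derive_close v dg gL)) _.
by rewrite ler_wpM2r//; lra.
Unshelve. all: by end_near. Qed.

Lemma add_in_range (b c t k : R) : 0 <= t -> 0 <= k -> k <= c - t -> c <= b ->
  0 <= t + k <= b.
Proof. by move=> *; apply/andP; split; lra. Qed.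

Lemma sub_in_range (c k : R) : 0 < k -> k <= c -> 0 <= c - k < c.
Proof. by move=> *; apply/andP; split; lra. Qed.

(** Near x a hypersurface point is reached from x + h (tau - d p), h > 0, by
moving a distance of order d h along the normal p. As g vanishes at both ends of
this broken path inside Omega, its slope along tau is of order d. *)
Lemma tangential_derivative_small Omega Gamma U rho g x tau (L : 'rV[R]_n) (d : R) :
    open U -> U x -> Ck 1 U rho ->
    (forall z, U z -> Omega z <-> rho z < 0) ->
    (forall z, U z -> Gamma z <-> rho z = 0) ->
    (forall z, Gamma z -> closure Omega z) -> Gamma x ->
    grad rho x != 0 -> dot (grad rho x) tau = 0 ->
    (forall y, Omega y -> differentiable g y) ->
    (forall y, Gamma y -> cvg (g @ within Omega (nbhs y))) ->
    (forall y, Gamma y -> bext Omega g y = 0) ->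
    (forall i, 'D_(ebase R i) g @ within Omega (nbhs x) --> L 0 i) ->
    0 < d -> d <= 1 ->
  `|dot L tau| <= d * (3 * `|dot L (grad rho x)| + norm1 tau + 3 * norm1 (grad rho x)).
Proof.
move=> oU Ux rC OU GU Gcl Gx p0 ptau dg cg g0 gL d0 d1.
have dr z : U z -> differentiable rho z by move=> Uz; exact: (Ck_differentiable rC).
have Dp := @grad_dot _ _ rho x _ (dr x Ux).
have rx : rho x = 0 by apply/GU.
move: (grad rho x) p0 ptau Dp => p p0 ptau Dp.
pose e := tau - d *: p.
have pp : 0 < dot p p by rewrite dot_gt0.
have De : 'D_e rho x < 0.
  by rewrite -Dp dotBr ptau dotZr sub0r oppr_lt0 mulr_gt0.
have De' : - 'D_(tau + d *: p) rho x < 0.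
  by rewrite -Dp dotDr ptau dotZr add0r oppr_lt0 mulr_gt0.
pose N z := U z /\ (0 < 'D_p rho z /\
  (Omega z -> forall i, `|'D_(ebase R i) g z - L 0 i| <= d)).
have Nx : \forall z \near x, N z.
  apply: filterI; first exact: open_nbhs_nbhs.
  apply: filterI.
    have cD : 'D_p rho z @[z --> x] --> 'D_p rho x.
      exact: (@Ck_continuous _ _ _ 0 U _ x (Ck_derive p rC) Ux).
    by apply: (cvgr_gt _ cD); rewrite -Dp.
  suff : \forall z \near within Omega (nbhs x),
      forall i, `|'D_(ebase R i) g z - L 0 i| <= d by [].
  apply: filter_forall => i.
  by have /cvgr_distC_le/(_ _ d0) := gL i.
(* All points used below lie in a small box spanned by e and p at x. *)
pose G (ab : R * R) := x + ab.1 *: e + ab.2 *: p.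
have cG : G ab @[ab --> (0, 0)] --> x.
  suff : G ab @[ab --> (0, 0)] --> G (0, 0) by rewrite /G !scale0r !addr0.
  apply: cvgD; first apply: cvgD; first exact: cvg_cst.
  - by apply: cvgZr_tmp; exact: cvg_fst.
  - by apply: cvgZr_tmp; exact: cvg_snd.
have [[A B] /= [A0 B0] AB] := cG _ Nx.
have [/nbhs_ballP[r1 /= r10 rA] /nbhs_ballP[r2 /= r20 rB]] := (A0, B0).
have zr : rho (x + 0 *: e) = 0 by rewrite scale0r addr0.
have [r3 r30 neg] :=
  right_interval (is_rderiv0_lt0 (is_rderiv0_line (e := e) (dr x Ux)) zr De).
have zr' : - rho (x + 0 *: (tau + d *: p)) = 0 by rewrite scale0r addr0 rx oppr0.
have [r4 r40 pos] := right_interval (is_rderiv0_lt0 (is_rderiv0N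
  (is_rderiv0_line (e := tau + d *: p) (dr x Ux))) zr' De').
have [h [h0 hr1 hr2 hr3 hr4]] : exists h, [/\ 0 < h, h < r1, 2 * h < r2, h < r3 & h < r4].
  have /filter_ex[h H] : \forall h \near (0 : R)^'+,
      [/\ 0 < h, h < r1, 2 * h < r2, h < r3 & h < r4].
    near=> h; split.
    + by near: h; exact: nbhs_right_gt.
    + by near: h; exact: nbhs_right_lt.
    + rewrite mulrC -ltr_pdivlMr//; near: h; apply: nbhs_right_lt.
      by rewrite divr_gt0.
    + by near: h; exact: nbhs_right_lt.
    + by near: h; exact: nbhs_right_lt.
  by exists h.
have NG a b : 0 <= a <= h -> 0 <= b <= 2 * (d * h) -> N (x + a *: e + b *: p).
  move=> /andP[a0 ah] /andP[b0 bh]; apply: (AB (a, b)); split => /=.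
    by apply: rA; rewrite /ball/= sub0r normrN ger0_norm// (le_lt_trans ah).
  apply: rB; rewrite /ball/= sub0r normrN ger0_norm// (le_lt_trans bh)//.
  apply: le_lt_trans hr2; rewrite ler_pM2l//.
  by rewrite ger_pMl.
have hh : 0 <= h <= h by rewrite lexx ltW.
have dh0 : 0 < 2 * (d * h) by rewrite !mulr_gt0.
have NG0 a : 0 <= a <= h -> N (x + a *: e).
  move=> ah; rewrite -[_ + _]addr0 -(scale0r p); apply: NG => //.
  by rewrite lexx ltW.
pose y := x + h *: e.
have path1 k : 0 < k <= h -> Omega (x + k *: e).
  move=> /andP[k0 kh].
  have [Uz _] : N (x + k *: e) by apply: NG0; rewrite ltW.
  by apply/(OU _ Uz); apply: neg; rewrite k0 (le_lt_trans kh).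
have bound1 := @segment_bound Omega g x e L h d h0 (Gcl _ Gx) (cg _ Gx).
have {}bound1 : `|g y - h * dot L e| <= h * (d * norm1 e).
  rewrite -[g y]subr0 -(g0 _ Gx); apply: bound1 => k kh.
  have Oz := path1 _ kh; split => //; first exact: dg.
  have [_ [_]] : N (x + k *: e) by apply: NG0; case/andP: kh => /ltW ->.
  exact.
have dry t : 0 <= t <= 2 * (d * h) -> differentiable rho (y + t *: p).
  by move=> th; apply: dr; have [] := NG h t hh th.
have ry0 : rho (y + 0 *: p) < 0.
  by rewrite scale0r addr0; apply: neg; rewrite h0.
have ry1 : 0 < rho (y + (2 * (d * h)) *: p).
  have -> : y + (2 * (d * h)) *: p = x + h *: (tau + d *: p).
    rewrite /y /e -addrA; congr (x + _); apply/rowP => i; rewrite !mxE; ring.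
  by rewrite -oppr_lt0; apply: pos; rewrite h0.
(* The derivative of rho along p is positive, so the zero found on the ray is
   the first one: the ray stays in Omega before it. *)
have [c cI rc0] : exists2 c, c \in `[0, 2 * (d * h)] & rho (y + c *: p) = 0.
  apply: (@IVT _ (fun t : R => rho (y + t *: p))); first exact: ltW.
    apply: derivable_within_continuous => t; rewrite in_itv/= => tI.
    have -> : (fun t : R => rho (y + t *: p)) = rho \o (fun t : R => y + t *: p) by [].
    rewrite (@derivable_affine _ _ _ _ (fun t : R => y + t *: p) rho t 1 p).
      exact/diff_derivable/dry.
    by move=> k; rewrite scalerDl addrCA [k *: 1]mulr1.
  by rewrite ge_min (ltW ry0)/= le_max (ltW ry1) orbT.
move: cI; rewrite in_itv/= => /andP[c0 c1].
have {c0} c0 : 0 < c.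
  by rewrite lt_def c0 andbT; apply/eqP => cE; move: ry0; rewrite -{1}cE rc0 ltxx.
have path2 t : 0 <= t < c -> rho (y + t *: p) < 0.
  move=> /andP[t0 tc]; have ct0 : 0 < c - t by rewrite subr_gt0.
  have addE k : y + t *: p + k *: p = y + (t + k) *: p by rewrite scalerDl addrA.
  have [k /andP[k0 kc]|k /andP[k0 kc]] := @MVT_line _ _ rho (y + t *: p) p (c - t) ct0.
    by rewrite addE; apply: dry; exact: add_in_range kc c1.
  rewrite !addE (addrC t (c - t)) subrK rc0 sub0r => E.
  rewrite -oppr_gt0 E mulr_gt0//.
  have [_ []//] : N (y + (t + k) *: p).
  by apply: NG => //; exact: add_in_range (ltW k0) (ltW kc) c1.
pose z := y + c *: p.
have Gz : Gamma z.
  have [Uz _] : N z by apply: NG => //; rewrite c1 ltW.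
  by apply/(GU _ Uz).
have zE k : z + k *: - p = y + (c - k) *: p.
  by rewrite /z scalerBl scalerN addrA.
have bound2 := @segment_bound Omega g z (- p) L c d c0 (Gcl _ Gz) (cg _ Gz).
have {}bound2 : `|g y + c * dot L p| <= c * (d * norm1 p).
  have E : dot L (- p) = - dot L p by rewrite dotC dotNl dotC.
  rewrite -(norm1N p) -[c * dot L p]opprK -mulrN -E.
  have -> : g y = g (z + c *: - p) - bext Omega g z.
    by rewrite zE subrr scale0r addr0 (g0 _ Gz) subr0.
  apply: bound2 => k /andP[k0 kc]; rewrite zE.
  have ck := sub_in_range k0 kc; have /andP[ck0 ckc] := ck.
  have [Uz [_ NL]] : N (y + (c - k) *: p).
    by apply: NG => //; rewrite ck0 (ltW (lt_le_trans ckc c1)).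
  have Oz : Omega (y + (c - k) *: p) by apply/(OU _ Uz); exact: path2.
  by split; [|exact: dg|exact: NL].
have LE : dot L e = dot L tau - d * dot L p by rewrite dotBr dotZr.
have e1 : norm1 e <= norm1 tau + d * norm1 p.
  by apply: le_trans (norm1D _ _) _; rewrite norm1N norm1Z gtr0_norm.
have n1p := norm1_ge0 p; have n1t := norm1_ge0 tau.
rewrite LE in bound1.
move: (dot L tau) (dot L p) (norm1 p) (norm1 tau) (norm1 e) (g y) n1p n1t e1 bound1 bound2.
move=> lt lp np nt ne gy np0 nt0 e1 b1 b2.
have q1 : h * `|lt| <= `|gy - h * (lt - d * lp)| + `|gy + c * lp| + (c + h * d) * `|lp|.
  have -> : h * `|lt| = `|- (gy - h * (lt - d * lp)) + (gy + c * lp) - (c - h * d) * lp|.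
    rewrite -{1}(gtr0_norm h0) -normrM; congr `|_|; ring.
  apply: le_trans (ler_normB _ _) _; rewrite lerD//.
    by apply: le_trans (ler_normD _ _) _; rewrite normrN.
  rewrite normrM ler_wpM2r//; apply: le_trans (ler_normB _ _) _.
  by rewrite !gtr0_norm ?mulr_gt0.
have hd0 : 0 < h * d by rewrite mulr_gt0.
rewrite -(ler_pM2l h0); apply: le_trans q1 _.
have q2 : h * (d * ne) <= h * (d * (nt + np)).
  rewrite !ler_pM2l//; apply: le_trans e1 _; rewrite lerD2l ler_piMl//.
have q3 : c * (d * np) <= h * (d * (2 * np)).
  apply: (@le_trans _ _ (2 * (d * h) * (d * np))).
    by rewrite ler_wpM2r// mulr_ge0// ltW.
  have -> : 2 * (d * h) * (d * np) = d * (h * (d * (2 * np))) by ring.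
  by rewrite ler_piMl// !mulr_ge0// ltW.
have q4 : (c + h * d) * `|lp| <= h * (d * (3 * `|lp|)).
  have -> : h * (d * (3 * `|lp|)) = (3 * (h * d)) * `|lp| by ring.
  rewrite ler_wpM2r//; move: c1; rewrite (mulrC d h); clear; lra.
have -> : h * (d * (3 * `|lp| + nt + 3 * np)) =
   h * (d * (nt + np)) + h * (d * (2 * np)) + h * (d * (3 * `|lp|)) by ring.
by rewrite !lerD// (le_trans b1 q2, le_trans b2 q3).
Unshelve. all: by end_near. Qed.

(** The tangential part of L is orthogonal to L, because its product with L is
of order d for every d > 0. *)
Lemma gradient_normal Omega Gamma U rho g x (L nu : 'rV[R]_n) :
    open U -> U x -> Ck 1 U rho ->
    (forall z, U z -> Omega z <-> rho z < 0) ->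
    (forall z, U z -> Gamma z <-> rho z = 0) ->
    (forall z, Gamma z -> closure Omega z) -> Gamma x ->
    grad rho x != 0 -> nu = (enorm (grad rho x))^-1 *: grad rho x ->
    (forall y, Omega y -> differentiable g y) ->
    (forall y, Gamma y -> cvg (g @ within Omega (nbhs y))) ->
    (forall y, Gamma y -> bext Omega g y = 0) ->
    (forall i, 'D_(ebase R i) g @ within Omega (nbhs x) --> L 0 i) ->
  L = dot nu L *: nu.
Proof.
move=> oU Ux rC OU GU Gcl Gx p0 nuE dg cg g0 gL.
pose tau := L - dot nu L *: nu.
have nn : dot nu nu = 1 by rewrite nuE; exact: normalize_dot.
have nt : dot nu tau = 0 by rewrite dotBr dotZr nn mulr1 subrr.
have e0 : enorm (grad rho x) != 0 by rewrite gt_eqF// enorm_gt0.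
have pt : dot (grad rho x) tau = 0.
  by move: nt; rewrite nuE dotZl => /eqP; rewrite mulf_eq0 invr_eq0 (negPf e0) => /eqP.
have small d := @tangential_derivative_small Omega Gamma U rho g x tau L d oU Ux rC OU
  GU Gcl Gx p0 pt dg cg g0 gL.
have Lt : dot L tau = 0.
  move: small; set C := _ + _; move=> small.
  apply/eqP; rewrite -normr_eq0; apply/eqP/le_anti; rewrite normr_ge0 andbT.
  have C0 : 0 <= C by rewrite !addr_ge0// ?mulr_ge0// norm1_ge0.
  have lim0 : d * C @[d --> 0^'+] --> 0 * C.
    by apply: cvgMl; apply: cvg_within.
  rewrite -(mul0r C); apply: (cvgr_to_ge lim0); near=> d; apply: small.
    by near: d; exact: nbhs_right_gt.
  by near: d; exact: nbhs_right_le.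
apply/eqP; rewrite -subr_eq0 -/tau -dot_eq0 {1}/tau dotBl dotZl nt Lt.
by rewrite mulr0 subrr.
Unshelve. all: by end_near. Qed.

End TangentialGradient.

(** * Derivatives of the pushed forward function *)

Section Extensions.
Context {R : realType} {n : nat}.
Local Notation P := (R * R * 'rV[R]_n)%type.
Implicit Types (s t : R) (x y e : 'rV[R]_n).

(** The deformations and their inverses, together with extensions F and Z of
both to open sets of space-time: right derivatives at s = 0 become ordinary
partial derivatives of the extensions. *)
Record flow_extension (s0 : R) (phi psi : R -> R -> 'rV[R]_n -> 'rV[R]_n)
    (F Z : P -> 'rV[R]_n) (OF OZ : set P) : Prop := FlowExtension {
  flow_s0 : 0 < s0;
  flow_phiK : forall s t, 0 <= s < s0 -> 0 <= t -> cancel (phi s t) (psi s t);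
  flow_psiK : forall s t, 0 <= s < s0 -> 0 <= t -> cancel (psi s t) (phi s t);
  flow_phi0 : forall t x, 0 <= t -> phi 0 t x = x;
  flow_openF : open OF;
  flow_CkF : Ck 2 OF F;
  flow_domF : forall s t x, 0 <= s < s0 -> 0 <= t -> OF (s, t, x);
  flow_eqF : forall s t x, 0 <= s < s0 -> 0 <= t -> phi s t x = F (s, t, x);
  flow_CkZ : Ck 2 OZ Z;
  flow_domZ : forall s t x, 0 <= s < s0 -> 0 <= t -> OZ (s, t, x);
  flow_eqZ : forall s t x, 0 <= s < s0 -> 0 <= t -> psi s t x = Z (s, t, x) }.

Record pullback_extension (k : nat) (s0 : R) (A : set 'rV[R]_n)
    (v : R -> R -> 'rV[R]_n -> R) (V : P -> R) (OV : set P) : Prop :=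
  PullbackExtension {
  pull_open : open OV;
  pull_Ck : Ck k OV V;
  pull_dom : forall s t x, 0 <= s < s0 -> 0 < t -> A x -> OV (s, t, x);
  pull_eq : forall s t x, 0 <= s < s0 -> 0 < t -> A x -> v s t x = V (s, t, x) }.

Lemma pullback_extensionW k s0 (A B : set 'rV[R]_n) v V OV : B `<=` A ->
  pullback_extension k.+1 s0 A v V OV -> pullback_extension k s0 B v V OV.
Proof.
move=> BA [oV VC VD VE]; split => //; first exact: CkW.
- by move=> s t x sE t0 /BA; exact: VD.
- by move=> s t x sE t0 /BA; exact: VE.
Qed.

Lemma derive_pair (V W1 W2 : normedModType R) (f : V -> W1) (g : V -> W2) (x v : V) :
  differentiable f x -> differentiable g x ->
  'D_v (fun z : V => (f z, g z)) x = ('D_v f x, 'D_v g x).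
Proof.
move=> df dg; rewrite deriveE; last exact: differentiable_pair.
by rewrite diff_pair//= !deriveE.
Qed.

End Extensions.

Section Pullback.
Context {R : realType} {n : nat}.
Local Notation P := (R * R * 'rV[R]_n)%type.
Local Notation dy := (fun k : 'I_n => @dir_y R n (ebase R k)).
Implicit Types (s t : R) (x y e : 'rV[R]_n).

Context (Omega0 : set 'rV[R]_n) (s0 : R).
Context (phi psi : R -> R -> 'rV[R]_n -> 'rV[R]_n) (v : R -> R -> 'rV[R]_n -> R).
Context (F Z : P -> 'rV[R]_n) (V : P -> R) (OF OZ OV : set P).
Context (oOm : open Omega0).
Context (H : flow_extension s0 phi psi F Z OF OZ).
Let s00 := flow_s0 H.
Let phiK := flow_phiK H.
Let psiK := flow_psiK H.
Let phi0 := flow_phi0 H.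
Let FC := flow_CkF H.
Let FD := flow_domF H.
Let FE := flow_eqF H.
Let ZC := flow_CkZ H.
Let ZD := flow_domZ H.
Let ZE := flow_eqZ H.

Lemma range0 : 0 <= (0 : R) < s0. Proof. by rewrite lexx s00. Qed.

Lemma psi0 t x : 0 <= t -> psi 0 t x = x.
Proof. by move=> t0; rewrite -{1}(phi0 x t0) phiK ?range0. Qed.

Lemma dZ s t x : 0 <= s < s0 -> 0 <= t -> differentiable Z (s, t, x).
Proof. by move=> *; apply: (Ck_differentiable ZC); exact: ZD. Qed.

Lemma dF s t x : 0 <= s < s0 -> 0 <= t -> differentiable F (s, t, x).
Proof. by move=> *; apply: (Ck_differentiable FC); exact: FD. Qed.

Lemma psi_slice s t : 0 <= s < s0 -> 0 <= t -> psi s t = fun y => Z (s, t, y).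
Proof. by move=> *; apply/funext => y; exact: ZE. Qed.

Lemma phi_slice s t : 0 <= s < s0 -> 0 <= t -> phi s t = fun y => F (s, t, y).
Proof. by move=> *; apply/funext => y; exact: FE. Qed.

Lemma psi_differentiable s t y : 0 <= s < s0 -> 0 <= t -> differentiable (psi s t) y.
Proof.
by move=> sE t0; rewrite psi_slice//; apply: differentiable_slice_y; exact: dZ.
Qed.

Lemma psi_derive s t y e : 0 <= s < s0 -> 0 <= t ->
  'D_e (psi s t) y = 'D_(dir_y e) Z (s, t, y).
Proof. by move=> sE t0; rewrite (psi_slice sE t0); exact: derive_slice_y. Qed.

Lemma phi_differentiable s t y : 0 <= s < s0 -> 0 <= t -> differentiable (phi s t) y.
Proof.
by move=> sE t0; rewrite phi_slice//; apply: differentiable_slice_y; exact: dF.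
Qed.

Lemma psi_continuous s t y : 0 <= s < s0 -> 0 <= t -> {for y, continuous (psi s t)}.
Proof. by move=> *; apply: differentiable_continuous; exact: psi_differentiable. Qed.

Lemma phi_continuous s t y : 0 <= s < s0 -> 0 <= t -> {for y, continuous (phi s t)}.
Proof. by move=> *; apply: differentiable_continuous; exact: phi_differentiable. Qed.

Lemma psi_image s t y : 0 <= s < s0 -> 0 <= t ->
  (phi s t @` Omega0) y <-> Omega0 (psi s t y).
Proof.
move=> sE t0; split => [[x Ox <-]|Oy]; first by rewrite phiK.
by exists (psi s t y) => //; exact: psiK.
Qed.

Lemma open_image s t : 0 <= s < s0 -> 0 <= t -> open (phi s t @` Omega0).
Proof.
move=> sE t0; have -> : phi s t @` Omega0 = psi s t @^-1` Omega0.
  by apply/funext => y; apply/propext; exact: psi_image.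
by apply: open_comp => // y _; exact: psi_continuous.
Qed.

Lemma near_ge0 (t : R) : 0 < t -> \forall t' \near t, 0 <= t'.
Proof.
move=> t0; have : \forall t' \near t, 0 < t' by exact: (cvgr_gt t cvg_id).
by apply: filterS => t' /ltW.
Qed.

Lemma near_gt0 (t : R) : 0 < t -> \forall t' \near t, 0 < t'.
Proof. by move=> t0; exact: (cvgr_gt t cvg_id). Qed.

Lemma slice_t_differentiable (W : normedModType R) (G : P -> W) s t y :
  differentiable G (s, t, y) -> differentiable (fun t' => G (s, t', y)) t.
Proof.
move=> dG; apply/derivable1_diffP.
rewrite (derivable_affine G (slice_t_line s t y)).
exact: diff_derivable.
Qed.

Lemma slice_s_differentiable (W : normedModType R) (G : P -> W) s t y :
  differentiable G (s, t, y) -> differentiable (fun s' => G (s', t, y)) s.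
Proof.
move=> dG; apply/derivable1_diffP.
rewrite (derivable_affine G (slice_s_line s t y)).
exact: diff_derivable.
Qed.

Section FirstOrder.
Context (HV : pullback_extension 1 s0 Omega0 v V OV).
Let VC := pull_Ck HV.
Let VD := pull_dom HV.
Let VE := pull_eq HV.

Lemma dV s t x : 0 <= s < s0 -> 0 < t -> Omega0 x -> differentiable V (s, t, x).
Proof. by move=> *; apply: (Ck_differentiable VC); exact: VD. Qed.

Lemma ubar_derive_t s t y : 0 <= s < s0 -> 0 < t -> Omega0 (psi s t y) ->
  is_derive t 1 (fun t' => phi_push psi v s t' y)
   ('D_dir_t V (s, t, psi s t y) +
    \sum_k 'D_dir_t Z (s, t, y) 0 k * 'D_(dy k) V (s, t, psi s t y)).
Proof.
move=> sE t0 Oy.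
have dZt : differentiable (fun t' => Z (s, t', y)) t.
  by apply: slice_t_differentiable; exact: dZ (ltW t0).
have near_eq : \forall t' \near t, V (s, t', Z (s, t', y)) = phi_push psi v s t' y.
  have nO : \forall t' \near t, Omega0 (Z (s, t', y)).
    apply: (differentiable_continuous dZt); rewrite -ZE//; last exact: ltW.
    exact: open_nbhs_nbhs.
  near=> t'; rewrite /phi_push.
  have t0' : 0 < t' by near: t'; exact: near_gt0.
  have Oy' : Omega0 (Z (s, t', y)) by near: t'.
  by rewrite (ZE y sE (ltW t0')) (VE sE t0' Oy').
apply: (near_eq_is_derive near_eq).
have dG : differentiable (fun t' : R => (s, t', Z (s, t', y)) : P) t.
  by apply: differentiable_pair => //; exact: differentiable_pair.
have dVp : differentiable V (s, t, Z (s, t, y)).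
  by rewrite -(ZE y sE (ltW t0)); exact: dV sE t0 Oy.
apply: is_derive_eq; first exact: (@chain_derive R _ _ _ (fun t' : R => (s, t', Z (s, t', y)) : P) V t 1 dG dVp).
rewrite derive_pair//; last exact: differentiable_pair.
rewrite derive_pair// derive_dirE// (derive_slice_t Z) (ZE y sE (ltW t0)).
have -> : 'D_1 (fun=> s) t = 0 by exact: derive_cst.
have -> : 'D_1 (fun t => t : R) t = 1 by exact: derive_id.
by rewrite mul0r add0r mul1r.
Unshelve. all: by end_near. Qed.

Lemma ubar_derive_y s t y e : 0 <= s < s0 -> 0 < t -> Omega0 (psi s t y) ->
  is_derive y e (phi_push psi v s t)
   (\sum_k 'D_(dir_y e) Z (s, t, y) 0 k * 'D_(dy k) V (s, t, psi s t y)).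
Proof.
move=> sE t0 Oy; have t0' := ltW t0.
have near_eq : \forall y' \near y,
    ((fun z => V (s, t, z)) \o psi s t) y' = phi_push psi v s t y'.
  have nO : \forall y' \near y, Omega0 (psi s t y').
    by apply: (psi_continuous sE t0'); exact: open_nbhs_nbhs.
  near=> y'; rewrite /phi_push/= VE//; near: y'; exact: nO.
apply: (near_eq_is_derive near_eq).
have dVp : differentiable (fun z => V (s, t, z)) (psi s t y).
  by apply: differentiable_slice_y; exact: dV.
apply: is_derive_eq; first exact: (chain_derive_rV e (psi_differentiable y sE t0') dVp).
apply: eq_bigr => k _.
by rewrite (derive_slice_y V s t _ (ebase R k)) (psi_derive y e sE t0').
Unshelve. all: by end_near. Qed.

End FirstOrder.

Section SecondOrder.
Context (HV : pullback_extension 2 s0 Omega0 v V OV).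
Let VC := pull_Ck HV.
Let VD := pull_dom HV.
Let VE := pull_eq HV.

Lemma ubar_derive_yy s t y e : 0 <= s < s0 -> 0 < t -> Omega0 (psi s t y) ->
  is_derive y e ('D_e (phi_push psi v s t))
   (\sum_k ('D_(dir_y e) ('D_(dir_y e) Z) (s, t, y) 0 k *
              'D_(dy k) V (s, t, psi s t y) +
            'D_(dir_y e) Z (s, t, y) 0 k *
              \sum_l 'D_(dir_y e) Z (s, t, y) 0 l *
                'D_(dy l) ('D_(dy k) V) (s, t, psi s t y))).
Proof.
move=> sE t0 Oy; have t0' := ltW t0.
pose a k y' := 'D_(dir_y e) Z (s, t, y') 0 k.
pose b k y' := 'D_(dy k) V (s, t, psi s t y').
have near_eq : \forall y' \near y,
    (\sum_k a k * b k) y' = 'D_e (phi_push psi v s t) y'.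
  have nO : \forall y' \near y, Omega0 (psi s t y').
    by apply: (psi_continuous sE t0'); exact: open_nbhs_nbhs.
  near=> y'; have Oy' : Omega0 (psi s t y') by near: y'.
  have D := ubar_derive_y (pullback_extensionW (@subset_refl _ _) HV) e sE t0 Oy'.
  by rewrite (derive_val (is_derive := D)) fct_sumE.
apply: (near_eq_is_derive near_eq).
pose c k := \sum_l 'D_(dir_y e) Z (s, t, y) 0 l *
  'D_(dy l) ('D_(dy k) V) (s, t, psi s t y).
have Da k : is_derive y e (a k) ('D_(dir_y e) ('D_(dir_y e) Z) (s, t, y) 0 k).
  have dD : differentiable (fun y' => 'D_(dir_y e) Z (s, t, y')) y.
    apply: (@differentiable_slice_y R n _ ('D_(dir_y e) Z) s t y).
    by apply: (Ck_differentiable (Ck_derive _ ZC)); exact: ZD.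
  rewrite -(derive_slice_y ('D_(dir_y e) Z) s t y e).
  exact: (is_derive_coord e k dD).
have Db k : is_derive y e (b k) (c k).
  have dVp : differentiable (fun z => 'D_(dy k) V (s, t, z)) (psi s t y).
    apply: (@differentiable_slice_y R n _ ('D_(dy k) V) s t (psi s t y)).
    by apply: (Ck_differentiable (Ck_derive _ VC)); exact: VD.
  apply: is_derive_eq.
    exact: (chain_derive_rV e (psi_differentiable y sE t0') dVp).
  apply: eq_bigr => l _.
  by rewrite (derive_slice_y ('D_(dy k) V) s t _ (ebase R l)) (psi_derive y e sE t0').
have Dab k : is_derive y e (a k * b k)
    ('D_(dir_y e) ('D_(dir_y e) Z) (s, t, y) 0 k * b k y + a k y * c k).
  apply: is_derive_eq (@is_deriveM _ _ (a k) (b k) y e _ _ (Da k) (Db k)) _.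
  by rewrite /GRing.scale/= addrC [b k y * _]mulrC.
exact: (is_derive_sum Dab).
Unshelve. all: by end_near. Qed.

End SecondOrder.

End Pullback.

(** * The heat operator at first order in the deformation *)

Section InitialValues.
Context {R : realType} {n : nat}.
Local Notation P := (R * R * 'rV[R]_n)%type.
Local Notation dy := (fun k : 'I_n => @dir_y R n (ebase R k)).
Implicit Types (s t : R) (x y e : 'rV[R]_n) (A : set 'rV[R]_n).

Lemma slice_s_rderiv (W : normedModType R) (a : P -> W) t x :
  differentiable a (0, t, x) ->
  is_rderiv0 (fun s => a (s, t, x)) ('D_dir_s a (0, t, x)).
Proof. by move=> da; exact: is_derive_rderiv0 (is_derive_slice_s da). Qed.

Lemma ebaseE (i k : 'I_n) : ebase R i 0 k = (k == i)%:R.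
Proof. by rewrite mxE eqxx. Qed.

Context (s0 : R) (phi psi : R -> R -> 'rV[R]_n -> 'rV[R]_n).
Context (F Z : P -> 'rV[R]_n) (OF OZ : set P).
Context (H : flow_extension s0 phi psi F Z OF OZ).
Let s00 := flow_s0 H.
Let z0 := range0 H.

Lemma F0 t x : 0 <= t -> F (0, t, x) = x.
Proof. by move=> t0; rewrite -(flow_eqF H x z0 t0) (flow_phi0 H). Qed.

Lemma Z0 t x : 0 <= t -> Z (0, t, x) = x.
Proof. by move=> t0; rewrite -(flow_eqZ H x z0 t0) (psi0 H). Qed.

Lemma derive_t_F0 t x : 0 < t -> 'D_dir_t F (0, t, x) = 0.
Proof.
move=> t0; rewrite -derive_slice_t -(derive_cst x t (1 : R)).
apply: near_eq_derive; near=> t'; rewrite F0//.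
by near: t'; exact: near_ge0.
Unshelve. all: by end_near. Qed.

Lemma derive_t_Z0 t x : 0 < t -> 'D_dir_t Z (0, t, x) = 0.
Proof.
move=> t0; rewrite -derive_slice_t -(derive_cst x t (1 : R)).
apply: near_eq_derive; near=> t'; rewrite Z0//.
by near: t'; exact: near_ge0.
Unshelve. all: by end_near. Qed.

Lemma derive_y_Z0 t x e : 0 <= t -> 'D_(dir_y e) Z (0, t, x) = e.
Proof.
move=> t0; rewrite -(derive_slice_y Z 0 t x e) -[RHS](derive_id x e).
by congr ('D_e _ x); apply/funext => y; exact: Z0.
Qed.

Lemma derive_yy_Z0 t x e e' : 0 <= t ->
  'D_(dir_y e') ('D_(dir_y e) Z) (0, t, x) = 0.
Proof.
move=> t0; rewrite -(derive_slice_y ('D_(dir_y e) Z) 0 t x e').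
rewrite -[RHS](derive_cst e x e').
by congr ('D_e' _ x); apply/funext => y; exact: derive_y_Z0.
Qed.

Lemma flow_curve_cvg t x : 0 <= t ->
  (s, t, phi s t x) @[s --> 0^'+] --> ((0, t, x) : P).
Proof.
move=> t0; have dFx := dF H x z0 t0.
have c : (fun s => (s, t, F (s, t, x)) : P) s @[s --> (0 : R)] --> (0, t, F (0, t, x)).
  apply: differentiable_continuous; apply: differentiable_pair.
    exact: differentiable_pair.
  exact: slice_s_differentiable dFx.
rewrite F0// in c.
have {}c : (s, t, F (s, t, x)) @[s --> 0^'+] --> ((0, t, x) : P).
  exact: cvg_within_filter c.
apply: (cvg_trans _ c); apply: near_eq_cvg.
apply: filterS (near_right_ico s00) => s sE.
by rewrite (flow_eqF H).
Qed.

Lemma flow_cvg (W : normedModType R) (a : P -> W) t x : 0 <= t ->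
  {for (0, t, x), continuous a} ->
  a (s, t, phi s t x) @[s --> 0^'+] --> a (0, t, x).
Proof.
move=> t0 ca.
exact: (@cvg_comp _ _ _ (fun s => (s, t, phi s t x) : P) a _ _ _ (@flow_curve_cvg t x t0) ca).
Qed.

Lemma flow_rderiv (a : P -> R) t x : 0 <= t -> differentiable a (0, t, x) ->
  exists l, is_rderiv0 (fun s => a (s, t, phi s t x)) l.
Proof.
move=> t0 da; have dFx := dF H x z0 t0.
have dc : differentiable (fun s => (s, t, F (s, t, x)) : P) 0.
  apply: differentiable_pair; first exact: differentiable_pair.
  exact: slice_s_differentiable dFx.
have da' : differentiable a (0, t, F (0, t, x)) by rewrite F0.
eexists; apply: (@eq_is_rderiv0 _ _ s0 (a \o (fun s => (s, t, F (s, t, x)) : P))) => //.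
  by move=> s sE; rewrite /= (flow_eqF H).
apply: is_derive_rderiv0.
exact: (@chain_derive R _ _ _ (fun s : R => (s, t, F (s, t, x)) : P) a 0 1 dc da').
Qed.

Lemma nu_phi_rderiv t x : 0 <= t ->
  is_rderiv0 (fun s => phi s t x) ('D_dir_s F (0, t, x)).
Proof.
move=> t0; apply: (@eq_is_rderiv0 _ _ s0 (fun s => F (s, t, x))) => //.
  by move=> s sE; rewrite (flow_eqF H).
by apply: slice_s_rderiv; exact: (dF H x z0 t0).
Qed.

Lemma nu_phiE t x : 0 <= t -> nu_phi phi t x = 'D_dir_s F (0, t, x).
Proof. by move=> t0; exact: rderiv0E (@nu_phi_rderiv t x t0). Qed.

Section PulledBack.
Context (A : set 'rV[R]_n) (v : R -> R -> 'rV[R]_n -> R) (V : P -> R) (OV : set P).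
Context (HV : pullback_extension 1 s0 A v V OV).

Lemma pull_differentiable s t x : 0 <= s < s0 -> 0 < t -> A x ->
  differentiable V (s, t, x).
Proof.
by move=> sE t0 Ax; apply: (Ck_differentiable (pull_Ck HV)); exact: (pull_dom HV).
Qed.

Lemma wbar_rderiv t x : 0 < t -> A x ->
  is_rderiv0 (fun s => v s t x) ('D_dir_s V (0, t, x)).
Proof.
move=> t0 Ax; apply: (@eq_is_rderiv0 _ _ s0 (fun s => V (s, t, x))) => //.
  by move=> s sE; rewrite (pull_eq HV).
by apply: slice_s_rderiv; exact: pull_differentiable.
Qed.

Lemma wbarE t x : 0 < t -> A x -> wbar v t x = 'D_dir_s V (0, t, x).
Proof. by move=> t0 Ax; exact: rderiv0E (wbar_rderiv t0 Ax). Qed.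

Context (oA : open A).

Lemma near_open x : A x -> \forall y \near x, A y.
Proof. by move=> Ax; exact: open_nbhs_nbhs. Qed.

Lemma derive_t_wbar t x : 0 < t -> A x ->
  'D_1 (fun t' => wbar v t' x) t = 'D_dir_t ('D_dir_s V) (0, t, x).
Proof.
move=> t0 Ax; rewrite -derive_slice_t; apply: near_eq_derive.
by near=> t'; apply: wbarE => //; near: t'; exact: near_gt0.
Unshelve. all: by end_near. Qed.

Lemma derive_y_wbar t x e : 0 < t -> A x ->
  'D_e (wbar v t) x = 'D_(dir_y e) ('D_dir_s V) (0, t, x).
Proof.
move=> t0 Ax; rewrite -(derive_slice_y ('D_dir_s V) 0 t x e); apply: near_eq_derive.
by near=> y; apply: wbarE => //; near: y; exact: near_open.
Unshelve. all: by end_near. Qed.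

Lemma derive_yy_wbar t x e e' : 0 < t -> A x -> 'D_e' ('D_e (wbar v t)) x =
  'D_(dir_y e') ('D_(dir_y e) ('D_dir_s V)) (0, t, x).
Proof.
move=> t0 Ax; rewrite -(derive_slice_y ('D_(dir_y e) ('D_dir_s V)) 0 t x e').
apply: near_eq_derive.
by near=> y; apply: derive_y_wbar => //; near: y; exact: near_open.
Unshelve. all: by end_near. Qed.

Context (v0 : forall t x, 0 <= t -> A x -> v 0 t x = 0).

Lemma pull0 t x : 0 < t -> A x -> V (0, t, x) = 0.
Proof. by move=> t0 Ax; rewrite -(pull_eq HV z0 t0 Ax) v0// ltW. Qed.

Lemma derive_y_pull0 t x e : 0 < t -> A x -> 'D_(dir_y e) V (0, t, x) = 0.
Proof.
move=> t0 Ax; rewrite -(derive_slice_y V 0 t x e); apply: etrans (derive_cst (0 : R) x e).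
by apply: near_eq_derive; near=> y; rewrite /= pull0//; near: y; exact: near_open.
Unshelve. all: by end_near. Qed.

Lemma derive_yy_pull0 t x e e' : 0 < t -> A x ->
  'D_(dir_y e') ('D_(dir_y e) V) (0, t, x) = 0.
Proof.
move=> t0 Ax; rewrite -(derive_slice_y ('D_(dir_y e) V) 0 t x e').
apply: etrans (derive_cst (0 : R) x e').
apply: near_eq_derive; near=> y; rewrite /= derive_y_pull0//.
by near: y; exact: near_open.
Unshelve. all: by end_near. Qed.

End PulledBack.

Section Heat.
Context (Omega0 : set 'rV[R]_n) (v : R -> R -> 'rV[R]_n -> R).
Context (V : P -> R) (OV : set P).
Context (oOm : open Omega0).
Context (HV : pullback_extension 3 s0 Omega0 v V OV).
Context (v0 : forall t x, 0 <= t -> Omega0 x -> v 0 t x = 0).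
Let HV2 := pullback_extensionW (@subset_refl _ _) HV.
Let HV1 := pullback_extensionW (@subset_refl _ _) HV2.

Lemma heat_wbar t x : 0 < t -> Omega0 x ->
  'D_1 (fun t' => wbar v t' x) t - laplacian (wbar v t) x =
  'D_dir_s ('D_dir_t V) (0, t, x) -
  \sum_i 'D_dir_s ('D_(dy i) ('D_(dy i) V)) (0, t, x).
Proof.
move=> t0 Ox; have Op := pull_dom HV z0 t0 Ox.
have VC2 : Ck 2 OV V := CkW (pull_Ck HV).
have VC1 (d : P) : Ck 2 OV ('D_d V) := Ck_derive d (pull_Ck HV).
have oV := pull_open HV.
have E1 : 'D_1 (fun t' => wbar v t' x) t = 'D_dir_s ('D_dir_t V) (0, t, x).
  apply: etrans (derive_t_wbar HV1 t0 Ox) _.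
  exact: (derive_comm dir_t dir_s oV VC2 Op).
suff E2 : laplacian (wbar v t) x =
    \sum_i 'D_dir_s ('D_(dy i) ('D_(dy i) V)) (0, t, x).
  exact: (congr2 (fun r1 r2 => r1 - r2) E1 E2).
apply: eq_bigr => i _.
apply: etrans (derive_yy_wbar HV1 oOm (ebase R i) (ebase R i) t0 Ox) _.
apply: esym; apply: etrans (derive_comm dir_s (dy i) oV (VC1 (dy i)) Op) _.
apply: near_eq_derive; near=> p.
have Op' : OV p by near: p; exact: (open_nbhs_nbhs (conj oV Op)).
exact: (derive_comm dir_s (dy i) oV VC2 Op').
Unshelve. all: by end_near. Qed.

Lemma sum_delta (i : 'I_n) (u : 'I_n -> R) (w : 'I_n -> 'I_n -> R) :
  \sum_k (0 * u k + (k == i)%:R * \sum_l (l == i)%:R * w k l) = w i i.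
Proof.
rewrite (bigD1 i)//= eqxx mul0r add0r mul1r.
rewrite [X in _ + X]big1 ?addr0; last first.
  by move=> k /negPf ->; rewrite !mul0r addr0.
rewrite (bigD1 i)//= eqxx mul1r big1 ?addr0// => l /negPf ->.
by rewrite mul0r.
Qed.

Lemma derive_Z0_cvg (d : P) k (l : R) t x : 0 <= t ->
  'D_d Z (0, t, x) 0 k = l ->
  'D_d Z (s, t, phi s t x) 0 k @[s --> 0^'+] --> l.
Proof.
move=> t0 <-.
have cZ : {for (0, t, x), continuous ('D_d Z)}.
  exact: (Ck_continuous (Ck_derive _ (flow_CkZ H)) (flow_domZ H x z0 t0)).
exact: (flow_cvg t0 (continuous_coord_fun (k := k) cZ)).
Qed.

Lemma derive2_Z0_cvg (d d' : P) k (l : R) t x : 0 <= t ->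
  'D_d ('D_d' Z) (0, t, x) 0 k = l ->
  'D_d ('D_d' Z) (s, t, phi s t x) 0 k @[s --> 0^'+] --> l.
Proof.
move=> t0 <-.
have cZ : {for (0, t, x), continuous ('D_d ('D_d' Z))}.
  exact: (@Ck_continuous _ _ _ 0 _ _ _ (Ck_derive _ (Ck_derive _ (flow_CkZ H)))
    (flow_domZ H x z0 t0)).
exact: (flow_cvg t0 (continuous_coord_fun (k := k) cZ)).
Qed.

(** On the curve y = phi(s, t, x) every derivative of the pushed forward function
is a sum of derivatives of V at the fixed point x times derivatives of psi. The
former vanish at s = 0, so of the latter only the values at s = 0 count, where
psi is the identity. *)
Lemma heat_rderiv t x : 0 < t -> Omega0 x ->
  is_rderiv0 (fun s => 'D_1 (fun t' => phi_push psi v s t' (phi s t x)) t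
                       - laplacian (phi_push psi v s t) (phi s t x))
    ('D_1 (fun t' => wbar v t' x) t - laplacian (wbar v t) x).
Proof.
move=> t0 Ox; have t0' := ltW t0; rewrite heat_wbar//.
pose a k s := 'D_dir_t Z (s, t, phi s t x) 0 k.
pose b k s := 'D_(dy k) V (s, t, x).
pose A i k s := 'D_(dy i) ('D_(dy i) Z) (s, t, phi s t x) 0 k.
pose B i k s := 'D_(dy i) Z (s, t, phi s t x) 0 k.
pose c k l s := 'D_(dy l) ('D_(dy k) V) (s, t, x).
apply: (@eq_is_rderiv0 _ _ s0 (fun s => ('D_dir_t V (s, t, x) + \sum_k a k s * b k s)
  - \sum_i \sum_k (A i k s * b k s + B i k s * \sum_l B i l s * c k l s))) => //.
  move=> s sE.
  have Op : Omega0 (psi s t (phi s t x)) by rewrite (flow_phiK H).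
  have D1 := derive_val (is_derive := ubar_derive_t oOm H HV1 sE t0 Op).
  have D2 i := derive_val
    (is_derive := ubar_derive_yy oOm H HV2 (ebase R i) sE t0 Op).
  rewrite (flow_phiK H sE t0') in D1.
  have {}D2 : laplacian (phi_push psi v s t) (phi s t x) = _ := eq_bigr _ (fun i _ => D2 i).
  rewrite (flow_phiK H sE t0') in D2.
  exact: esym (congr2 (fun r1 r2 => r1 - r2) D1 D2).
have Op := pull_dom HV z0 t0 Ox.
have VC1 (d : P) : Ck 2 OV ('D_d V) := Ck_derive d (pull_Ck HV).
have rb k : is_rderiv0 (b k) ('D_dir_s ('D_(dy k) V) (0, t, x)).
  by apply: slice_s_rderiv; exact: (Ck_differentiable (VC1 _) Op).
have rc k l : is_rderiv0 (c k l) ('D_dir_s ('D_(dy l) ('D_(dy k) V)) (0, t, x)).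
  by apply: slice_s_rderiv; exact: (Ck_differentiable (Ck_derive _ (VC1 _)) Op).
have b0 k : b k 0 = 0 by exact: (derive_y_pull0 HV1 oOm v0).
have c0 k l : c k l 0 = 0 by exact: (derive_yy_pull0 HV1 oOm v0).
have ca k : a k s @[s --> 0^'+] --> (0 : R).
  by apply: (derive_Z0_cvg t0'); rewrite derive_t_Z0// mxE.
have cA i k : A i k s @[s --> 0^'+] --> (0 : R).
  by apply: (derive2_Z0_cvg t0'); rewrite derive_yy_Z0// mxE.
have cB i k : B i k s @[s --> 0^'+] --> ((k == i)%:R : R).
  by apply: (derive_Z0_cvg t0'); rewrite derive_y_Z0// ebaseE.
have rV : is_rderiv0 (fun s => 'D_dir_t V (s, t, x)) ('D_dir_s ('D_dir_t V) (0, t, x)).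
  by apply: slice_s_rderiv; exact: (Ck_differentiable (VC1 _) Op).
pose lt := 'D_dir_s ('D_dir_t V) (0, t, x).
have {}rV : is_rderiv0 _ lt := rV.
pose lb k := 'D_dir_s ('D_(dy k) V) (0, t, x).
pose lc k l := 'D_dir_s ('D_(dy l) ('D_(dy k) V)) (0, t, x).
rewrite -/lt; have -> : lt - \sum_i 'D_dir_s ('D_(dy i) ('D_(dy i) V)) (0, t, x) =
    (lt + \sum_k 0 * lb k) -
    \sum_i \sum_k (0 * lb k + (k == i)%:R * \sum_l (l == i)%:R * lc k l).
  rewrite [X in lt + X - _]big1 ?addr0; last by move=> k _; rewrite mul0r.
  by congr (_ - _); apply: eq_bigr => i _; rewrite sum_delta.
have {}rb k : is_rderiv0 (b k) (lb k) := rb k.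
have {}rc k l : is_rderiv0 (c k l) (lc k l) := rc k l.
move: rb rc b0 c0; clearbody lt b c lb lc => rb rc b0 c0.
clearbody a A B.
apply: is_rderiv0B.
  apply: is_rderiv0D => //.
  by apply: is_rderiv0_sum => k; exact: is_rderiv0_mul_vanishing.
apply: is_rderiv0_sum => i; apply: is_rderiv0_sum => k.
apply: is_rderiv0D; first exact: is_rderiv0_mul_vanishing.
apply: is_rderiv0_mul_vanishing => //.
  by apply: big1 => l _; rewrite c0 mulr0.
by apply: is_rderiv0_sum => l; exact: is_rderiv0_mul_vanishing.
Qed.

End Heat.

End InitialValues.

(** * The moving unit normal *)

Section MovingNormal.
Context {R : realType} {n : nat}.
Local Notation P := (R * R * 'rV[R]_n)%type.
Local Notation dy := (fun k : 'I_n => @dir_y R n (ebase R k)).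
Implicit Types (s t : R) (x y e : 'rV[R]_n) (A : set 'rV[R]_n).

Lemma rderiv0_cvg (b : R -> R) l : is_rderiv0 b l -> b h @[h --> 0^'+] --> b 0.
Proof.
move=> bl; have lim1 : h * (h^-1 *: (b h - b 0)) + b 0 @[h --> 0^'+] --> 0 * l + b 0.
  apply: cvgD; last exact: cvg_cst.
  by apply: cvgM; [apply: cvg_within|exact: bl].
rewrite mul0r add0r in lim1; apply: (cvg_trans _ lim1); apply: near_eq_cvg.
near=> h; rewrite /= /GRing.scale/= mulVKf ?subrK//.
Unshelve. all: by end_near. Qed.

(** The normalisation of a curve q moves, to first order, orthogonally to its
initial position nu: with r the part of q orthogonal to nu, the defect
nu . q/|q| - 1 is a multiple of |r|^2. *)
Lemma normalize_rderiv (q : R -> 'rV[R]_n) (l : 'I_n -> R) (nu : 'rV[R]_n) :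
    (forall i, is_rderiv0 (fun s => q s 0 i) (l i)) -> q 0 != 0 ->
    nu = (enorm (q 0))^-1 *: q 0 ->
  is_rderiv0 (fun s => dot ((enorm (q s))^-1 *: q s) nu) 0 /\
  (forall i, ((enorm (q s))^-1 *: q s) 0 i @[s --> 0^'+] --> nu 0 i).
Proof.
move=> ql q0 nuE.
have nn : dot nu nu = 1 by rewrite nuE; exact: normalize_dot.
have e0 : 0 < enorm (q 0) by rewrite enorm_gt0.
have qE : q 0 = enorm (q 0) *: nu by rewrite nuE scalerA mulfV ?scale1r ?gt_eqF.
have cq i := rderiv0_cvg (ql i).
have cqq : dot (q s) (q s) @[s --> 0^'+] --> dot (q 0) (q 0) by exact: cvg_dot.
have ce : enorm (q s) @[s --> 0^'+] --> enorm (q 0).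
  apply: (@cvg_comp _ _ _ (fun s => dot (q s) (q s)) (@Num.sqrt R) _ _ _ cqq).
  exact: sqrt_continuous.
have cn i : ((enorm (q s))^-1 *: q s) 0 i @[s --> 0^'+] --> nu 0 i.
  have lim1 : (enorm (q s))^-1 * q s 0 i @[s --> 0^'+] --> (enorm (q 0))^-1 * q 0 0 i.
    by apply: cvgM => //; apply: cvgV => //; rewrite gt_eqF.
  have -> : (fun s => ((enorm (q s))^-1 *: q s) 0 i) =
      fun s => (enorm (q s))^-1 * q s 0 i.
    by apply/funext => s; rewrite mxE.
  by rewrite nuE mxE.
split => //.
have cqn : dot (q s) nu @[s --> 0^'+] --> dot (q 0) nu.
  by apply: cvg_dot => // i; exact: cvg_cst.
have qn0 : dot (q 0) nu = enorm (q 0) by rewrite {1}qE dotZl nn mulr1.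
pose r i s := q s 0 i - dot (q s) nu * nu 0 i.
pose a s := - ((enorm (q s) * (dot (q s) nu + enorm (q s)))^-1).
have r0 i : r i 0 = 0.
  by rewrite /r qn0 {1}qE mxE subrr.
have rr i : exists k, is_rderiv0 (r i) k.
  eexists; apply: is_rderiv0B; first exact: ql.
  apply: (@eq_is_rderiv0 _ _ 1 (fun s => nu 0 i * \sum_j nu 0 j * q s 0 j)) => //.
    move=> s _; rewrite mulrC; congr (_ * _); apply: eq_bigr => j _.
    by rewrite mulrC.
  by apply: is_rderiv0_mull; apply: is_rderiv0_sum => j; apply: is_rderiv0_mull.
have rrr i : is_rderiv0 (fun s => r i s * r i s) 0.
  have [k rk] := rr i; have cr := rderiv0_cvg rk; rewrite r0 in cr.
  by rewrite -(mul0r k); exact: is_rderiv0_mul_vanishing.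
have ca : a s @[s --> 0^'+] --> a 0.
  apply: cvgN; apply: cvgV.
    by rewrite qn0 mulf_neq0// gt_eqF// addr_gt0.
  by apply: cvgM => //; apply: cvgD.
have sumr : is_rderiv0 (fun s => \sum_i r i s * r i s) (\sum_(i < n) 0).
  exact: is_rderiv0_sum.
have sum0 : \sum_i r i 0 * r i 0 = 0.
  by apply: big1 => i _; rewrite r0 mulr0.
have main := is_rderiv0_mul_vanishing ca sum0 sumr.
have main1 := is_rderiv0D main (is_rderiv0_cst (1 : R)).
rewrite big1// mulr0 addr0 in main1.
apply: near_is_rderiv0 main1.
  by rewrite sum0 mulr0 add0r -nuE nn.
have ep : \forall s \near 0^'+, 0 < enorm (q s) by exact: (cvgr_gt _ ce).
have qp : \forall s \near 0^'+, 0 < dot (q s) nu.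
  by apply: (cvgr_gt _ cqn); rewrite qn0.
near=> s.
have es : 0 < enorm (q s) by near: s; exact: ep.
have qs : 0 < dot (q s) nu by near: s; exact: qp.
(* Here nu . q/|q| - 1 = ((q . nu)^2 - |q|^2) / (|q| (q . nu + |q|)), and the
   numerator is - |r|^2. *)
have -> : \sum_i r i s * r i s = dot (q s) (q s) - dot (q s) nu * dot (q s) nu.
  transitivity (dot (q s - dot (q s) nu *: nu) (q s - dot (q s) nu *: nu)).
    by apply: eq_bigr => i _; rewrite !mxE.
  by rewrite !(dotBl, dotBr, dotZl, dotZr) nn (dotC nu (q s)); ring.
rewrite dotZl -sqr_enorm /a.
move: (enorm (q s)) (dot (q s) nu) es qs => E D E0 D0.
by field; rewrite !gt_eqF// addr_gt0.
Unshelve. all: by end_near. Qed.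

Context (Omega0 : set 'rV[R]_n) (s0 : R).
Context (phi psi : R -> R -> 'rV[R]_n -> 'rV[R]_n).
Context (F Z : P -> 'rV[R]_n) (OF OZ : set P).
Context (H : flow_extension s0 phi psi F Z OF OZ).
Let z0 := range0 H.

Lemma psi_Ck s t : 0 <= s < s0 -> 0 <= t -> Ck 1 setT (psi s t).
Proof.
move=> sE t0; rewrite (psi_slice H sE t0).
apply: (@Ck_subset _ _ _ _ _ [set y | OZ (s, t, y)]).
  by move=> y _; exact: (flow_domZ H y sE t0).
exact: Ck_slice_y (CkW (flow_CkZ H)).
Qed.

Lemma derive_Z_rderiv (d : P) k t x : 0 <= t ->
  exists l, is_rderiv0 (fun s => 'D_d Z (s, t, phi s t x) 0 k) l.
Proof.
move=> t0; apply: (@flow_rderiv _ _ _ _ _ _ _ _ _ H (fun p => 'D_d Z p 0 k)) => //.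
apply: differentiable_coord_fun.
exact: (Ck_differentiable (Ck_derive d (flow_CkZ H)) (flow_domZ H x z0 t0)).
Qed.

Section Normal.
Context (U : set 'rV[R]_n) (rho : 'rV[R]_n -> R) (x : 'rV[R]_n).
Context (oU : open U) (Ux : U x) (rC : Ck 1 U rho).
Context (Uneg : forall z, U z -> Omega0 z <-> rho z < 0) (rx : rho x = 0).
Context (gx : grad rho x != 0).
Let nu0 := (enorm (grad rho x))^-1 *: grad rho x.

(** The gradient at phi(s, t, x) of the pushed forward defining function. *)
Definition transported_gradient t s : 'rV[R]_n :=
  \row_i \sum_k 'D_(dy i) Z (s, t, phi s t x) 0 k * 'D_(ebase R k) rho x.
Local Notation q := transported_gradient.

Lemma transported_gradient0 t : 0 <= t -> q t 0 = grad rho x.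
Proof.
move=> t0; apply/rowP => i; rewrite mxE [RHS]mxE.
have E k : 'D_(dy i) Z (0, t, phi 0 t x) 0 k = (k == i)%:R.
  by rewrite (flow_phi0 H x t0) (derive_y_Z0 H x (ebase R i) t0) ebaseE.
under eq_bigr => k _ do rewrite E.
rewrite (bigD1 i)//= eqxx mul1r big1 ?addr0// => k /negPf ->.
by rewrite mul0r.
Qed.

Lemma unit_normal0 : unit_normal Omega0 x = nu0.
Proof. by apply: unit_normalE; exists U, rho; split. Qed.

Lemma transported_gradient_rderiv t i : 0 <= t ->
  exists l, is_rderiv0 (fun s => q t s 0 i) l.
Proof.
move=> t0; have rl k := derive_Z_rderiv (dy i) k x t0.
pose l k := xget 0 [set l | is_rderiv0 (fun s => 'D_(dy i) Z (s, t, phi s t x) 0 k) l].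
have {}rl k : is_rderiv0 (fun s => 'D_(dy i) Z (s, t, phi s t x) 0 k) (l k).
  by rewrite /l; case: xgetP => [l' _//|nol]; have [l' /nol] := rl k.
exists (\sum_k 'D_(ebase R k) rho x * l k).
apply: (@eq_is_rderiv0 _ _ 1 (fun s => \sum_k 'D_(ebase R k) rho x *
  'D_(dy i) Z (s, t, phi s t x) 0 k)) => //.
  by move=> s _; rewrite mxE; apply: eq_bigr => k _; rewrite mulrC.
by apply: is_rderiv0_sum => k; exact: is_rderiv0_mull.
Qed.

(** Only for small s: then the transported gradient is close to that of rho and
hence nonzero. *)
Lemma unit_normal_flow t : 0 <= t -> \forall s \near 0^'+,
  unit_normal (phi s t @` Omega0) (phi s t x) = (enorm (q t s))^-1 *: q t s.
Proof.
move=> t0.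
have cq i : q t s 0 i @[s --> 0^'+] --> q t 0 0 i.
  by have [l ql] := transported_gradient_rderiv i t0; exact: rderiv0_cvg ql.
have cqq : dot (q t s) (q t s) @[s --> 0^'+] --> dot (q t 0) (q t 0).
  exact: cvg_dot.
have qp : \forall s \near 0^'+, 0 < dot (q t s) (q t s).
  by apply: (cvgr_gt _ cqq); rewrite transported_gradient0// dot_gt0.
near=> s.
have sE : 0 <= s < s0 by near: s; exact: (near_right_ico (flow_s0 H)).
have qs : q t s != 0 by rewrite -dot_gt0; near: s; exact: qp.
have qE : q t s = \row_i \sum_k 'D_(ebase R i) (psi s t) (phi s t x) 0 k *
    'D_(ebase R k) rho x.
  by apply/rowP => i; rewrite !mxE; apply: eq_bigr => k _; rewrite (psi_derive H).
apply: unit_normalE; rewrite qE in qs *.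
exact: (outward_unit_normal_image (flow_phiK H sE t0) (flow_psiK H sE t0)
  (psi_Ck sE t0) oU Ux rC Uneg rx qs).
Unshelve. all: by end_near. Qed.

Lemma unit_normal_flow_rderiv t : 0 <= t ->
  is_rderiv0 (fun s => dot (unit_normal (phi s t @` Omega0) (phi s t x)) nu0) 0 /\
  (forall i, (unit_normal (phi s t @` Omega0) (phi s t x)) 0 i @[s --> 0^'+]
     --> nu0 0 i).
Proof.
move=> t0.
pose l i := xget 0 [set l | is_rderiv0 (fun s => q t s 0 i) l].
have ql i : is_rderiv0 (fun s => q t s 0 i) (l i).
  rewrite /l; case: xgetP => [l' _//|nol].
  by have [l' /nol] := transported_gradient_rderiv i t0.
have q0 := transported_gradient0 t0.
have [|||n1 n2] := @normalize_rderiv (q t) l nu0; first exact: ql.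
- by rewrite q0.
- by rewrite q0.
split => [|i].
  apply: near_is_rderiv0 n1.
    have im : phi 0 t @` Omega0 = Omega0.
      apply/seteqP; split => [_ [y Oy <-]|y Oy]; first by rewrite (flow_phi0 H).
      by exists y => //; rewrite (flow_phi0 H).
    by rewrite q0 im (flow_phi0 H)// unit_normal0.
  by apply: filterS (unit_normal_flow t0) => s ->.
apply: (cvg_trans _ (n2 i)); apply: near_eq_cvg.
by apply: filterS (unit_normal_flow t0) => s ->.
Qed.

End Normal.
End MovingNormal.

(** * The normal velocity condition at first order *)

Section IteratedDerivative.
Context {R : realType} {n : nat}.
Implicit Types (x y e : 'rV[R]_n).

Lemma dderE (Omega : set 'rV[R]_n) (X : 'rV[R]_n -> 'rV[R]_n) f x :
  dder Omega X f x = \sum_i X x 0 i * bext Omega ('D_(ebase R i) f) x.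
Proof. by apply: eq_bigr => i _; rewrite mxE. Qed.

Context (Omega : set 'rV[R]_n) (oOm : open Omega).
Context (u : 'rV[R]_n -> R) (uC : Ck 2 Omega u).
Context (X : 'rV[R]_n -> 'rV[R]_n) (XC : Ck 1 setT X).

Lemma dder_inside y : Omega y ->
  dder Omega X u y = \sum_k X y 0 k * 'D_(ebase R k) u y.
Proof.
move=> Oy; rewrite dderE; apply: eq_bigr => k _; congr (_ * _).
apply: bext_continuous; first exact: subset_closure.
exact: (Ck_continuous (Ck_derive _ uC) Oy).
Qed.

Lemma derive_dder_inside y e : Omega y -> 'D_e (dder Omega X u) y =
  \sum_k ('D_e X y 0 k * 'D_(ebase R k) u y +
          X y 0 k * 'D_e ('D_(ebase R k) u) y).
Proof.
move=> Oy.
pose a k := fun z => X z 0 k; pose b k := 'D_(ebase R k) u.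
have Dab k : is_derive y e (a k * b k) ('D_e X y 0 k * b k y + a k y * 'D_e (b k) y).
  have Da : is_derive y e (a k) ('D_e X y 0 k).
    by apply: is_derive_coord; exact: (Ck_differentiable XC).
  have Db : is_derive y e (b k) ('D_e (b k) y).
    apply: differentiable_is_derive.
    exact: (Ck_differentiable (Ck_derive _ uC) Oy).
  apply: is_derive_eq (@is_deriveM _ _ (a k) (b k) y e _ _ Da Db) _.
  by rewrite /GRing.scale/= addrC [b k y * _]mulrC.
have D := derive_val (is_derive := is_derive_sum Dab).
apply: etrans D; apply: near_eq_derive; near=> z.
have Oz : Omega z by near: z; exact: open_nbhs_nbhs.
by rewrite dder_inside// fct_sumE.
Unshelve. all: by end_near. Qed.

(** The boundary value of the iterated derivative: the inner field is
differentiated as well. *)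
Lemma dder_dder (nu : 'rV[R]_n -> 'rV[R]_n) x : closure Omega x ->
  (forall k, cvg ('D_(ebase R k) u @ within Omega (nbhs x))) ->
  (forall i k, cvg ('D_(ebase R i) ('D_(ebase R k) u) @ within Omega (nbhs x))) ->
  dder Omega nu (dder Omega X u) x =
  dot ('D_(nu x) X x) (bgrad Omega u x) +
  \sum_i nu x 0 i * \sum_k X x 0 k *
     bext Omega ('D_(ebase R k) ('D_(ebase R i) u)) x.
Proof.
move=> cx cu1 cu2.
have FF : ProperFilter (within Omega (nbhs x)) by exact: within_nbhs_proper.
have dX : differentiable X x by exact: (Ck_differentiable XC).
have E i : bext Omega ('D_(ebase R i) (dder Omega X u)) x =
   \sum_k ('D_(ebase R i) X x 0 k * bext Omega ('D_(ebase R k) u) x +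
    X x 0 k * bext Omega ('D_(ebase R k) ('D_(ebase R i) u)) x).
  apply: bextE => //.
  apply: (@cvg_within_eq _ _ _ (fun y => \sum_k ('D_(ebase R i) X y 0 k * 'D_(ebase R k) u y +
          X y 0 k * 'D_(ebase R i) ('D_(ebase R k) u) y))).
    by move=> y /set_mem Oy; rewrite (derive_dder_inside (ebase R i) Oy).
  apply: cvg_rsum => k; apply: cvgD; apply: cvgM.
  - apply: (@cvg_within_continuous _ _ _ (fun y => 'D_(ebase R i) X y 0 k)).
    apply: continuous_coord_fun.
    exact: (@Ck_continuous _ _ _ 0 setT _ _ (Ck_derive _ XC)).
  - exact: cvg_bext.
  - apply: (@cvg_within_continuous _ _ _ (fun y => X y 0 k)).
    by apply: continuous_coord_fun; exact: (Ck_continuous XC).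
  - have -> : bext Omega ('D_(ebase R k) ('D_(ebase R i) u)) x =
        bext Omega ('D_(ebase R i) ('D_(ebase R k) u)) x.
      by apply: eq_bext => y /set_mem Oy; exact: (derive_comm _ _ oOm uC Oy).
    exact: cvg_bext.
rewrite dderE; under eq_bigr => i _ do rewrite E big_split mulrDr.
rewrite big_split; congr (_ + _).
have -> : dot ('D_(nu x) X x) (bgrad Omega u x) =
    \sum_k (\sum_i nu x 0 i * 'D_(ebase R i) X x 0 k) * bext Omega ('D_(ebase R k) u) x.
  apply: eq_bigr => k _; rewrite mxE; congr (_ * _).
  have dXk : differentiable (fun y => X y 0 k) x by exact: differentiable_coord_fun.
  have Dk e := derive_val (is_derive := is_derive_coord e k dX).
  apply: etrans (esym (Dk (nu x))) _; rewrite derive_rV//.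
  by apply: eq_bigr => i _; rewrite Dk.
under [RHS]eq_bigr => k _ do rewrite mulr_suml.
rewrite exchange_big; apply: eq_bigr => i _; rewrite mulr_sumr.
by apply: eq_bigr => k _; rewrite mulrA.
Qed.

End IteratedDerivative.

Section Velocity.
Context {R : realType} {n : nat}.
Local Notation P := (R * R * 'rV[R]_n)%type.
Local Notation dy := (fun k : 'I_n => @dir_y R n (ebase R k)).
Implicit Types (s t : R) (x y e : 'rV[R]_n) (A : set 'rV[R]_n).

Context (Omega0 : set 'rV[R]_n) (s0 : R).
Context (phi psi : R -> R -> 'rV[R]_n -> 'rV[R]_n).
Context (F Z : P -> 'rV[R]_n) (OF OZ : set P).
Context (oOm : open Omega0).
Context (H : flow_extension s0 phi psi F Z OF OZ).
Let s00 := flow_s0 H.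
Let z0 := range0 H.

Lemma derive_t_phi s t x : 0 <= s < s0 -> 0 < t ->
  'D_1 (fun t' => phi s t' x) t = 'D_dir_t F (s, t, x).
Proof.
move=> sE t0; rewrite -derive_slice_t; apply: near_eq_derive; near=> t'.
by rewrite (flow_eqF H)//; near: t'; exact: near_ge0.
Unshelve. all: by end_near. Qed.

Lemma derive_t_nu_phi t x : 0 < t ->
  'D_1 (fun t' => nu_phi phi t' x) t = 'D_dir_t ('D_dir_s F) (0, t, x).
Proof.
move=> t0; rewrite -derive_slice_t; apply: near_eq_derive; near=> t'.
by rewrite (nu_phiE H)//; near: t'; exact: near_ge0.
Unshelve. all: by end_near. Qed.

Lemma nu_phi_Ck t : 0 <= t -> Ck 1 setT (nu_phi phi t).
Proof.
move=> t0; have -> : nu_phi phi t = fun y => 'D_dir_s F (0, t, y).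
  by apply/funext => y; exact: (nu_phiE H).
apply: (@Ck_subset _ _ _ _ _ [set y | OF (0, t, y)]).
  by move=> y _; exact: (flow_domF H y z0 t0).
exact: Ck_slice_y (Ck_derive _ (flow_CkF H)).
Qed.

Lemma derive_st_F_coord t x i : 0 < t ->
  'D_dir_s ('D_dir_t F) (0, t, x) 0 i = 'D_dir_t ('D_dir_s F) (0, t, x) 0 i.
Proof.
move=> t0; have Op := flow_domF H x z0 (ltW t0).
have oF := flow_openF H; have FC := flow_CkF H.
pose f p := F p 0 i.
have fC : Ck 2 OF f by exact: Ck_coord.
have D (d d' : P) : 'D_d ('D_d' F) (0, t, x) 0 i = 'D_d ('D_d' f) (0, t, x).
  have dD : differentiable ('D_d' F) (0, t, x).
    exact: (Ck_differentiable (Ck_derive _ FC) Op).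
  apply: etrans (esym (derive_val (is_derive := is_derive_coord d i dD))) _.
  apply: near_eq_derive; near=> p.
  have OFp : OF p by near: p; exact: (open_nbhs_nbhs (conj oF Op)).
  have dFp : differentiable F p by exact: (Ck_differentiable FC OFp).
  exact: esym (derive_val (is_derive := is_derive_coord d' i dFp)).
apply: etrans (D _ _) _; apply: etrans _ (esym (D _ _)).
exact: (derive_comm dir_s dir_t oF fC Op).
Unshelve. all: by end_near. Qed.

(** The velocity d/dt phi vanishes at s = 0, so the normal N enters with its value
at s = 0 only. *)
Lemma velocity_lhs_rderiv (N : R -> 'rV[R]_n) (nu : 'rV[R]_n) t x : 0 < t ->
  (forall i, N s 0 i @[s --> 0^'+] --> nu 0 i) ->
  is_rderiv0 (fun s => dot ('D_1 (fun t' => phi s t' x) t) (N s))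
    (dot nu ('D_1 (fun t' => nu_phi phi t' x) t)).
Proof.
move=> t0 Nnu; rewrite derive_t_nu_phi//.
have Op := flow_domF H x z0 (ltW t0); have FC := flow_CkF H.
apply: (@eq_is_rderiv0 _ _ s0 (fun s => \sum_i N s 0 i * 'D_dir_t F (s, t, x) 0 i)) => //.
  by move=> s sE; rewrite derive_t_phi// dotC.
apply: is_rderiv0_sum => i; apply: is_rderiv0_mul_vanishing => //.
  by rewrite (derive_t_F0 H)// mxE.
rewrite -(derive_st_F_coord x i t0).
have dD : differentiable ('D_dir_t F) (0, t, x).
  exact: (Ck_differentiable (Ck_derive _ FC) Op).
have r := slice_s_rderiv (differentiable_coord_fun i dD).
by rewrite (derive_val (is_derive := is_derive_coord dir_s i dD)) in r.
Qed.

Section RightHandSide.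
Context (v : R -> R -> 'rV[R]_n -> R) (V : P -> R) (OV : set P).
Context (HV : pullback_extension 2 s0 (closure Omega0) v V OV).
Context (v0 : forall t x, 0 <= t -> closure Omega0 x -> v 0 t x = 0).
Let HVo := pullback_extensionW (@subset_closure _ Omega0) HV.

Lemma derive_y_pull0_closure t x e : 0 < t -> closure Omega0 x ->
  'D_(dir_y e) V (0, t, x) = 0.
Proof.
move=> t0 cx; have VC := pull_Ck HV.
have FF : ProperFilter (within Omega0 (nbhs x)) by exact: within_nbhs_proper.
have c1 : (fun y => 'D_(dir_y e) V (0, t, y)) @ within Omega0 (nbhs x) -->
    'D_(dir_y e) V (0, t, x).
  apply: (@cvg_within_continuous _ _ Omega0 (fun y => 'D_(dir_y e) V (0, t, y)) x).
  apply: (@continuous_comp _ _ _ (fun y => (0, t, y) : P) ('D_(dir_y e) V)).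
    exact: continuous_slice_y.
  exact: (Ck_continuous (Ck_derive _ VC) (pull_dom HV z0 t0 cx)).
apply: (cvg_unique _ c1) => //.
apply: (@cvg_within_eq _ _ _ (fun=> 0)); last exact: cvg_cst.
move=> y /set_mem Oy; apply/esym; apply: (derive_y_pull0 H HVo oOm _ e t0 Oy).
by move=> t' y' t'0 /subset_closure; exact: v0.
Qed.

Lemma closure_flow s t x : 0 <= s < s0 -> 0 <= t -> closure Omega0 x ->
  closure (phi s t @` Omega0) (phi s t x).
Proof.
move=> sE t0; apply: closure_image; first exact: (phi_continuous H).
by move=> y Oy; exists y.
Qed.

Lemma ubar_cvg s t x i : 0 <= s < s0 -> 0 < t -> closure Omega0 x ->
  'D_(ebase R i) (phi_push psi v s t) @ within (phi s t @` Omega0) (nbhs (phi s t x)) -->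
  \sum_k 'D_(dy i) Z (s, t, phi s t x) 0 k * 'D_(dy k) V (s, t, x).
Proof.
move=> sE t0 cx; have t0' := ltW t0; have VC := pull_Ck HV.
have psix : psi s t (phi s t x) = x by rewrite (flow_phiK H).
apply: (@cvg_within_eq _ _ _ (fun y => \sum_k 'D_(dy i) Z (s, t, y) 0 k *
   'D_(dy k) V (s, t, psi s t y))).
  move=> y /set_mem /(psi_image Omega0 H y sE t0') Oy; apply: esym.
  exact: (derive_val (is_derive := ubar_derive_y oOm H HVo (ebase R i) sE t0 Oy)).
apply: cvg_rsum => k; apply: cvgM.
  apply: (@cvg_within_continuous _ _ _ (fun y => 'D_(dy i) Z (s, t, y) 0 k)).
  apply: continuous_coord_fun.
  apply: (@continuous_comp _ _ _ (fun y => (s, t, y) : P) ('D_(dy i) Z)).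
    exact: continuous_slice_y.
  exact: (Ck_continuous (Ck_derive _ (flow_CkZ H)) (flow_domZ H _ sE t0')).
have := @cvg_within_continuous _ _ (phi s t @` Omega0)
  (fun y => 'D_(dy k) V (s, t, psi s t y)) (phi s t x).
rewrite /= psix; apply.
apply: (@continuous_comp _ _ _ (psi s t) (fun y => 'D_(dy k) V (s, t, y))).
  exact: (psi_continuous H).
rewrite psix; apply: (@continuous_comp _ _ _ (fun y => (s, t, y) : P) ('D_(dy k) V)).
  exact: continuous_slice_y.
exact: (Ck_continuous (Ck_derive _ VC) (pull_dom HV sE t0 cx)).
Qed.

Lemma wbar_bext t x i : 0 < t -> closure Omega0 x ->
  bext Omega0 ('D_(ebase R i) (wbar v t)) x = 'D_dir_s ('D_(dy i) V) (0, t, x).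
Proof.
move=> t0 cx; have VC := pull_Ck HV; have Op := pull_dom HV z0 t0 cx.
apply: etrans _ (derive_comm (dy i) dir_s (pull_open HV) VC Op).
apply: bextE => //.
apply: (@cvg_within_eq _ _ _ (fun y => 'D_(dy i) ('D_dir_s V) (0, t, y))).
  move=> y /set_mem Oy; apply: esym.
  exact: (derive_y_wbar H HVo oOm (ebase R i) t0 Oy).
apply: (@cvg_within_continuous _ _ Omega0 (fun y => 'D_(dy i) ('D_dir_s V) (0, t, y)) x).
apply: (@continuous_comp _ _ _ (fun y => (0, t, y) : P) ('D_(dy i) ('D_dir_s V))).
  exact: continuous_slice_y.
exact: (@Ck_continuous _ _ _ 0 _ _ _ (Ck_derive _ (Ck_derive _ VC)) Op).
Qed.

(** The gradient of the pulled back function vanishes at s = 0 up to the boundary;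
hence neither the motion of the normal nor that of the point contributes. *)
Lemma dder_ubar_rderiv (N : R -> 'rV[R]_n -> 'rV[R]_n) (nu : 'rV[R]_n -> 'rV[R]_n) t x :
  0 < t -> closure Omega0 x ->
  (forall i, N s (phi s t x) 0 i @[s --> 0^'+] --> nu x 0 i) ->
  is_rderiv0 (fun s => dder (phi s t @` Omega0) (N s) (phi_push psi v s t) (phi s t x))
    (dder Omega0 nu (wbar v t) x).
Proof.
move=> t0 cx Nnu; have t0' := ltW t0; have VC := pull_Ck HV.
pose B i k s := 'D_(dy i) Z (s, t, phi s t x) 0 k.
pose b k s := 'D_(dy k) V (s, t, x).
apply: (@eq_is_rderiv0 _ _ s0 (fun s => \sum_i N s (phi s t x) 0 i *
   \sum_k B i k s * b k s)) => //.
  move=> s sE; rewrite dderE; apply: eq_bigr => i _; congr (_ * _).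
  apply: esym; apply: bextE; first exact: closure_flow.
  exact: ubar_cvg.
have Op := pull_dom HV z0 t0 cx.
pose lb k := 'D_dir_s ('D_(dy k) V) (0, t, x).
have rb k : is_rderiv0 (b k) (lb k).
  by apply: slice_s_rderiv; exact: (Ck_differentiable (Ck_derive _ VC) Op).
have b0 k : b k 0 = 0 by exact: derive_y_pull0_closure.
have cB i k : B i k s @[s --> 0^'+] --> ((k == i)%:R : R).
  by apply: (derive_Z0_cvg H t0'); rewrite (derive_y_Z0 H)// ebaseE.
have -> : dder Omega0 nu (wbar v t) x = \sum_i nu x 0 i * \sum_k (k == i)%:R * lb k.
  rewrite dderE; apply: eq_bigr => i _; congr (_ * _).
  rewrite (bigD1 i)//= eqxx mul1r big1 ?addr0; first exact: wbar_bext.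
  by move=> k /negPf ->; rewrite mul0r.
clearbody B b lb.
apply: is_rderiv0_sum => i; apply: is_rderiv0_mul_vanishing => //.
  by apply: big1 => k _; rewrite b0 mulr0.
by apply: is_rderiv0_sum => k; exact: is_rderiv0_mul_vanishing.
Qed.

End RightHandSide.

Section Gradient.
Context (u : 'rV[R]_n -> R) (uC : Ck 2 Omega0 u).
Context (stab : forall s t y, 0 <= s < s0 -> 0 <= t -> Omega0 y -> Omega0 (phi s t y)).

Lemma bext_flow_rderiv g t x : Ck 1 Omega0 g -> 0 <= t -> closure Omega0 x ->
  (forall y, closure Omega0 y -> cvg (g @ within Omega0 (nbhs y))) ->
  (forall k, cvg ('D_(ebase R k) g @ within Omega0 (nbhs x))) ->
  is_rderiv0 (fun s => bext Omega0 g (phi s t x))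
    (\sum_k nu_phi phi t x 0 k * bext Omega0 ('D_(ebase R k) g) x).
Proof.
move=> gC t0 cx cg cDg.
apply: (@eq_is_rderiv0 _ _ s0 (fun s => bext Omega0 g (F (s, t, x)))) => //.
  by move=> s sE; rewrite (flow_eqF H).
rewrite (nu_phiE H)//.
apply: (@is_rderiv0_bext _ _ Omega0 g F OF s0 t x
  (fun k => bext Omega0 ('D_(ebase R k) g) x)) => //.
- exact: CkW (flow_CkF H).
- by move=> s y sE; exact: (flow_domF H).
- by move=> y; exact: (F0 H).
- by move=> s y sE Oy; rewrite -(flow_eqF H)//; exact: stab.
- by move=> y Oy; exact: (Ck_differentiable gC).
Qed.

(** With G the gradient of u at phi(s, t, x), write N . G as
N . (G - c nu) + c N . nu: the first term has a factor vanishing at s = 0, the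
second one is stationary. *)
Lemma dder_u0_rderiv (N : R -> 'rV[R]_n -> 'rV[R]_n) (nu : 'rV[R]_n) (c : R) t x :
  0 <= t -> closure Omega0 x ->
  (forall k y, closure Omega0 y -> cvg ('D_(ebase R k) u @ within Omega0 (nbhs y))) ->
  (forall i k, cvg ('D_(ebase R i) ('D_(ebase R k) u) @ within Omega0 (nbhs x))) ->
  bgrad Omega0 u x = c *: nu ->
  (forall i, N s (phi s t x) 0 i @[s --> 0^'+] --> nu 0 i) ->
  is_rderiv0 (fun s => dot (N s (phi s t x)) nu) 0 ->
  is_rderiv0 (fun s => dder Omega0 (N s) u (phi s t x))
    (\sum_i nu 0 i * \sum_k nu_phi phi t x 0 k *
       bext Omega0 ('D_(ebase R k) ('D_(ebase R i) u)) x).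
Proof.
move=> t0 cx cu1 cu2 guc Nnu Nn.
pose G i s := bext Omega0 ('D_(ebase R i) u) (phi s t x).
pose l i := \sum_k nu_phi phi t x 0 k * bext Omega0 ('D_(ebase R k) ('D_(ebase R i) u)) x.
have rG i : is_rderiv0 (fun s => G i s - c * nu 0 i) (l i).
  rewrite -[l i]subr0; apply: is_rderiv0B; last exact: is_rderiv0_cst.
  apply: bext_flow_rderiv => //; first exact: Ck_derive.
  by move=> y; exact: cu1.
have G0 i : G i 0 - c * nu 0 i = 0.
  move/rowP/(_ i): guc; rewrite !mxE => <-.
  by rewrite /G (flow_phi0 H)// subrr.
apply: (@eq_is_rderiv0 _ _ s0 (fun s => \sum_i N s (phi s t x) 0 i * (G i s - c * nu 0 i)
   + c * dot (N s (phi s t x)) nu)) => //.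
  move=> s sE; rewrite dderE /dot mulr_sumr -big_split; apply: eq_bigr => i _ /=.
  rewrite -/(G i s); ring.
rewrite -[X in is_rderiv0 _ X]addr0 -[X in _ + X](mulr0 c).
apply: is_rderiv0D; last exact: is_rderiv0_mull.
by apply: is_rderiv0_sum => i; exact: is_rderiv0_mul_vanishing.
Qed.

End Gradient.
End Velocity.

(** * The linearized system *)

Section Existence.
Context {R : realType} {n : nat}.
Local Notation P := (R * R * 'rV[R]_n)%type.

Lemma flow_extension_exists (s0 : R) (phi psi : R -> R -> 'rV[R]_n -> 'rV[R]_n) :
  0 < s0 -> diffeo_family s0 phi psi ->
  exists (F Z : P -> 'rV[R]_n) (OF OZ : set P), flow_extension s0 phi psi F Z OF OZ.
Proof.
move=> s00 [can [OF [F [oF DF FC FE]]] [OZ [Z [oZ DZ ZC ZE]]] phi0].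
have D s t (x : 'rV[R]_n) : 0 <= s < s0 -> 0 <= t ->
    [set p : R * R * 'rV[R]_n | 0 <= p.1.1 < s0 /\ 0 <= p.1.2] (s, t, x) by [].
exists F, Z, OF, OZ; split => //.
- by move=> s t sE t0; have [] := can s t sE t0.
- by move=> s t sE t0; have [] := can s t sE t0.
- by move=> s t x sE t0; apply: DF; exact: D.
- by move=> s t x sE t0; apply: (FE (s, t, x)); apply/mem_set; exact: D.
- by move=> s t x sE t0; apply: DZ; exact: D.
- by move=> s t x sE t0; apply: (ZE (s, t, x)); apply/mem_set; exact: D.
Qed.

Lemma pullback_extension_exists (s0 : R) k (A : set 'rV[R]_n) v :
  Ck_upto k [set p : R * R * 'rV[R]_n |
        [/\ 0 <= p.1.1 < s0, 0 < p.1.2 & A p.2]]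
        (fun p => v p.1.1 p.1.2 p.2 : R) ->
  exists (V : P -> R) (OV : set P), pullback_extension k s0 A v V OV.
Proof.
move=> [OV [V [oV DV VC VE]]]; exists V, OV; split => //.
- by move=> s t x sE t0 Ax; apply: DV; split.
- by move=> s t x sE t0 Ax; apply: (VE (s, t, x)); apply/mem_set; split.
Qed.

Lemma agree_iff (W : normedModType R) (f g : R -> W) a b :
  is_rderiv0 f a -> is_rderiv0 g b -> derivatives_agree f g <-> a = b.
Proof.
move=> fa gb; split => [[l fl gl]|ab]; last by exists a => //; rewrite ab.
by rewrite (is_rderiv0_unique fa fl) (is_rderiv0_unique gb gl).
Qed.

Lemma solves_agree (s0 : R) (W : normedModType R) (f g : R -> W) a : 0 < s0 ->
  is_rderiv0 f a -> solves s0 f g -> derivatives_agree f g.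
Proof. by move=> s00 fa fg; exists a => //; exact: (eq_is_rderiv0 s00 fg fa). Qed.

End Existence.

Section Linearization.
Context {R : realType} {n : nat}.
Local Notation P := (R * R * 'rV[R]_n)%type.
Local Notation dy := (fun k : 'I_n => @dir_y R n (ebase R k)).
Implicit Types (s t : R) (x y e : 'rV[R]_n).

Context (Omega0 Gamma0 : set 'rV[R]_n) (u0 : 'rV[R]_n -> R) (s0 : R).
Context (phi psi : R -> R -> 'rV[R]_n -> 'rV[R]_n) (v : R -> R -> 'rV[R]_n -> R).
Context (F Z : P -> 'rV[R]_n) (OF OZ : set P).
Context (V3 V2 : P -> R) (OV3 OV2 : set P).
Context (oOm : open Omega0).
Context (Gcl : forall x, Gamma0 x -> closure Omega0 x).
Context (H : flow_extension s0 phi psi F Z OF OZ).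
Context (stab : forall s t y, 0 <= s < s0 -> 0 <= t -> Omega0 y -> Omega0 (phi s t y)).
Context (HV3 : pullback_extension 3 s0 Omega0 v V3 OV3).
Context (HV2 : pullback_extension 2 s0 (closure Omega0) v V2 OV2).
Context (v0 : forall t x, 0 <= t -> closure Omega0 x -> v 0 t x = 0).
Context (vt0 : forall x, Omega0 x -> exists l : R, is_rderiv0 (fun s => v s 0 x) l).
Context (uC : Ck 2 Omega0 u0).
Context (cu0 : forall y, closure Omega0 y -> cvg (u0 @ within Omega0 (nbhs y))).
Context (cu1 : forall k y, closure Omega0 y ->
  cvg ('D_(ebase R k) u0 @ within Omega0 (nbhs y))).
Context (cu2 : forall i k y, closure Omega0 y ->
  cvg ('D_(ebase R i) ('D_(ebase R k) u0) @ within Omega0 (nbhs y))).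

Let s00 := flow_s0 H.
Let z0 := range0 H.
Let nu0 := unit_normal Omega0.
Let HV1 := pullback_extensionW (@subset_refl _ _) HV2.

Let v0o t x : 0 <= t -> Omega0 x -> v 0 t x = 0.
Proof. by move=> t0 Ox; apply: v0 => //; exact: subset_closure. Qed.

Lemma image0 t : 0 <= t -> phi 0 t @` Omega0 = Omega0.
Proof.
move=> t0; apply/seteqP; split => [_ [y Oy <-]|y Oy]; first by rewrite (flow_phi0 H).
by exists y => //; rewrite (flow_phi0 H).
Qed.

Lemma wbar_boundary_rderiv t x : 0 < t -> closure Omega0 x ->
  is_rderiv0 (fun s => v s t x) (wbar v t x).
Proof.
move=> t0 cx; rewrite (wbarE H HV1 t0 cx); exact: (wbar_rderiv H HV1 t0 cx).
Qed.

Lemma dirichlet_rderiv t x : 0 < t -> closure Omega0 x ->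
  is_rderiv0 (fun s => - bext Omega0 u0 (phi s t x))
    (- dder Omega0 (nu_phi phi t) u0 x).
Proof.
move=> t0 cx; apply: is_rderiv0N; rewrite dderE.
apply: (bext_flow_rderiv H stab (CkW uC) (ltW t0) cx cu0) => k.
exact: cu1.
Qed.

Lemma initial_rderiv x : Omega0 x -> is_rderiv0 (fun s => v s 0 x) (wbar v 0 x).
Proof. by move=> Ox; have [l vl] := vt0 Ox; rewrite /wbar (rderiv0E vl). Qed.

Lemma start_rderiv x : is_rderiv0 (fun s => phi s 0 x) (nu_phi phi 0 x).
Proof.
by rewrite (nu_phiE H x (lexx (0 : R))); apply: (nu_phi_rderiv H); exact: lexx.
Qed.

Section AtBoundaryPoint.
Context (x : 'rV[R]_n) (Gx : Gamma0 x).
Context (U : set 'rV[R]_n) (rho : 'rV[R]_n -> R).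
Context (oU : open U) (Ux : U x) (rC : Ck 1 U rho).
Context (Uneg : forall z, U z -> Omega0 z <-> rho z < 0).
Context (UG : forall z, U z -> Gamma0 z <-> rho z = 0).
Context (gx : grad rho x != 0).

Let rx : rho x = 0. Proof. by apply/(UG Ux). Qed.
Let nuE := unit_normal0 oU Ux rC Uneg rx gx.
Let cx := Gcl Gx.

Lemma normal_velocity_rderiv t : 0 < t ->
  is_rderiv0 (fun s => dot ('D_1 (fun t' => phi s t' x) t)
      (unit_normal (phi s t @` Omega0) (phi s t x)))
    (dot (nu0 x) ('D_1 (fun t' => nu_phi phi t' x) t)).
Proof.
move=> t0; have [_ cn] := unit_normal_flow_rderiv H oU Ux rC Uneg rx gx (ltW t0).
apply: (velocity_lhs_rderiv H (N := fun s => unit_normal (phi s t @` Omega0) (phi s t x))) => //.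
by move=> i; rewrite /nu0 nuE.
Qed.

Context (ub0 : forall y, Gamma0 y -> bext Omega0 u0 y = 0).

Lemma gradient_u0 : bgrad Omega0 u0 x = dder Omega0 nu0 u0 x *: nu0 x.
Proof.
apply: (@gradient_normal _ _ Omega0 Gamma0 U rho u0 x) => //.
- by move=> y Oy; exact: (Ck_differentiable uC).
- by move=> y /Gcl; exact: cu0.
- by move=> i; rewrite mxE; apply: cvg_bext => //; exact: cu1.
Qed.

(** The rotation of the normal does not contribute: the gradient of u0 is normal
to the boundary, and the first order change of a unit vector is tangential. *)
Lemma normal_derivative_rderiv t : 0 < t ->
  dot (nu0 x) ('D_(nu0 x) (nu_phi phi t) x) * dder Omega0 nu0 u0 x = 0 ->
  is_rderiv0 (fun s => - (dder Omega0 (unit_normal (phi s t @` Omega0)) u0 (phi s t x) +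
      dder (phi s t @` Omega0) (unit_normal (phi s t @` Omega0))
        (phi_push psi v s t) (phi s t x)))
    (- dder Omega0 nu0 (dder Omega0 (nu_phi phi t) u0) x
     - dder Omega0 nu0 (wbar v t) x).
Proof.
move=> t0 vanish; have t0' := ltW t0.
have [Nn cn] := unit_normal_flow_rderiv H oU Ux rC Uneg rx gx t0'.
have gE := gradient_u0; rewrite /nu0 in gE vanish *.
have cn' i : (unit_normal (phi s t @` Omega0) (phi s t x)) 0 i @[s --> 0^'+] -->
    unit_normal Omega0 x 0 i by rewrite nuE; exact: cn.
rewrite -nuE in Nn.
rewrite (dder_dder oOm uC (nu_phi_Ck H t0') _ cx (fun k => @cu1 k x cx)
  (fun i k => @cu2 i k x cx)).
rewrite gE dotZr [dot _ (unit_normal Omega0 x)]dotC mulrC vanish add0r -opprD.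
apply: is_rderiv0N; apply: is_rderiv0D.
  exact: (dder_u0_rderiv H uC stab (N := fun s => unit_normal (phi s t @` Omega0))
    t0' cx (@cu1) (fun i k => @cu2 i k x cx) gE cn' Nn).
exact: (dder_ubar_rderiv oOm H HV2 v0 (N := fun s => unit_normal (phi s t @` Omega0)) t0 cx cn').
Qed.

End AtBoundaryPoint.

Context (charts : forall x, Gamma0 x -> exists (U : set 'rV[R]_n) (rho : 'rV[R]_n -> R),
  [/\ [/\ open U, U x & Ck 1 U rho], forall z, U z -> Omega0 z <-> rho z < 0,
    forall z, U z -> Gamma0 z <-> rho z = 0 & grad rho x != 0]).

(** Each of the five conditions compares two functions of s whose right
derivatives are computed above; the linearized equation is their equality. *)
Lemma linearization_iff :
  (forall t x, 0 < t -> Gamma0 x -> bext Omega0 u0 x = 0 /\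
     dot (nu0 x) ('D_(nu0 x) (nu_phi phi t) x) * dder Omega0 nu0 u0 x = 0) ->
  linearization Omega0 Gamma0 u0 phi psi v <->
  linearized_system Omega0 Gamma0 u0 (wbar v) (nu_phi phi).
Proof.
move=> vanish.
have ub0 y : Gamma0 y -> bext Omega0 u0 y = 0.
  by move=> Gy; have [] := vanish 1 y ltr01 Gy.
have E1 t x (t0 : 0 < t) (Ox : Omega0 x) :=
  agree_iff (heat_rderiv H oOm HV3 v0o t0 Ox) (is_rderiv0_cst (0 : R)).
have E2 t x (t0 : 0 < t) (Gx : Gamma0 x) :=
  agree_iff (wbar_boundary_rderiv t0 (Gcl Gx)) (dirichlet_rderiv t0 (Gcl Gx)).
have E3 x (Ox : Omega0 x) := agree_iff (initial_rderiv Ox) (is_rderiv0_cst (0 : R)).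
have E4 t x : 0 < t -> Gamma0 x -> derivatives_agree
    (fun s => dot ('D_1 (fun t' => phi s t' x) t)
      (unit_normal (phi s t @` Omega0) (phi s t x)))
    (fun s => - (dder Omega0 (unit_normal (phi s t @` Omega0)) u0 (phi s t x) +
      dder (phi s t @` Omega0) (unit_normal (phi s t @` Omega0))
        (phi_push psi v s t) (phi s t x))) <->
    dot (nu0 x) ('D_1 (fun t' => nu_phi phi t' x) t) =
    - dder Omega0 nu0 (dder Omega0 (nu_phi phi t) u0) x
     - dder Omega0 nu0 (wbar v t) x.
  move=> t0 Gx; have [_ vx] := vanish t x t0 Gx.
  have [U [rho [[oU Ux rC] Uneg UG gx]]] := charts Gx.
  exact: (agree_iff (normal_velocity_rderiv Gx oU Ux rC Uneg UG gx t0)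
    (normal_derivative_rderiv Gx oU Ux rC Uneg UG gx ub0 t0 vx)).
have E5 x := agree_iff (@start_rderiv x) (is_rderiv0_cst x).
split=> -[e1 e2 e3 e4 e5]; split.
- by move=> t x t0 Ox; apply/(E1 t x t0 Ox); exact: e1.
- by move=> t x t0 Gx; apply/(E2 t x t0 Gx); exact: e2.
- by move=> x Ox; apply/(E3 x Ox); exact: e3.
- by move=> t x t0 Gx; apply/(E4 t x t0 Gx); exact: e4.
- by move=> x Gx; apply/(E5 x); exact: e5.
- by move=> t x t0 Ox; apply/(E1 t x t0 Ox); exact: e1.
- by move=> t x t0 Gx; apply/(E2 t x t0 Gx); exact: e2.
- by move=> x Ox; apply/(E3 x Ox); exact: e3.
- by move=> t x t0 Gx; apply/(E4 t x t0 Gx); exact: e4.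
- by move=> x Gx; apply/(E5 x); exact: e5.
Qed.

Lemma dder_ubar0 (nu : 'rV[R]_n -> 'rV[R]_n) t x : 0 < t -> closure Omega0 x ->
  dder (phi 0 t @` Omega0) nu (phi_push psi v 0 t) (phi 0 t x) = 0.
Proof.
move=> t0 cx; rewrite dderE; apply: big1 => i _.
have c := ubar_cvg oOm H HV2 (i := i) z0 t0 cx.
rewrite (bextE (closure_flow H z0 (ltW t0) cx) c) big1 ?mulr0// => k _.
by rewrite (derive_y_pull0_closure oOm H HV2 v0)// mulr0.
Qed.

(** At s = 0 the equations say that u0 and its normal derivative vanish on the
boundary, so that the two hypotheses of the equivalence hold; and functions of s
that coincide have the same derivative. *)
Lemma solution_linearized :
  pulled_back_equations Omega0 Gamma0 u0 phi psi v (solves s0) ->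
  linearized_system Omega0 Gamma0 u0 (wbar v) (nu_phi phi).
Proof.
move=> [e1 e2 e3 e4 e5]; apply/linearization_iff.
  move=> t x t0 Gx; have t0' := ltW t0; have cx := Gcl Gx; split.
    have := e2 t x t0 Gx 0 z0.
    by rewrite (flow_phi0 H)// v0// => /eqP; rewrite eq_sym oppr_eq0 => /eqP.
  have := e4 t x t0 Gx 0 z0.
  rewrite (derive_t_phi H x z0 t0) (derive_t_F0 H)// dot0l dder_ubar0//.
  rewrite image0// (flow_phi0 H)// addr0 => /eqP.
  by rewrite eq_sym oppr_eq0 => /eqP ->; rewrite mulr0.
split.
- move=> t x t0 Ox; apply: (solves_agree s00 (heat_rderiv H oOm HV3 v0o t0 Ox)).
  exact: e1.
- move=> t x t0 Gx; apply: (solves_agree s00 (wbar_boundary_rderiv t0 (Gcl Gx))).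
  exact: e2.
- move=> x Ox; apply: (solves_agree s00 (initial_rderiv Ox)); exact: e3.
- move=> t x t0 Gx; have [U [rho [[oU Ux rC] Uneg UG gx]]] := charts Gx.
  apply: (solves_agree s00 (normal_velocity_rderiv Gx oU Ux rC Uneg UG gx t0)).
  exact: e4.
- move=> x Gx; apply: (solves_agree s00 (@start_rderiv x)); exact: e5.
Qed.

End Linearization.

(** * From the Stefan problem to the pulled back equations *)

Section StefanPulledBack.
Context {R : realType} {n : nat}.
Local Notation P := (R * R * 'rV[R]_n)%type.
Local Notation dy := (fun k : 'I_n => @dir_y R n (ebase R k)).
Implicit Types (s t : R) (x y e : 'rV[R]_n).

Context (Omega0 Gamma0 : set 'rV[R]_n) (f u0 : 'rV[R]_n -> R) (s0 : R).
Context (phi psi : R -> R -> 'rV[R]_n -> 'rV[R]_n) (v : R -> R -> 'rV[R]_n -> R).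
Context (F Z : P -> 'rV[R]_n) (OF OZ : set P).
Context (V : P -> R) (OV : set P).
Context (oOm : open Omega0).
Context (Gcl : forall x, Gamma0 x -> closure Omega0 x).
Context (H : flow_extension s0 phi psi F Z OF OZ).
Context (stab : forall s t y, 0 <= s < s0 -> 0 <= t -> Omega0 y -> Omega0 (phi s t y)).
Context (HV : pullback_extension 2 s0 (closure Omega0) v V OV).
Context (v0 : forall t x, 0 <= t -> closure Omega0 x -> v 0 t x = 0).
Context (uC : Ck 2 Omega0 u0).
Context (cu0 : forall y, closure Omega0 y -> cvg (u0 @ within Omega0 (nbhs y))).
Context (cu1 : forall k y, closure Omega0 y ->
  cvg ('D_(ebase R k) u0 @ within Omega0 (nbhs y))).

Let z0 := range0 H.
Let HVo := pullback_extensionW (@subset_closure _ Omega0) HV.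
Let HV2 : pullback_extension 2 s0 Omega0 v V OV.
Proof.
case: HV => oV VC VD VE; split => //.
- by move=> s t x sE t0 /(@subset_closure _ Omega0); exact: VD.
- by move=> s t x sE t0 /(@subset_closure _ Omega0); exact: VE.
Qed.

Let image_sub s t : 0 <= s < s0 -> 0 <= t -> phi s t @` Omega0 `<=` Omega0.
Proof. by move=> sE t0 _ [y Oy <-]; exact: stab. Qed.

Lemma derive_sum_image s t y e : 0 <= s < s0 -> 0 < t -> (phi s t @` Omega0) y ->
  'D_e (fun z => u0 z + phi_push psi v s t z) y =
  'D_e u0 y + 'D_e (phi_push psi v s t) y.
Proof.
move=> sE t0 Oy; have t0' := ltW t0.
have Oy0 := image_sub sE t0' Oy; move/(psi_image Omega0 H y sE t0') : Oy => Oy.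
apply: deriveD; first exact/diff_derivable/(Ck_differentiable uC).
exact: (@ex_derive _ _ _ _ _ _ _ (ubar_derive_y oOm H HVo e sE t0 Oy)).
Qed.

Lemma laplacian_sum_image s t y : 0 <= s < s0 -> 0 < t -> (phi s t @` Omega0) y ->
  laplacian (fun z => u0 z + phi_push psi v s t z) y =
  laplacian u0 y + laplacian (phi_push psi v s t) y.
Proof.
move=> sE t0 Oy; have t0' := ltW t0.
rewrite /laplacian -big_split; apply: eq_bigr => i _.
have E : 'D_(ebase R i) ('D_(ebase R i) (fun z => u0 z + phi_push psi v s t z)) y =
    'D_(ebase R i) ('D_(ebase R i) u0 + 'D_(ebase R i) (phi_push psi v s t)) y.
  apply: near_eq_derive; near=> z.
  have Oz : (phi s t @` Omega0) z.
    by near: z; exact: (open_nbhs_nbhs (conj (open_image oOm H sE t0') Oy)).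
  exact: (derive_sum_image (ebase R i) sE t0 Oz).
apply: etrans E _.
have Oy0 := image_sub sE t0' Oy; move/(psi_image Omega0 H y sE t0') : Oy => Oy.
apply: deriveD.
  exact/diff_derivable/(Ck_differentiable (Ck_derive _ uC)).
exact: (@ex_derive _ _ _ _ _ _ _ (ubar_derive_yy oOm H HV2 (ebase R i) sE t0 Oy)).
Unshelve. all: by end_near. Qed.

Lemma bext_sum s t x (g h : 'rV[R]_n -> R) (l : R) :
  0 <= s < s0 -> 0 < t -> closure Omega0 x ->
  (forall y, closure Omega0 y -> cvg (g @ within Omega0 (nbhs y))) ->
  h @ within (phi s t @` Omega0) (nbhs (phi s t x)) --> l ->
  bext (phi s t @` Omega0) (fun z => g z + h z) (phi s t x) =
    bext Omega0 g (phi s t x) + l.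
Proof.
move=> sE t0 cx cg hl; have t0' := ltW t0.
have cl := closure_flow H sE t0' cx.
have FF : ProperFilter (within (phi s t @` Omega0) (nbhs (phi s t x))).
  exact: within_nbhs_proper.
have cl0 : closure Omega0 (phi s t x) by exact: (closureS (image_sub sE t0')).
apply: bextE => //; apply: cvgD => //.
apply: (cvg_within_subset (image_sub sE t0')).
by apply: cvg_bext => //; exact: cg.
Qed.

Lemma ubar_boundary_cvg s t x : 0 <= s < s0 -> 0 < t -> closure Omega0 x ->
  phi_push psi v s t @ within (phi s t @` Omega0) (nbhs (phi s t x)) --> v s t x.
Proof.
move=> sE t0 cx; have t0' := ltW t0.
have psix : psi s t (phi s t x) = x by rewrite (flow_phiK H).
apply: (@cvg_within_eq _ _ _ (fun y => V (s, t, psi s t y))).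
  move=> y /set_mem /(psi_image Omega0 H y sE t0') Oy.
  by rewrite /phi_push (pull_eq HVo sE t0 Oy).
have := @cvg_within_continuous _ _ (phi s t @` Omega0)
  (fun y => V (s, t, psi s t y)) (phi s t x).
rewrite /= psix -(pull_eq HV sE t0 cx); apply.
apply: (@continuous_comp _ _ _ (psi s t) (fun y => V (s, t, y))).
  exact: (psi_continuous H).
rewrite psix; apply: (@continuous_comp _ _ _ (fun y => (s, t, y) : P) V).
  exact: continuous_slice_y.
exact: (Ck_continuous (pull_Ck HV) (pull_dom HV sE t0 cx)).
Qed.

Lemma phi_push0 t y : 0 <= t -> Omega0 y -> phi_push psi v 0 t y = 0.
Proof.
move=> t0 Oy; rewrite /phi_push (psi0 H)// v0//; exact: subset_closure.
Qed.

Lemma phi_push0_operator t y : 0 < t -> Omega0 y ->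
  'D_1 (fun t' => phi_push psi v 0 t' y) t = 0 /\ laplacian (phi_push psi v 0 t) y = 0.
Proof.
move=> t0 Oy; split.
  apply: etrans (derive_cst (0 : R) t (1 : R)); apply: near_eq_derive; near=> t'.
  by apply: phi_push0 => //; near: t'; exact: near_ge0.
apply: big1 => i _; apply: etrans (derive_cst (0 : R) y (ebase R i)).
apply: near_eq_derive; near=> z.
apply: etrans (derive_cst (0 : R) z (ebase R i)); apply: near_eq_derive.
have Oz : Omega0 z by near: z; exact: (open_nbhs_nbhs (conj oOm Oy)).
near=> z'; apply: phi_push0; first exact: ltW.
by near: z'; exact: (open_nbhs_nbhs (conj oOm Oz)).
Unshelve. all: by end_near. Qed.

Lemma cancel_common (d l1 l2 : R) : d - (l1 + l2) = - l1 -> d - l2 = 0.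
Proof. by move=> *; lra. Qed.

(** The member s = 0 of the family says that u0 is an equilibrium,
- laplacian u0 = f; subtracting this from the equation at s leaves the
homogeneous heat equation for ubar. *)
Lemma stefan_pulled_back :
  (forall s, 0 <= s < s0 -> stefan_problem Omega0 Gamma0 f u0 (phi s)
     (fun t y => u0 y + phi_push psi v s t y)) ->
  pulled_back_equations Omega0 Gamma0 u0 phi psi v (solves s0).
Proof.
move=> S.
have D1E s t y : 0 <= s < s0 -> 0 < t -> (phi s t @` Omega0) y ->
    'D_1 (fun t' => u0 y + phi_push psi v s t' y) t =
    'D_1 (fun t' => phi_push psi v s t' y) t.
  move=> sE t0 /(psi_image Omega0 H y sE (ltW t0)) Oy.
  have D := @ex_derive _ _ _ _ _ _ _ (ubar_derive_t oOm H HVo sE t0 Oy).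
  apply: etrans (deriveD (derivable_cst (u0 y) t 1) D) _.
  apply: etrans (congr1 (fun r => r + _) (derive_cst (u0 y) t (1 : R))) _.
  exact: add0r.
have equil y : Omega0 y -> - laplacian u0 y = f y.
  move=> Oy; have [S1 _ _ _ _] := S 0 z0.
  have Oy' : (phi 0 1 @` Omega0) y by exists y => //; rewrite (flow_phi0 H).
  have := S1 1 y ltr01 Oy'.
  have [d1 d2] := phi_push0_operator ltr01 Oy.
  by rewrite D1E// laplacian_sum_image// d1 d2 addr0 sub0r.
split.
- move=> t x t0 Ox s sE; have [S1 _ _ _ _] := S s sE.
  have Oy : (phi s t @` Omega0) (phi s t x) by exists x.
  have Oy0 := image_sub sE (ltW t0) Oy.
  have E := S1 t _ t0 Oy.
  rewrite (D1E s t _ sE t0 Oy) (laplacian_sum_image sE t0 Oy) -(equil _ Oy0) in E.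
  exact: cancel_common E.
- move=> t x t0 Gx s sE; have [_ S2 _ _ _] := S s sE; have cx := Gcl Gx.
  have Gy : (phi s t @` Gamma0) (phi s t x) by exists x.
  have := S2 t _ t0 Gy.
  rewrite (bext_sum sE t0 cx cu0 (ubar_boundary_cvg sE t0 cx)) addrC => /eqP.
  by rewrite addr_eq0 => /eqP.
- move=> x Ox s sE; have [_ _ S3 _ _] := S s sE.
  have := S3 (phi s 0 x) (stab sE (lexx 0) Ox).
  rewrite /phi_push (flow_phiK H sE (lexx 0)) => /eqP.
  by rewrite -subr_eq0 addrAC subrr add0r => /eqP.
- move=> t x t0 Gx s sE; have [_ _ _ S4 _] := S s sE; have cx := Gcl Gx.
  rewrite (S4 t x t0 Gx); congr (- _); rewrite !dderE -big_split /=.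
  apply: eq_bigr => i _; rewrite -mulrDr; congr (_ * _).
  have c := ubar_cvg oOm H HV (i := i) sE t0 cx.
  rewrite (bextE (closure_flow H sE (ltW t0) cx) c).
  rewrite -(bext_sum sE t0 cx (@cu1 i) c).
  apply: eq_bext => y /set_mem Oy; exact: (derive_sum_image (ebase R i) sE t0 Oy).
- by move=> x Gx s sE; have [_ _ _ _ S5] := S s sE; exact: S5.
Qed.

End StefanPulledBack.

(** * Iterated integrals of continuous functions with bounded support *)

Section OneDimension.
Context {R : realType}.
Local Notation mu := (@lebesgue_measure R).
Implicit Types (M c : R) (g h : R -> R).

Definition cc1 M g := continuous g /\ forall z, M < `|z| -> g z = 0.

Definition integral1 g : R := Rintegral mu setT g.

Lemma cc1_restrict M g : cc1 M g -> g \_ `[- M, M]%classic = g.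
Proof.
move=> [_ g0]; apply/funext => z; rewrite patchE; case: ifPn => // /negP zM.
apply/esym/g0; rewrite ltNge; apply/negP => zM'; apply: zM.
by apply/mem_set; rewrite /= in_itv/= -ler_norml.
Qed.

Lemma cc1_integrable_segment M g : cc1 M g ->
  mu.-integrable `[- M, M]%classic (EFin \o g).
Proof.
move=> [cg _]; apply: continuous_compact_integrable; first exact: segment_compact.
exact: continuous_subspaceT.
Qed.

Lemma measurable_segment (a b : R) :
  measurable (`[a, b]%classic : set (measurableTypeR R)).
Proof. exact: measurable_itv. Qed.

Lemma cc1_integrable M g : cc1 M g -> mu.-integrable setT (EFin \o g).
Proof.
move=> gM; rewrite -(cc1_restrict gM) -restrict_EFin.
apply/(integrable_mkcond _ (measurable_segment (- M) M)).
exact: cc1_integrable_segment.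
Qed.

Lemma integral1_segment M g : cc1 M g ->
  integral1 g = Rintegral mu `[- M, M]%classic g.
Proof. by move=> gM; rewrite Rintegral_mkcond (cc1_restrict gM). Qed.

Lemma integral1_lin M g h a : cc1 M g -> cc1 M h ->
  integral1 (fun z => g z + a * h z) = integral1 g + a * integral1 h.
Proof.
move=> gM hM; have ig := cc1_integrable gM; have ih := cc1_integrable hM.
rewrite /integral1 RintegralD//; last first.
  apply: (cc1_integrable (M := M)); split; last first.
    by move=> z zM; case: hM => _ ->//; rewrite mulr0.
  case: hM => ch _ z.
  by apply: (@cvgM _ _ _ (nbhs_filter z) (cst a) h); [exact: cvg_cst|exact: (ch z)].
by rewrite RintegralZl.
Qed.

Lemma segment_measure M : 0 <= M -> fine (mu `[- M, M]%classic) = 2 * M.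
Proof.
move=> M0; rewrite lebesgue_measure_itv/= lte_fin.
have [MM|MM] := ltP (- M) M; first by rewrite /= opprK mulrC mulr_natr mulr2n.
by have -> : M = 0; [lra|rewrite mulr0].
Qed.

Lemma integral1_bound M g c : 0 <= M -> cc1 M g -> (forall z, `|g z| <= c) ->
  `|integral1 g| <= c * (2 * M).
Proof.
move=> M0 gM gc; rewrite (integral1_segment gM).
have mI := measurable_segment (- M) M.
have iM := cc1_integrable_segment gM.
apply: le_trans (le_normr_Rintegral mI iM) _.
rewrite -(segment_measure M0) -Rintegral_cst//.
apply: le_Rintegral => //.
- have := cc1_integrable_segment (M := M) (g := fun z => `|g z|).
  apply; split; last by move=> z zM; case: gM => _ ->//; rewrite normr0.
  by case: gM => cg _ z; apply: (@cvg_norm _ _ _ (nbhs z) _ g); exact: (cg z).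
- apply: continuous_compact_integrable; first exact: segment_compact.
  by apply: continuous_subspaceT => z; exact: cvg_cst.
Qed.

Lemma integral1_ge0 g : (forall z, 0 <= g z) -> 0 <= integral1 g.
Proof. by move=> g0; apply: Rintegral_ge0. Qed.

Lemma integral1_gt0 M g z0 : cc1 M g -> (forall z, 0 <= g z) -> 0 < g z0 ->
  0 < integral1 g.
Proof.
move=> gM g0 gz0; pose c := g z0 / 2.
have c0 : 0 < c by rewrite divr_gt0.
have cg : {for z0, continuous g} by case: gM => cg _; exact: cg.
have : \forall z \near z0, c < g z.
  apply: (cvgr_gt _ cg); rewrite /c; lra.
move=> /nbhs_ballP[d /= d0 dg].
pose I := `[z0 - d / 2, z0 + d / 2]%classic.
have mI : measurable (I : set (measurableTypeR R)) by exact: measurable_segment.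
have ltI : z0 - d / 2 < z0 + d / 2 by rewrite ltrD2l; lra.
have muI : fine (mu I) = d.
  rewrite /I lebesgue_measure_itv/= lte_fin ltI /=; lra.
have ic : mu.-integrable I (EFin \o (fun=> c)).
  apply: continuous_compact_integrable; first exact: segment_compact.
  by apply: continuous_subspaceT => z; exact: cvg_cst.
have iT := cc1_integrable gM.
have icT : mu.-integrable setT (EFin \o ((fun=> c) \_ I)).
  by rewrite -restrict_EFin; apply/(integrable_mkcond _ mI).
have cd : 0 < c * d by rewrite mulr_gt0.
apply: lt_le_trans cd _.
rewrite -{1}muI -Rintegral_cst// Rintegral_mkcond.
apply: le_Rintegral => // z _; rewrite patchE; case: ifPn => [/set_mem|_]; last exact: g0.
rewrite /I/= in_itv/= => /andP[z1 z2]; apply: ltW; apply: dg.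
rewrite /ball/= distrC ltr_norml; apply/andP; split; lra.
Qed.

End OneDimension.

Section HigherDimension.
Context {R : realType}.

(** Cubes rather than balls: their slices are cubes of the same half-width. *)
Definition ccube (n : nat) (M : R) (f : 'rV[R]_n -> R) :=
  continuous f /\ forall (z : 'rV[R]_n) i, M < `|z 0 i| -> f z = 0.

Definition slice n (f : 'rV[R]_n.+1 -> R) (z : R) (y : 'rV[R]_n) : R :=
  f (row_mx (z%:M : 'rV[R]_1) y : 'rV[R]_(1 + n)).

Lemma integral_rVS n (f : 'rV[R]_n.+1 -> R) :
  integral_rV f = integral1 (fun z => integral_rV (slice f z)).
Proof. by []. Qed.

Lemma row_mx_continuous n : continuous
  (fun p : R * 'rV[R]_n => row_mx (p.1%:M : 'rV[R]_1) p.2 : 'rV[R]_(1 + n)).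
Proof.
move=> p; apply: continuous_rV => i; case: (split_ordP i) => j ->.
  have -> : (fun y : R * 'rV[R]_n => row_mx (y.1%:M : 'rV[R]_1) y.2 0 (lshift n j))
      = fst.
    by apply/funext => y; rewrite row_mxEl mxE eqE/= (ord1 j) mulr1n.
  exact: cvg_fst.
have -> : (fun y : R * 'rV[R]_n => row_mx (y.1%:M : 'rV[R]_1) y.2 0 (rshift 1 j))
    = (fun y => y.2 0 j).
  by apply/funext => y; rewrite row_mxEr.
apply: (@continuous_comp _ _ _ snd (fun M : 'rV[R]_n => M 0 j)).
  exact: cvg_snd.
exact: coord_continuous.
Qed.

Lemma slice_ccube n M f z : @ccube n.+1 M f -> ccube M (slice f z).
Proof.
move=> [cf f0]; split => [y|y i yM].
  have cJ : {for y, continuous (fun y : 'rV[R]_n => (z, y))}.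
    exact: differentiable_continuous.
  apply: (@continuous_comp _ _ _ (fun y : 'rV[R]_n => (z, y)) (fun p : R * 'rV[R]_n =>
    f (row_mx (p.1%:M : 'rV[R]_1) p.2 : 'rV[R]_(1 + n)))) => //.
  apply: (@continuous_comp _ _ _
    (fun p : R * 'rV[R]_n => row_mx (p.1%:M : 'rV[R]_1) p.2 : 'rV[R]_(1 + n)) f).
    exact: row_mx_continuous.
  exact: cf.
apply: (f0 _ (rshift 1 i)).
by have := yM; rewrite -(row_mxEr (z%:M : 'rV[R]_1) y 0 i).
Qed.

Lemma slice_vanish n M f z : @ccube n.+1 M f -> M < `|z| -> slice f z = fun=> 0.
Proof.
move=> [_ f0] zM; apply/funext => y; apply: (f0 _ (lshift n (ord0 : 'I_1))).
have E : row_mx (z%:M : 'rV[R]_1) y 0 (lshift n (ord0 : 'I_1)) = z.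
  by rewrite row_mxEl mxE eqE/= mulr1n.
by have := zM; rewrite -{1}E.
Qed.

Lemma cube_compact n (M : R) :
  compact [set y : 'rV[R]_n | forall i, `|y 0 i| <= M].
Proof.
have : compact [set y : 'rV[R]_n | forall i, `[- M, M]%classic (y 0 i)].
  by apply: (@rV_compact _ _ (fun=> `[- M, M]%classic)) => i; exact: segment_compact.
congr (compact _); apply/funext => y; apply/propext; split => h i.
  by have := h i; rewrite /= in_itv/= -ler_norml.
by rewrite /= in_itv/= -ler_norml.
Qed.

(** Only the slices over the compact cube matter, and there continuity in z is
uniform in y. *)
Lemma slice_uniform n M f z (e : R) : @ccube n.+1 M f -> 0 < e ->
  \forall z' \near z, forall y, `|slice f z' y - slice f z y| <= e.
Proof.
move=> fM e0.
have nc := iffLR (compact_near_coveringP _) (@cube_compact n M).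
have cov y : [set y : 'rV[R]_n | forall i, `|y 0 i| <= M] y ->
    \forall y' \near y & z' \near z, `|slice f z' y' - slice f z y'| <= e.
  move=> _; have e2 : 0 < e / 2 by rewrite divr_gt0.
  pose g (p : R * 'rV[R]_n) :=
    f (row_mx (p.1%:M : 'rV[R]_1) p.2 : 'rV[R]_(1 + n)).
  have cg : {for (z, y), continuous g}.
    apply: (@continuous_comp _ _ _
      (fun p : R * 'rV[R]_n => row_mx (p.1%:M : 'rV[R]_1) p.2 : 'rV[R]_(1 + n)) f).
      exact: row_mx_continuous.
    by case: fM => cf _; exact: cf.
  have /cvgr_dist_le/(_ _ e2)[[A B]/= [Az By] AB] := cg.
  exists (B, A) => // -[y' z']/= [By' Az'].
  have h1 := AB (z', y') (conj Az' By').
  have h2 := AB (z, y') (conj (nbhs_singleton Az) By').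
  apply: le_trans (ler_distD (g (z, y)) _ _) _.
  rewrite (splitr e) lerD//.
  by rewrite distrC.
apply: filterS (nc R (nbhs z) (fun z' y => `|slice f z' y - slice f z y| <= e)
  (nbhs_filter z) cov) => z' h y.
have [/asboolP yM|/asboolPn/existsNP[i /negP]] := boolP `[< forall i, `|y 0 i| <= M >].
  exact: h.
rewrite -ltNge => yM.
have [_ f0] := slice_ccube z fM; have [_ f0'] := slice_ccube z' fM.
by rewrite (f0 _ _ yM) (f0' _ _ yM) subrr normr0 ltW.
Qed.

(** The three properties are proved together: linearity and the bound for the
inner integrals make the outer integrand continuous. *)
Lemma integral_rV_facts n (M : R) : 0 <= M ->
  [/\ forall f g a, @ccube n M f -> @ccube n M g ->
        integral_rV (fun z => f z + a * g z) = integral_rV f + a * integral_rV g,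
      forall f c, @ccube n M f -> (forall z, `|f z| <= c) ->
        `|integral_rV f| <= c * (2 * M) ^+ n,
      forall f, @ccube n M f -> (forall z, 0 <= f z) -> 0 <= integral_rV f &
      forall f z0, @ccube n M f -> (forall z, 0 <= f z) -> 0 < f z0 ->
        0 < integral_rV f].
Proof.
move=> M0; elim: n => [|n [IHl IHb IHp IHs]].
  split=> //=.
  - by move=> f c _ fc; rewrite expr0 mulr1.
  - by move=> f z0 _ _; rewrite (_ : z0 = 0)//; apply/rowP => -[].
have zeroI : integral_rV (fun _ : 'rV[R]_n => 0 : R) = 0.
  have z0 : @ccube n M (fun _ => 0 : R) by split => //; exact: cst_continuous.
  have := IHb _ 0 z0; rewrite mul0r => h.
  by apply/eqP; rewrite -normr_eq0 eq_le normr_ge0 andbT h// => z; rewrite normr0.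
have inner f : @ccube n.+1 M f -> cc1 M (fun z => integral_rV (slice f z)).
  move=> fM; split => [z|z zM]; last by rewrite (slice_vanish fM zM).
  apply/cvgrPdist_le => /= e e0.
  have K0 : 0 < (2 * M) ^+ n + 1.
    by rewrite ltr_pwDr// exprn_ge0// mulr_ge0.
  have e1 : 0 < e / ((2 * M) ^+ n + 1) by rewrite divr_gt0.
  apply: filterS (slice_uniform z fM e1) => z' h; rewrite distrC.
  have E : integral_rV (slice f z') - integral_rV (slice f z) =
      integral_rV (fun y => slice f z' y + -1 * slice f z y).
    by rewrite IHl ?mulN1r//; exact: slice_ccube.
  have cD : @ccube n M (fun y => slice f z' y + -1 * slice f z y).
    have [c1 s1] := slice_ccube z fM; have [c2 s2] := slice_ccube z' fM.
    split => [y|y i yM]; last by rewrite (s1 _ _ yM) (s2 _ _ yM) mulr0 addr0.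
    apply: (@cvgD _ _ _ _ (nbhs_filter y) (slice f z') (fun y => -1 * slice f z y)).
      exact: (c2 y).
    apply: (@cvgM _ _ _ (nbhs_filter y) (cst (-1)) (slice f z)); first exact: cvg_cst.
    exact: (c1 y).
  rewrite E; apply: le_trans (IHb _ _ cD _) _.
    by move=> y; rewrite mulN1r; exact: h.
  rewrite -[leRHS](divfK (lt0r_neq0 K0)) ler_wpM2l//; first exact: ltW.
  by rewrite lerDl.
split.
- move=> f g a fM gM; rewrite !integral_rVS.
  rewrite -(integral1_lin a (inner f fM) (inner g gM)).
  apply: eq_Rintegral => z _; rewrite -IHl//; exact: slice_ccube.
- move=> f c fM fc; rewrite integral_rVS exprS.
  have -> : c * (2 * M * (2 * M) ^+ n) = c * (2 * M) ^+ n * (2 * M) by ring.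
  apply: (integral1_bound M0 (inner f fM)) => z.
  by apply: IHb => [|y]; [exact: slice_ccube|exact: fc].
- move=> f fM f0; rewrite integral_rVS; apply: integral1_ge0 => z.
  by apply: IHp => [|y]; [exact: slice_ccube|exact: f0].
- move=> f z0 fM f0 fz0; rewrite integral_rVS.
  have z0E : row_mx ((z0 0 ord0)%:M : 'rV[R]_1) (rsubmx (z0 : 'rV[R]_(1 + n))) = z0.
    have <- : lsubmx (z0 : 'rV[R]_(1 + n)) = (z0 0 ord0)%:M.
      apply/rowP => i; rewrite (ord1 i) !mxE eqE/= mulr1n.
      by congr (z0 _ _); exact: val_inj.
    exact: (@hsubmxK _ 1 1 n).
  apply: (integral1_gt0 (z0 := z0 0 ord0) (inner f fM)) => [z|].
    by apply: IHp => [|y]; [exact: slice_ccube|exact: f0].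
  apply: (IHs _ (rsubmx (z0 : 'rV[R]_(1 + n)))) => [|y|];
    [exact: slice_ccube|exact: f0|].
  by rewrite /slice z0E.
Qed.

Lemma integral_rV0 n : integral_rV (fun _ : 'rV[R]_n => 0 : R) = 0.
Proof.
have z0 : @ccube n 0 (fun _ => 0 : R) by split => //; exact: cst_continuous.
have [_ b _ _] := integral_rV_facts n (lexx (0 : R)).
have := b _ 0 z0; rewrite mul0r => h.
by apply/eqP; rewrite -normr_eq0 eq_le normr_ge0 andbT h// => z; rewrite normr0.
Qed.

Lemma ccube_combo n M k (c : 'I_k -> R) (f : 'I_k -> 'rV[R]_n -> R) :
  (forall i, ccube M (f i)) -> ccube M (fun z => \sum_i c i * f i z).
Proof.
move=> fM; split => [z|z i zM].
  apply: (@cvg_rsum _ _ _ (nbhs_filter z)) => j; apply: cvgM; first exact: cvg_cst.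
  by have [cf _] := fM j; exact: cf.
by apply: big1 => j _; have [_ f0] := fM j; rewrite (f0 z i zM) mulr0.
Qed.

Lemma integral_rV_combo n M k (c : 'I_k -> R) (f : 'I_k -> 'rV[R]_n -> R) : 0 <= M ->
  (forall i, ccube M (f i)) ->
  integral_rV (fun z => \sum_i c i * f i z) = \sum_i c i * integral_rV (f i).
Proof.
move=> M0 fM; have [lin _ _ _] := integral_rV_facts n M0.
elim: k c f fM => [|k IH] c f fM.
  rewrite big_ord0 -[RHS](integral_rV0 n); congr integral_rV.
  by apply/funext => z; rewrite big_ord0.
rewrite big_ord_recr /= -IH; last by move=> i; exact: fM.
rewrite -lin//; last exact: ccube_combo.
by congr integral_rV; apply/funext => z; rewrite big_ord_recr.
Qed.

End HigherDimension.

(** * The mollified normal field *)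

Section MollifiedNormal.
Context {R : realType} {n : nat}.
Implicit Types (x y z : 'rV[R]_n).

Lemma coord_le_enorm z i : `|z 0 i| <= enorm z.
Proof.
rewrite -(@ler_pXn2r _ 2)// ?nnegrE ?enorm_ge0//.
rewrite real_normK ?num_real// [leRHS]expr2 sqr_enorm /dot (bigD1 i)//= expr2 lerDl.
by apply: sumr_ge0 => j _; rewrite -expr2 sqr_ge0.
Qed.

Lemma norm_le_enorm z : `|z| <= enorm z.
Proof.
rewrite /Num.Def.normr/= mx_normrE; apply: bigmax_le; first exact: enorm_ge0.
by move=> [i k] _ /=; rewrite (ord1 i); exact: coord_le_enorm.
Qed.

Lemma enormZ (c : R) z : 0 <= c -> enorm (c *: z) = c * enorm z.
Proof.
move=> c0; rewrite /enorm dotZl dotZr mulrA sqrtrM ?mulr_ge0//.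
by rewrite -expr2 sqrtr_sqr ger0_norm.
Qed.

Context (Omega0 Gamma0 : set 'rV[R]_n).
Context (charts : forall x, Gamma0 x -> exists (U : set 'rV[R]_n) (rho : 'rV[R]_n -> R),
  [/\ [/\ open U, U x & Ck 1 U rho], forall z, U z -> Omega0 z <-> rho z < 0,
    forall z, U z -> Gamma0 z <-> rho z = 0 & forall z, U z -> grad rho z != 0]).
Let nu0 := unit_normal Omega0.

Lemma chart_normal (U : set 'rV[R]_n) (rho : 'rV[R]_n -> R) y : open U -> Ck 1 U rho ->
  (forall z, U z -> Omega0 z <-> rho z < 0) ->
  (forall z, U z -> Gamma0 z <-> rho z = 0) ->
  (forall z, U z -> grad rho z != 0) -> U y -> Gamma0 y ->
  nu0 y = (enorm (grad rho y))^-1 *: grad rho y.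
Proof.
move=> oU rC Un UG g0 Uy Gy; apply: unit_normalE.
exists U, rho; split => //; first by split => //; exact: g0.
exact/(UG _ Uy).
Qed.

Lemma normal_unit y : Gamma0 y -> dot (nu0 y) (nu0 y) = 1.
Proof.
move=> Gy; have [U [rho [[oU Uy rC] Un UG g0]]] := charts Gy.
by rewrite (chart_normal oU rC Un UG g0 Uy Gy) normalize_dot// g0.
Qed.

Context (r0 : R) (Y : 'rV[R]_n -> 'rV[R]_n) (r : 'rV[R]_n -> R) (eta : R -> R).
Context (htub : tubular_coordinates Gamma0 nu0 r0 Y r) (heta : cutoff r0 eta).
Let nut := nu_tilde Gamma0 nu0 r0 Y r eta.

Lemma open_tube : open (tube Gamma0 r0).
Proof.
rewrite openE => x [y Gy xy].
by apply: filterS (near_enormB xy) => z zy; exists y.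
Qed.

Lemma nu_tilde_tube z : tube Gamma0 r0 z -> nut z = eta (r z) *: nu0 (Y z).
Proof. by move=> tz; rewrite /nut /nu_tilde patchE mem_set. Qed.

Lemma tube_surface x : Gamma0 x -> tube Gamma0 r0 x.
Proof.
by move=> Gx; have [r00 _ _ _ _] := htub; exists x => //; rewrite subrr enorm0.
Qed.

Lemma nu_tilde_surface x : Gamma0 x -> nut x = nu0 x.
Proof.
move=> Gx; rewrite nu_tilde_tube; last exact: tube_surface.
have [r00 T1 _ _ _] := htub; have [_ _ eta1 _] := heta.
have q0 : `|0 : R| < r0 by rewrite normr0.
have [_] := T1 x 0 Gx q0; rewrite scale0r addr0 => -> ->.
by rewrite eta1 ?scale1r// normr0 divr_ge0// ltW.
Qed.

Lemma nu_tilde_cvg z i : tube Gamma0 r0 z -> nut z' 0 i @[z' --> z] --> nut z 0 i.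
Proof.
move=> tz; have [r00 T1 T2 YC rC] := htub; have [etaC _ _ _] := heta.
have [GY _ _] := T2 z tz.
have [U [rho [[oU Uy rhoC] Un UG g0]]] := charts GY.
pose g z' i := 'D_(ebase R i) rho (Y z').
pose G z' := grad rho (Y z').
have cY : {for z, continuous Y} by exact: (Ck_continuous YC tz).
have cG j : G z' 0 j @[z' --> z] --> G z 0 j.
  have -> : (fun z' => G z' 0 j) = 'D_(ebase R j) rho \o Y.
    by apply/funext => z'; rewrite mxE.
  rewrite mxE; apply: (@continuous_comp _ _ _ Y ('D_(ebase R j) rho)) => //.
  exact: (Ck_continuous (Ck_derive _ rhoC) Uy).
have cGG : dot (G z') (G z') @[z' --> z] --> dot (G z) (G z) by exact: (cvg_dot cG cG).
have ce : enorm (G z') @[z' --> z] --> enorm (G z).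
  apply: (@cvg_comp _ _ _ (fun z' => dot (G z') (G z')) (@Num.sqrt R) _ _ _ cGG).
  exact: sqrt_continuous.
have ceta : eta (r z') @[z' --> z] --> eta (r z).
  apply: (@continuous_comp _ _ _ r eta); first exact: (Ck_continuous rC tz).
  by apply: (@Ck_continuous _ _ _ 0 setT) => //; exact: etaC.
have limit : eta (r z') * ((enorm (G z'))^-1 * G z' 0 i) @[z' --> z] -->
    eta (r z) * ((enorm (G z))^-1 * G z 0 i).
  have eG : enorm (G z) != 0 by rewrite gt_eqF// enorm_gt0 g0.
  exact: (cvgM ceta (cvgM (cvgV eG ce) (cG i))).
have E z' : tube Gamma0 r0 z' -> U (Y z') ->
    nut z' 0 i = eta (r z') * ((enorm (G z'))^-1 * G z' 0 i).
  move=> tz' Uz'; have [GY' _ _] := T2 z' tz'.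
  by rewrite nu_tilde_tube// (chart_normal oU rhoC Un UG g0 Uz' GY') !mxE.
have n1 : \forall z' \near z, tube Gamma0 r0 z'.
  exact: (open_nbhs_nbhs (conj open_tube tz)).
have n2 : \forall z' \near z, U (Y z').
  by apply: cY; exact: (open_nbhs_nbhs (conj oU Uy)).
have near_eq : \forall z' \near z,
    eta (r z') * ((enorm (G z'))^-1 * G z' 0 i) = nut z' 0 i.
  by apply: filterS (filterI n1 n2) => z' [tz' Uz']; apply/esym; exact: E.
apply: (cvg_trans (near_eq_cvg near_eq)).
exact: (eq_rect _ (fun l : R => _ --> l) limit _ (esym (E z tz Uy))).
Qed.

(** Compactness of the surface gives one radius on which the extended normal
field deviates by less than a right angle from its value at the centre. *)
Lemma uniform_cone : compact Gamma0 -> exists2 d : R, 0 < d &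
  forall x z, Gamma0 x -> `|z| < d ->
    tube Gamma0 r0 (x - z) /\ 0 < dot (nut x) (nut (x - z)).
Proof.
move=> cptG.
pose Q (d : R) x := forall z, `|z| < d ->
  tube Gamma0 r0 (x - z) /\ 0 < dot (nut x) (nut (x - z)).
have nc := iffLR (compact_near_coveringP _) cptG.
have cov x : Gamma0 x -> \forall x' \near x & d \near 0^'+, Q d x'.
  move=> Gx; have tx := tube_surface Gx.
  have c1 : dot (nut p.1) (nut p.2) @[p --> (x, x)] --> dot (nut x) (nut x).
    apply: cvg_dot => i.
      apply: (@cvg_comp _ _ _ fst (fun z => nut z 0 i) _ (nbhs x)).
        exact: cvg_fst.
      exact: nu_tilde_cvg.
    apply: (@cvg_comp _ _ _ snd (fun z => nut z 0 i) _ (nbhs x)).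
      exact: cvg_snd.
    exact: nu_tilde_cvg.
  have p1 : 0 < dot (nut x) (nut x) by rewrite nu_tilde_surface// normal_unit.
  have [[A B] /= [Ax Bx] AB] := cvgr_gt _ c1 _ p1.
  have /nbhs_ballP[e /= e0 eB] : nbhs x (B `&` tube Gamma0 r0).
    by apply: filterI => //; exact: (open_nbhs_nbhs (conj open_tube tx)).
  have e2 : 0 < e / 2 by rewrite divr_gt0.
  exists (A `&` ball x (e / 2), [set d | d < e / 2]).
    split => /=; first by apply: filterI => //; exact: nbhsx_ballx.
    exact: nbhs_right_lt.
  move=> [x' d] /= [[Ax' x'x] de] z zd.
  have : ball x e (x' - z).
    move: x'x; rewrite -ball_normE /ball_/= => x'x.
    have -> : x - (x' - z) = (x - x') + z by rewrite opprB addrA addrAC.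
    by rewrite (le_lt_trans (ler_normD _ _))// (splitr e) ltrD// (lt_trans zd).
  move=> /eB[Bz tz]; split; first exact: tz.
  exact: (AB (x', x' - z) (conj Ax' Bz)).
have near1 := nc R 0^'+ Q (at_right_proper_filter 0) cov.
have n0 : \forall d \near (0 : R)^'+, 0 < d by exact: nbhs_right_gt.
have [d [d0 dQ]] := @filter_ex _ _ (at_right_proper_filter (0 : R)) _ (filterI n0 near1).
by exists d => // x z Gx; exact: dQ.
Qed.

Context (m : 'rV[R]_n -> R) (hm : mollifier m).

Lemma mollifier_positive : exists z, 0 < m z.
Proof.
have [_ m0 _ m1] := hm; apply: contrapT => /forallNP np.
have mE : m = fun=> 0.
  apply/funext => z; apply/eqP; rewrite eq_le m0 andbT leNgt.
  by apply/negP; exact: np.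
by move/eqP: m1; rewrite mE integral_rV0 eq_sym oner_eq0.
Qed.

(** Against the direction nu0 x the mollified field is the integral of a
nonnegative continuous function that is positive somewhere. *)
Lemma mollified_normal_neq0 : compact Gamma0 ->
  exists2 delta0 : R, 0 < delta0 & forall delta, 0 < delta < delta0 ->
    forall x, Gamma0 x -> mollify m delta nut x != 0.
Proof.
move=> /uniform_cone[d1 d10 cone]; have [mC m0 [M' mM'] _] := hm.
(* The bound M' on the support may be negative. *)
pose M := Num.max M' 0.
have M0 : 0 <= M by rewrite le_max lexx orbT.
have mM z : M < enorm z -> m z = 0.
  by move=> zM; apply: mM'; apply: le_lt_trans zM; rewrite le_max lexx.
have M1 : 0 < M + 1 by rewrite ltr_pwDr.
exists (d1 / (M + 1)); first by rewrite divr_gt0.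
move=> d /andP[d0]; rewrite ltr_pdivlMr// => dd1 x Gx.
have dM : d * M < d1 by apply: le_lt_trans dd1; rewrite ler_pM2l// lerDl.
have dM0 : 0 <= d * M by rewrite mulr_ge0// ltW.
have far z : d * M < enorm z -> m (d^-1 *: z) = 0.
  move=> zM; apply: mM; rewrite enormZ ?invr_ge0 ?ltW//.
  by rewrite mulrC ltr_pdivlMr// mulrC.
have cm : continuous (fun z => m (d^-1 *: z)).
  move=> z; apply: (@continuous_comp _ _ _ (fun z => d^-1 *: z) m).
    exact: scaler_continuous.
  by apply: (@Ck_continuous _ _ _ 0 setT) => //; exact: mC.
pose g i z := d ^- n * m (d^-1 *: z) * nut (x - z) 0 i.
have gM i : ccube (d * M) (g i).
  split => [z|z k zk]; last first.
    by rewrite /g far ?mulr0 ?mul0r// (lt_le_trans zk)// coord_le_enorm.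
  have [zd|zd] := ltP `|z| d1.
    have [tz _] := cone x z Gx zd.
    have c1 : m (d^-1 *: z') @[z' --> z] --> m (d^-1 *: z) := cm z.
    have cB : x - z' @[z' --> z] --> x - z.
      exact: (cvgB (cvg_cst x) (@cvg_id _ (nbhs z))).
    have c2 : nut (x - z') 0 i @[z' --> z] --> nut (x - z) 0 i.
      exact: (@cvg_comp _ _ _ (fun z => x - z) (fun z => nut z 0 i) _ (nbhs (x - z))
        _ cB (@nu_tilde_cvg (x - z) i tz)).
    exact: (cvgM (cvgM (cvg_cst (d ^- n)) c1) c2).
  have zM : d * M < enorm z.
    by apply: lt_le_trans dM _; apply: le_trans zd _; exact: norm_le_enorm.
  have gz z' : d * M < enorm z' -> g i z' = 0.
    by move=> z'M; rewrite /g far// mulr0 mul0r.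
  have nz : \forall z' \near z, d * M < enorm z'.
    have ce : enorm z' @[z' --> z] --> enorm z by exact: continuous_enorm.
    exact: (cvgr_gt _ ce _ zM).
  change (g i z' @[z' --> z] --> g i z); rewrite gz//.
  have near_eq : \forall z' \near z, cst (0 : R) z' = g i z'.
    by apply: filterS nz => z' /gz ->.
  exact: (cvg_trans (near_eq_cvg near_eq) (cvg_cst (0 : R))).
pose w := nut x.
have GE z : \sum_i w 0 i * g i z = d ^- n * m (d^-1 *: z) * dot w (nut (x - z)).
  by rewrite /dot mulr_sumr; apply: eq_bigr => i _; exact: mulrCA.
have dn : 0 < d ^- n by rewrite invr_gt0 exprn_gt0.
have Gge0 z : 0 <= \sum_i w 0 i * g i z.
  rewrite GE; have [zd|zd] := ltP `|z| d1.
    have [_ c] := cone x z Gx zd.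
    by rewrite !mulr_ge0// ltW.
  rewrite far ?mulr0 ?mul0r//.
  by apply: lt_le_trans dM _; apply: le_trans zd _; exact: norm_le_enorm.
have [z0 mz0] := mollifier_positive.
have Gz0 : 0 < \sum_i w 0 i * g i (d *: z0).
  have zd : `|d *: z0| < d1.
    apply: le_lt_trans (norm_le_enorm _) _; rewrite enormZ ?ltW//.
    apply: le_lt_trans dM; rewrite ler_pM2l// leNgt; apply/negP => /mM E.
    by move: mz0; rewrite E ltxx.
  have [_ c] := cone x _ Gx zd.
  by rewrite GE scalerA mulVf ?gt_eqF// scale1r !mulr_gt0.
have [_ _ _ pos] := integral_rV_facts n dM0.
have := pos _ (d *: z0) (ccube_combo (w 0) gM) Gge0 Gz0.
rewrite (integral_rV_combo (w 0) dM0 gM) => lt0.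
apply: contraTneq lt0 => E; rewrite -leNgt big1// => i _.
move/rowP/(_ i): E; rewrite !mxE => E.
by rewrite -[integral_rV _]/(integral_rV (g i)) E mulr0.
Qed.

End MollifiedNormal.

(** * Reduction to a scalar unknown *)

Section Reduction.
Context {R : realType} {n : nat}.
Local Notation P := (R * R * 'rV[R]_n)%type.
Implicit Types (s t : R) (x y e : 'rV[R]_n).

Lemma eq_bext_near (Omega : set 'rV[R]_n) (f g : 'rV[R]_n -> R) x :
  (\forall y \near x, f y = g y) -> bext Omega f x = bext Omega g x.
Proof.
move=> fg; rewrite /bext; congr (get _); apply/funext => l; apply/propext.
have near_within (f' g' : 'rV[R]_n -> R) : (\forall y \near x, f' y = g' y) ->
    {near within Omega (nbhs x), f' =1 g'}.
  by move=> fg'; apply: cvg_within.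
split=> lim.
  apply: (cvg_trans _ lim); apply: near_eq_cvg; apply: near_within.
  exact: fg.
apply: (cvg_trans _ lim); apply: near_eq_cvg; apply: near_within.
by apply: filterS fg => y ->.
Qed.

Lemma eq_dder_near (Omega : set 'rV[R]_n) nu (f g : 'rV[R]_n -> R) x :
  (\forall y \near x, f y = g y) -> dder Omega nu f x = dder Omega nu g x.
Proof.
move=> fg; rewrite !dderE; apply: eq_bigr => i _; congr (_ * _).
apply: eq_bext_near; apply: filterS (nbhs_interior fg) => y fgy.
exact: near_eq_derive.
Qed.

Context (Omega0 Gamma0 : set 'rV[R]_n) (u0 : 'rV[R]_n -> R) (s0 : R).
Context (phi psi : R -> R -> 'rV[R]_n -> 'rV[R]_n).
Context (F Z : P -> 'rV[R]_n) (OF OZ : set P).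
Context (H : flow_extension s0 phi psi F Z OF OZ).
Context (nud : 'rV[R]_n -> 'rV[R]_n) (h : R -> 'rV[R]_n -> R) (N : set 'rV[R]_n).
Context (oN : open N) (GN : Gamma0 `<=` N).
Context (nudE : forall t z, 0 <= t -> N z -> nu_phi phi t z = h t z *: nud z).
Context (nud0 : forall x, Gamma0 x -> nud x != 0).
Let nu0 := unit_normal Omega0.

Lemma dder_field t x : 0 <= t -> N x ->
  dder Omega0 (nu_phi phi t) u0 x = dder Omega0 nud u0 x * h t x.
Proof.
move=> t0 Nx; rewrite !dderE mulr_suml; apply: eq_bigr => i _.
by rewrite nudE// mxE -mulrA mulrC.
Qed.

(** Where the field does not vanish the coefficient h is a quotient of
components, hence differentiable in time. *)
Lemma derive_t_field t x : 0 < t -> Gamma0 x ->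
  'D_1 (fun t' => nu_phi phi t' x) t = 'D_1 (fun t' => h t' x) t *: nud x.
Proof.
move=> t0 Gx; have z0 := range0 H.
have [i nudi] : exists i, nud x 0 i != 0.
  apply: contrapT => /forallNP np; move: (nud0 Gx); apply/negP; rewrite negbK.
  by apply/eqP/rowP => i; rewrite mxE; apply/eqP; move: (np i) => /negP; rewrite negbK.
have dnu : differentiable (fun t' => nu_phi phi t' x) t.
  have dD : differentiable (fun t' => 'D_dir_s F (0, t', x)) t.
    apply: (@slice_t_differentiable _ _ _ ('D_dir_s F)).
    exact: (Ck_differentiable (Ck_derive _ (flow_CkF H)) (flow_domF H x z0 (ltW t0))).
  apply: near_eq_differentiable dD; near=> t'; rewrite (nu_phiE H)//.
  by near: t'; exact: near_ge0.
have near_eq : \forall t' \near t, nu_phi phi t' x = h t' x *: nud x.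
  by near=> t'; apply: nudE; [near: t'; exact: near_ge0|exact: GN].
have dh : derivable (fun t' => h t' x) t 1.
  have Di := is_derive_coord (1 : R) i dnu.
  have Dc := @is_deriveZ _ _ _ _ (nud x 0 i)^-1 t (1 : R) _ Di.
  apply: near_eq_derivable (@ex_derive _ _ _ _ _ _ _ Dc).
  apply: filterS near_eq => t' E; rewrite /= E /GRing.scale/= mxE.
  by rewrite mulrC mulfK.
apply/rowP => k; rewrite mxE.
rewrite -(derive_val (is_derive := is_derive_coord (1 : R) k dnu)).
have E : 'D_1 (fun t' => nu_phi phi t' x 0 k) t = 'D_1 (nud x 0 k *: (fun t' => h t' x)) t.
  apply: near_eq_derive; apply: filterS near_eq => t' ->.
  by rewrite mxE mulrC.
by apply: etrans E _; rewrite deriveZ// mulrC.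
Unshelve. all: by end_near. Qed.

Lemma reduced_iff (w : R -> 'rV[R]_n -> R) :
  linearized_system Omega0 Gamma0 u0 w (nu_phi phi) <->
  reduced_system Omega0 Gamma0 u0 nud w h.
Proof.
have E2 t x : 0 < t -> Gamma0 x ->
    dder Omega0 (nu_phi phi t) u0 x = dder Omega0 nud u0 x * h t x.
  by move=> t0 /GN Nx; rewrite dder_field// ltW.
have E4 t x : 0 < t -> Gamma0 x -> dot (nu0 x) ('D_1 (fun t' => nu_phi phi t' x) t) =
    dot (nud x) (nu0 x) * 'D_1 (fun t' => h t' x) t.
  by move=> t0 Gx; rewrite derive_t_field// dotZr dotC mulrC.
have E4' t x : 0 < t -> Gamma0 x -> dder Omega0 nu0 (dder Omega0 (nu_phi phi t) u0) x =
    dder Omega0 nu0 (fun z => dder Omega0 nud u0 z * h t z) x.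
  move=> t0 Gx; apply: eq_dder_near; near=> y; apply: dder_field; first exact: ltW.
  by near: y; exact: (open_nbhs_nbhs (conj oN (GN Gx))).
have E5 x : Gamma0 x -> nu_phi phi 0 x = 0 <-> h 0 x = 0.
  move=> Gx; rewrite nudE//; last exact: GN.
  split => [/eqP|->]; last exact: scale0r.
  by rewrite scaler_eq0 (negPf (nud0 Gx)) orbF => /eqP.
split=> -[e1 e2 e3 e4 e5]; split.
- exact: e1.
- by move=> t x t0 Gx; apply: etrans (e2 t x t0 Gx) _; rewrite E2.
- exact: e3.
- move=> t x t0 Gx; apply: etrans (esym (E4 t x t0 Gx)) _.
  by apply: etrans (e4 t x t0 Gx) _; rewrite (E4' t x t0 Gx).
- by move=> x Gx; apply/(E5 x Gx); exact: e5.
- exact: e1.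
- by move=> t x t0 Gx; apply: etrans (e2 t x t0 Gx) _; rewrite E2.
- exact: e3.
- move=> t x t0 Gx; apply: etrans (E4 t x t0 Gx) _.
  by apply: etrans (e4 t x t0 Gx) _; rewrite (E4' t x t0 Gx).
- by move=> x Gx; apply/(E5 x Gx); exact: e5.
Unshelve. all: by end_near. Qed.

End Reduction.

(** * Linearization of the Stefan problem *)

Unset Implicit Arguments.
Set Strict Implicit.
Set Printing Implicit Defensive.

Theorem proposition5p4 (R : realType) (n : nat) (alpha : R)
  (Omega0 Gamma0 : set 'rV[R]_n) (f u0 : 'rV[R]_n -> R)
  (s0 : R) (phi psi : R -> R -> 'rV[R]_n -> 'rV[R]_n)
  (v : R -> R -> 'rV[R]_n -> R)
  (r0 : R) (Y : 'rV[R]_n -> 'rV[R]_n) (r : 'rV[R]_n -> R) (eta : R -> R)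
  (m : 'rV[R]_n -> R)
  (hn : (0 < n)%N) (halpha : 0 < alpha < 1)
  (hGamma : bounds_domain alpha Gamma0 Omega0)
  (hf : smooth f)
  (hu0 : buc 2 alpha Omega0 u0)
  (hs0 : 0 < s0)
  (hphi : diffeo_family s0 phi psi)
  (hflow : flows_into s0 Omega0 phi)
  (hv : pulled_back_regular s0 Omega0 v)
  (htub : tubular_coordinates Gamma0 (unit_normal Omega0) r0 Y r)
  (heta : cutoff r0 eta)
  (hm : mollifier m) :
  let nu0 := unit_normal Omega0 in
  let nuphi := nu_phi phi in
  let w := wbar v in
  let nud delta := mollify m delta (nu_tilde Gamma0 nu0 r0 Y r eta) in
  [/\ (* the Stefan problem for u = u0 + ubar gives the pulled back equations *)
      (forall s, 0 <= s < s0 ->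
         stefan_problem Omega0 Gamma0 f u0 (phi s)
           (fun t y => u0 y + phi_push psi v s t y)) ->
      pulled_back_equations Omega0 Gamma0 u0 phi psi v (solves s0),
      (* these equations give the linearized system *)
      pulled_back_equations Omega0 Gamma0 u0 phi psi v (solves s0) ->
      linearized_system Omega0 Gamma0 u0 w nuphi,
      (* that system expresses equality of the s-derivatives of both sides, also
         for families which need not solve the equations *)
      (forall t x, 0 < t -> Gamma0 x ->
         bext Omega0 u0 x = 0 /\
         dot (nu0 x) ('D_(nu0 x) (nuphi t) x) * dder Omega0 nu0 u0 x = 0) ->
      (linearization Omega0 Gamma0 u0 phi psi v <->
       linearized_system Omega0 Gamma0 u0 w nuphi)
    & (* reduction for nu_phi = h nu^delta, with delta small *)
      exists2 delta0 : R, 0 < delta0 &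
      forall delta, 0 < delta < delta0 ->
      forall (h : R -> 'rV[R]_n -> R) (N : set 'rV[R]_n),
        open N -> Gamma0 `<=` N ->
        (forall t z, 0 <= t -> N z -> nuphi t z = h t z *: nud delta z) ->
        [/\ forall t x, 0 < t -> Gamma0 x ->
              dder Omega0 (nuphi t) u0 x = dder Omega0 (nud delta) u0 x * h t x,
            forall t x, 0 < t -> Gamma0 x ->
              dot (nu0 x) ('D_1 (fun t' => nuphi t' x) t) =
              dot (nud delta x) (nu0 x) * 'D_1 (fun t' => h t' x) t
          & linearized_system Omega0 Gamma0 u0 w nuphi <->
            reduced_system Omega0 Gamma0 u0 (nud delta) w h]].
Proof.
move=> nu0 nuphi w nud.
have [[oOm _ Om0] cptG GE ch] := hGamma.
have [uC _] := hu0.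
have [F [Z [OF [OZ H]]]] := flow_extension_exists hs0 hphi.
have [hv3 hv2 vt0 v0] := hv.
have [V3 [OV3 HV3]] := pullback_extension_exists hv3.
have [V2 [OV2 HV2]] := pullback_extension_exists hv2.
have Gcl x : Gamma0 x -> closure Omega0 x by rewrite GE => -[].
have stab s t y : 0 <= s < s0 -> 0 <= t -> Omega0 y -> Omega0 (phi s t y).
  by move=> sE t0 Oy; apply: (hflow s t sE t0); exists y.
have charts x : Gamma0 x -> exists (U : set 'rV[R]_n) (rho : 'rV[R]_n -> R),
    [/\ [/\ open U, U x & Ck 1 U rho], forall z, U z -> Omega0 z <-> rho z < 0,
      forall z, U z -> Gamma0 z <-> rho z = 0 & forall z, U z -> grad rho z != 0].
  move=> Gx; have [U [rho [oU Ux [rC _] Uz]]] := ch x Gx.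
  exists U, rho; split; first by split => //; exact: CkW.
  - by move=> z /Uz[].
  - by move=> z /Uz[].
  - by move=> z /Uz[].
have charts' x : Gamma0 x -> exists (U : set 'rV[R]_n) (rho : 'rV[R]_n -> R),
    [/\ [/\ open U, U x & Ck 1 U rho], forall z, U z -> Omega0 z <-> rho z < 0,
      forall z, U z -> Gamma0 z <-> rho z = 0 & grad rho x != 0].
  move=> Gx; have [U [rho [[oU Ux rC] Un UG g0]]] := charts x Gx.
  by exists U, rho; split => //; exact: g0.
have ext l y : (size l <= 2)%N -> closure Omega0 y ->
    cvg (pderivs l u0 @ within Omega0 (nbhs y)).
  move=> l2 cy; apply: uniform_cvg_bext => //.
  exact: (buc_uniform hn oOm Om0 hu0 l2).
have cu0 y : closure Omega0 y -> cvg (u0 @ within Omega0 (nbhs y)).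
  exact: (@ext [::] y).
have cu1 k y : closure Omega0 y -> cvg ('D_(ebase R k) u0 @ within Omega0 (nbhs y)).
  exact: (@ext [:: k] y).
have cu2 i k y : closure Omega0 y ->
    cvg ('D_(ebase R i) ('D_(ebase R k) u0) @ within Omega0 (nbhs y)).
  exact: (@ext [:: i; k] y).
split.
- exact: (stefan_pulled_back oOm Gcl H stab HV2 v0 uC cu0 cu1).
- exact: (solution_linearized oOm Gcl H stab HV3 HV2 v0 vt0 uC cu0 cu1 cu2 charts').
- exact: (linearization_iff oOm Gcl H stab HV3 HV2 v0 vt0 uC cu0 cu1 cu2 charts').
have [d0 d00 nz] := mollified_normal_neq0 charts htub heta hm cptG.
exists d0 => // d dd h N oN GN nudE; have {}nz := nz d dd.
split.
- by move=> t x t0 Gx; exact: (dder_field Omega0 u0 nudE (ltW t0) (GN x Gx)).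
- move=> t x t0 Gx.
  rewrite (derive_t_field H GN nudE nz t0 Gx) dotZr dotC; exact: mulrC.
- exact: (reduced_iff Omega0 u0 H oN GN nudE nz w).
Qed.
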